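(* Let $\psi_k=(\psi,v_k)$. Consider, for given $T>0$, $t_0\in(0,T)$, $\rho\in(0,1]$, $g$ and $\psi\in D(A)$, the inverse problem of finding a pair $\{u(t),f\}$ with $$D_t^\rho u(t)+Au(t)=f\,g(t),\quad t\in(0,T],\qquad u(T)=u(0),\qquad u(t_0)=\psi,$$ and the following assertions. (1) If $K_{0,\rho}$ is empty, i.e. $\Delta_\rho(k,t_0,T)\ne0$ for all $k$, then the inverse problem has a unique solution, given by $$f=\sum_{k=1}^\infty f_kv_k,\qquad u(t)=\sum_{k=1}^\infty f_k\left[b_{k,\rho}(t)+\frac{b_{k,\rho}(T)}{1-E_\rho(-\lambda_kT^\rho)}E_\rho(-\lambda_kt^\rho)\right]v_k,$$ $$f_k=\frac{\psi_k(1-E_\rho(-\lambda_kT^\rho))}{\Delta_\rho(k,t_0,T)}.$$ (2) If $K_{0,\rho}$ is not empty, then a solution of the inverse problem exists if and only if $\psi_k=0$ for all $k\in K_{0,\rho}$. In this case the solution exists but is not unique, and the solutions are given by $$f=\sum_{k\in K_\rho}\frac{\psi_k(1-E_\rho(-\lambda_kT^\rho))}{\Delta_\rho(k,t_0,T)}v_k+\sum_{k\in K_{0,\rho}}f_kv_k,$$ $$u(t)=\sum_{k=1}^\infty f_k\left[b_{k,\rho}(t)+\frac{b_{k,\rho}(T)}{1-E_\rho(-\lambda_kT^\rho)}E_\rho(-\lambda_kt^\rho)\right]v_k,$$ where $f_k=\psi_k(1-E_\rho(-\lambda_kT^\rho))/\Delta_\rho(k,t_0,T)$ for $k\in K_\rho$,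 and $f_k$, $k\in K_{0,\rho}$, are arbitrary numbers (scalars of $H$). Then: (a) Case $\rho=1$: if $T>0$, $g\in C^1[0,T]$, $g(T)\ne0$, $t_0\in(0,T)$ satisfies $g(t_0)g(T)>0$, and $\psi\in D(A)$, then (1) and (2) hold. (b) Case $\rho\in(0,1)$: if $\bar T>0$, $g\in C^1[0,\bar T]$ and $g(0)\ne0$, then for all sufficiently small $T$, i.e. there is $T_0\in(0,\bar T]$ such that for every $T\in(0,T_0]$, every $t_0\in(0,T)$ and every $\psi\in D(A)$, (1) and (2) hold.
   Context: $H$ is a separable Hilbert space with scalar product $(\cdot,\cdot)$ and norm $\|\cdot\|$. $A$ is a self-adjoint positive operator in $H$ with domain $D(A)$ whose inverse is compact; $\{v_k\}_{k\ge1}$ is a complete orthonormal system of eigenfunctions of $A$ with eigenvalues $0<\lambda_1\le\lambda_2\le\cdots\to+\infty$, $Av_k=\lambda_kv_k$. The function $g$ is a given real-valued scalar function. The Caputo derivative of order $\rho\in(0,1)$ of $h:\mathbb{R}_+\to H$ is $$D_t^\rho h(t)=\frac{1}{\Gamma(1-\rho)}\int_0^t\frac{h'(\xi)}{(t-\xi)^\rho}\,d\xi,\quad t>0,$$ provided the right-hand side exists; for $\rho=1$, $D_t^1h=\frac{dh}{dt}$. The Mittag-Leffler functions are $E_{\rho,\mu}(z)=\sum_{k=0}^\infty\frac{z^k}{\Gamma(\rho k+\mu)}$ and $E_\rho(z)=E_{\rho,1}(z)$ (so $E_1(z)=E_{1,1}(z)=e^z$). Set $$b_{k,\rho}(t)=\int_0^t(t-s)^{\rho-1}E_{\rho,\rho}(-\lambda_k(t-s)^\rho)\,g(s)\,ds,$$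 $$\Delta_\rho(k,t_0,T)=(1-E_\rho(-\lambda_kT^\rho))\,b_{k,\rho}(t_0)+E_\rho(-\lambda_kt_0^\rho)\,b_{k,\rho}(T),$$ $$K_{0,\rho}=\{k\in\mathbb{N}:\Delta_\rho(k,t_0,T)=0\},\qquad K_\rho=\mathbb{N}\setminus K_{0,\rho}.$$ A solution of the inverse problem is a pair $\{u(t),f\}$ with $f\in H$, $u\in C([0,T];H)$ and $D_t^\rho u,\ Au\in C((0,T];H)$ satisfying the equation at each $t\in(0,T]$ and the conditions $u(T)=u(0)$ and $u(t_0)=\psi$. *)

(* Defs.v *)
From mathcomp Require Import all_boot all_order all_algebra.
From mathcomp Require Import complex.
From mathcomp Require Import all_classical all_reals all_analysis.

Set Implicit Arguments.
Unset Strict Implicit.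
Unset Printing Implicit Defensive.

Import Order.TTheory GRing.Theory Num.Theory.
Import numFieldNormedType.Exports.

Local Open Scope classical_set_scope.
Local Open Scope ring_scope.

(* The scalar field of a Hilbert space is either R or C = R[i].  Norms of
   a normedModType are valued in its scalar field, whence [re_scalar]. *)
Inductive scalar_kind := RealScalars | ComplexScalars.

Definition scalar_field (R : realType) (k : scalar_kind) : numFieldType :=
  match k with
  | RealScalars => R : numFieldType
  | ComplexScalars => R[i] : numFieldType
  end.

Definition of_real (R : realType) (k : scalar_kind) : R -> scalar_field R k :=
  match k with
  | RealScalars => fun x => x
  | ComplexScalars => fun x => Complex x 0
  end.

Definition re_scalar (R : realType) (k : scalar_kind) : scalar_field R k -> R :=
  match k with
  | RealScalars => fun x => x
  | ComplexScalars => fun z => complex.Re z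
  end.

Definition conj_scalar (R : realType) (k : scalar_kind) :
    scalar_field R k -> scalar_field R k :=
  match k with
  | RealScalars => fun x => x
  | ComplexScalars => fun z => Num.conj z
  end.

Arguments of_real {R} k.
Arguments re_scalar {R} k.
Arguments conj_scalar {R} k.

(* Difference quotients are restricted to the set S, so that the derivative is
   one-sided at an endpoint of an interval and depends only on h on S. *)
Definition derivative_within (R : realType) (K : numFieldType)
    (V : normedModType K) (e : R -> K) (S : set R) (h : R -> V) (t : R) (l : V)
    : Prop :=
  e ((s - t)^-1) *: (h s - h t) @[s --> within S t^'] --> l.

Definition C1_on (R : realType) (T : R) (g : R -> R) : Prop :=
  exists dg : R -> R,
    (forall t, t \in `[0, T] ->
       derivative_within (V := R^o) (fun x : R => x) `[0, T] g t (dg t)) /\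
    {within `[0, T], continuous dg}.

Section SpecialFunctions.
Context {R : realType}.

(* Euler's integral, used for x > 0 only. *)
Definition Gamma (x : R) : R :=
  \int[lebesgue_measure]_(s in `]0, +oo[) (s `^ (x - 1) * expR (- s)).

Definition mittag_leffler (rho mu z : R) : R :=
  limn (series (fun n : nat => z ^+ n / Gamma (rho * n%:R + mu))).

Definition b_coef (rho : R) (g : R -> R) (lam t : R) : R :=
  \int[lebesgue_measure]_(s in `[0, t])
    ((t - s) `^ (rho - 1)
     * mittag_leffler rho rho (- lam * (t - s) `^ rho) * g s).

Definition Delta (rho : R) (g : R -> R) (lam t0 T : R) : R :=
  (1 - mittag_leffler rho 1 (- lam * T `^ rho)) * b_coef rho g lam t0
  + mittag_leffler rho 1 (- lam * t0 `^ rho) * b_coef rho g lam T.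

End SpecialFunctions.

Section Hilbert.
Context {R : realType} {k : scalar_kind}.
Local Notation K := (scalar_field R k).
Context {H : completeNormedModType K}.
Implicit Types (D : set H) (A : H -> H) (f w psi : H) (u h : R -> H).

Definition separable_space : Prop :=
  exists S : set H, countable S /\ dense S.

Section Bochner.
Local Notation mu := (@lebesgue_measure R).

Definition simple_integral (S : set R) (s : R -> H) (w : H) : Prop :=
  exists (m : nat) (E : 'I_m -> set R) (c : 'I_m -> H),
    [/\ forall i, measurable (E i),
        forall i, (mu (E i) < +oo)%E,
        forall x, s x = \sum_(i < m) of_real k (\1_(E i) x) *: c i
      & w = \sum_(i < m) of_real k (fine (mu (E i `&` S))) *: c i].

(* F is Bochner integrable on S, with integral w. *)
Definition bochner_integral (S : set R) (F : R -> H) (w : H) : Prop :=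
  exists (s : nat -> R -> H) (I : nat -> H),
    [/\ forall n, simple_integral S (s n) (I n),
        {ae mu, forall x, S x -> s n x @[n --> \oo] --> F x},
        (\int[mu]_(x in S) (re_scalar k `|F x - s n x|)%:E)%E @[n --> \oo]
          --> 0%E
      & I n @[n --> \oo] --> w].

End Bochner.

(* w is the value at t of the Caputo derivative of order rho of h, where h is
   only considered on [0, T].  For rho = 1 and t = T the derivative is a left
   derivative. *)
Definition caputo (T rho : R) (h : R -> H) (t : R) (w : H) : Prop :=
  if rho == 1 then derivative_within (of_real k) `[0, T] h t w
  else exists (dh : R -> H) (J : H),
    [/\ forall x, x \in `]0, t[ ->
          derivative_within (of_real k) `[0, T] h x (dh x),
        bochner_integral `]0, t[
          (fun x => of_real k (((t - x) `^ rho)^-1) *: dh x) J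
      & w = of_real k ((Gamma (1 - rho))^-1) *: J].

(* An operator is given by its domain D and a function A, whose values outside
   D are irrelevant. *)
Section Operators.
Variable dot : {dot H for conj_scalar k}.

Definition linear_operator (D : set H) (A : H -> H) : Prop :=
  D 0 /\ forall (a : K) x y, D x -> D y ->
    D (a *: x + y) /\ A (a *: x + y) = a *: A x + A y.

Definition in_adjoint (D : set H) (A : H -> H) (x y : H) : Prop :=
  forall z, D z -> dot (A z) x = dot z y.

Definition self_adjoint (D : set H) (A : H -> H) : Prop :=
  [/\ linear_operator D A, dense D
    & forall x y, in_adjoint D A x y <-> D x /\ A x = y].

Definition positive_operator (D : set H) (A : H -> H) : Prop :=
  forall x, D x -> x != 0 -> 0 < dot (A x) x.

Definition compact_inverse (D : set H) (A : H -> H) : Prop :=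
  set_bij D setT A /\
  forall B : set H, bounded_set B -> precompact (D `&` A @^-1` B).

Definition complete_orthonormal (v : nat -> H) : Prop :=
  (forall i j, dot (v i) (v j) = (i == j)%:R) /\
  (forall x, (forall i, dot x (v i) = 0) -> x = 0).

End Operators.

(* The values of u outside [0, T] are irrelevant. *)
Definition inverse_solution (D : set H) (A : H -> H) (T t0 rho : R)
    (g : R -> R) (psi : H) (u : R -> H) (f : H) : Prop :=
  [/\ {within `[0, T], continuous u},
      forall t, t \in `]0, T] -> D (u t),
      {within `]0, T], continuous (A \o u)},
      exists Du : R -> H,
        [/\ forall t, t \in `]0, T] -> caputo T rho u t (Du t),
            {within `]0, T], continuous Du}
          & forall t, t \in `]0, T] -> Du t + A (u t) = of_real k (g t) *: f]
    & u T = u 0 /\ u t0 = psi].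

Section Assertions.
Variables (dot : {dot H for conj_scalar k}) (D : set H) (A : H -> H).
(* The systems are indexed from 0: v n and lam n stand for v_{n+1} and
   lambda_{n+1}. *)
Variables (v : nat -> H) (lam : nat -> R).
Variables (T t0 rho : R) (g : R -> R) (psi : H).

Local Notation solution := (inverse_solution D A T t0 rho g psi).

Definition K0 : set nat := [set n | Delta rho g (lam n) t0 T = 0].

Definition expansion_on (P : set nat) (c : nat -> K) (w : H) : Prop :=
  (\sum_(0 <= n < N | n \in P) c n *: v n) @[N --> \oo] --> w.

Definition f_coef (n : nat) : K :=
  dot psi (v n) * of_real k (1 - mittag_leffler rho 1 (- lam n * T `^ rho))
  / of_real k (Delta rho g (lam n) t0 T).

Definition u_coef (n : nat) (t : R) : R :=
  b_coef rho g (lam n) t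
  + b_coef rho g (lam n) T / (1 - mittag_leffler rho 1 (- lam n * T `^ rho))
    * mittag_leffler rho 1 (- lam n * t `^ rho).

Definition u_formula (c : nat -> K) (u : R -> H) : Prop :=
  forall t, t \in `[0, T] ->
    expansion_on setT (fun n => c n * of_real k (u_coef n t)) (u t).

Definition assertion1 : Prop :=
  K0 = set0 ->
  exists (u : R -> H) (f : H),
    [/\ solution u f,
        forall u' f', solution u' f' ->
          {in `[0, T], u' =1 u} /\ f' = f,
        expansion_on setT f_coef f
      & u_formula f_coef u].

(* The formulas of the second assertion; the values of c outside K0 are
   irrelevant. *)
Definition solution_formula (c : nat -> K) (u : R -> H) (f : H) : Prop :=
  (exists f1 f2 : H,
    [/\ expansion_on (~` K0) f_coef f1, expansion_on K0 c f2 & f = f1 + f2]) /\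
  u_formula (fun n => if n \in K0 then c n else f_coef n) u.

Definition assertion2 : Prop :=
  K0 !=set0 ->
  ((exists u f, solution u f) <-> (forall n, K0 n -> dot psi (v n) = 0)) /\
  ((forall n, K0 n -> dot psi (v n) = 0) ->
   [/\ exists u1 f1 u2 f2, [/\ solution u1 f1, solution u2 f2
         & ~ ({in `[0, T], u1 =1 u2} /\ f1 = f2)],
       forall c : nat -> K, exists u f, solution_formula c u f
     & forall u f, solution u f <-> exists c, solution_formula c u f]).

End Assertions.
End Hilbert.

Arguments separable_space {R k} H.

(* Main.v *)
(* Expanding in the eigenfunctions reduces the problem to the scalar equations
   D^rho y + lam y = phi g.  Put k(t) = t^(rho-1) / Gamma(rho), e(t) = t^(rho-1) E_{rho,rho}(- lam t^rho)
   and s(t) = E_rho(- lam t^rho).  Then e is the resolvent of lam k, i.e. e = k - lam k * e, and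
   s = 1 - lam 1 * e.

   Uniqueness: y is differentiable on the open interval with an integrable derivative, hence it is
   the integral of its derivative, and the equation turns into the Volterra equation
   y + lam k * y = y(0) + phi k * g, whose only solution is y(0) s + phi e * g.  The condition
   u(T) = u(0) determines y(0), and u(t0) = psi becomes f_n Delta_n = psi_n (1 - s(T)).

   Asymptotics: for rho < 1 the strict log-convexity of k forbids a first zero of e, so that e > 0,
   and 0 <= s <= (1 + lam t^rho / Gamma(rho + 1))^-1.  Therefore lam b(t) = g(t) + O(1 / lam) and
   lam_n Delta_n tends to g(t0).  Only g(t0) <> 0 is needed: then K_0 is finite and the f_n are
   O(lam_n |psi_n|), hence square summable since psi lies in D(A).  In case (b), T0 is chosen so that
   g does not vanish on [0, T0].

   Existence: all limits in H (continuity of u and Au, difference quotients, approximating simple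
   functions of the Bochner integral) are of the form sum_n c_n a_n v_n with c square summable and
   multipliers a_n that are bounded uniformly in n and converge for each n. *)
From HB Require Import structures.
Require Import Defs.
From mathcomp Require Import all_boot all_order all_algebra.
From mathcomp Require Import interval_inference complex ring lra.
From mathcomp Require Import all_classical all_reals all_analysis.
From mathcomp Require Import measurable_realfun.

Set Implicit Arguments.
Unset Strict Implicit.
Unset Printing Implicit Defensive.

Import Order.TTheory GRing.Theory Num.Theory.
Import numFieldNormedType.Exports.

Local Open Scope classical_set_scope.
Local Open Scope ring_scope.

(** * Substitution in the Lebesgue integral *)

(** There are two obstacles: the singularity of [k] at 0, which makes derivatives unbounded, and the
    definition of the Caputo derivative, which yields a derivative that is only weighted-integrable.
    Against the first, functions are extended by 0 to the negative half-line and convolved over the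
    whole line. The power kernels [k_a(t) = t^(a-1) / Gamma(a)] form a convolution semigroup
    (Euler's beta integral) and [k_1] is the Heaviside function, so that integration, fractional
    integration and the Caputo derivative are all convolutions and the calculus reduces to
    associativity. The Mittag-Leffler kernels are series of power kernels, hence convolution with
    [k_b] only raises their second index by [b]. The second obstacle calls for the fundamental
    theorem for differentiable functions with an integrable derivative. Vector equations are tested
    against [b v_n] with [nrm b <= 1] and real parts are taken, which treats real and complex
    scalars together. For [rho = 1] the kernel [k] is constant, strict log-convexity is lost, and
    positivity comes from the differential equation. *)

Section LebesgueSubstitution.
Context {R : realType}.
Local Notation mu := (@lebesgue_measure R).
Implicit Types (t c : R).

Let measurable_reflect t :
  measurable_fun setT ((fun x => t - x) : measurableTypeR R -> measurableTypeR R).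
Proof. exact: measurable_funB. Qed.

Let reflect_mfun t : {mfun measurableTypeR R >-> measurableTypeR R} :=
  HB.pack ((fun x => t - x) : measurableTypeR R -> measurableTypeR R)
    (isMeasurableFun.Build _ _ _ _ _ (measurable_reflect t)).

Let measurable_scale c :
  measurable_fun setT ((fun x => c * x) : measurableTypeR R -> measurableTypeR R).
Proof. exact: measurable_funM. Qed.

Let dilation_mfun c : {mfun measurableTypeR R >-> measurableTypeR R} :=
  HB.pack ((fun x => c * x) : measurableTypeR R -> measurableTypeR R)
    (isMeasurableFun.Build _ _ _ _ _ (measurable_scale c)).

Let pushforward_dilation c : {measure set (measurableTypeR R) -> \bar R} :=
  measure_function_pushforward__canonical__measure_function_Measure mu (measurable_scale c).

(** Lebesgue measure is determined by its values on half-open intervals. Reflection moves the closed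
    end to the other side, which leaves the length unchanged. *)
Lemma lebesgue_measure_reflect t (A : set R) : measurable A ->
  pushforward mu (reflect_mfun t) A = mu A.
Proof.
move=> mA; apply/esym/lebesgue_measure_unique => //= _ [[a b]] _ <-.
rewrite /pushforward.
have -> : (fun x => t - x) @^-1` `]a, b]%classic = `[t - b, t - a[%classic.
  by apply/seteqP; split => x /=; rewrite !in_itv/= => /andP[h1 h2]; apply/andP; split; lra.
rewrite !lebesgue_measure_itv/= !lte_fin.
have -> : (t - b < t - a) = (a < b) by apply/idP/idP => ?; lra.
by case: ifPn => // _; rewrite -!EFinB; congr (_%:E); ring.
Qed.

Lemma ge0_integral_reflect t (f : R -> \bar R) :
  measurable_fun setT f -> (forall x, 0 <= f x)%E ->
  (\int[mu]_x f (t - x)%R = \int[mu]_x f x)%E.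
Proof.
move=> mf f0.
transitivity (\int[pushforward mu (reflect_mfun t)]_x f x)%E.
  by rewrite ge0_integral_pushforward//; exact: measurable_reflect.
by apply: eq_measure_integral => //= A mA _; exact: lebesgue_measure_reflect.
Qed.

Lemma integral_reflect t (f : R -> \bar R) : measurable_fun setT f ->
  (\int[mu]_x f (t - x)%R = \int[mu]_x f x)%E.
Proof.
move=> mf; rewrite integralE [RHS]integralE; congr (_ - _)%E.
- rewrite -[RHS](ge0_integral_reflect t (measurable_funepos mf) (funepos_ge0 f)).
  by apply: eq_integral => x _; rewrite !funeposE.
- rewrite -[RHS](ge0_integral_reflect t (measurable_funeneg mf) (funeneg_ge0 f)).
  by apply: eq_integral => x _; rewrite !funenegE.
Qed.

(** A translation is the composition of [x |-> t - x] and [x |-> - x]. *)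
Lemma integral_shift t (f : R -> \bar R) : measurable_fun setT f ->
  (\int[mu]_x f (x - t)%R = \int[mu]_x f x)%E.
Proof.
move=> mf; rewrite -(integral_reflect t); last first.
  by apply: measurableT_comp => //; exact: measurable_funB.
rewrite -[RHS](integral_reflect 0)//; apply: eq_integral => x _.
by congr (f _); ring.
Qed.

Lemma lebesgue_measure_scale c (A : set R) : 0 < c -> measurable A ->
  (c%:E * pushforward mu (dilation_mfun c) A)%E = mu A.
Proof.
move=> c0 mA.
pose m' : {measure set (measurableTypeR R) -> \bar R} :=
  mscale (NngNum (ltW c0)) (pushforward_dilation c).
transitivity (m' A) => //.
apply/esym/(lebesgue_measure_unique (mu := m')) => //= _ [[a b]] _ <-.
rewrite /m' /mscale/= /pushforward.
have -> : (fun x => c * x) @^-1` `]a, b]%classic = `](c^-1 * a), (c^-1 * b)]%classic.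
  apply/seteqP; split => x /=; rewrite !in_itv/= => /andP[h1 h2]; apply/andP; split.
  - by rewrite mulrC ltr_pdivrMr// mulrC.
  - by rewrite mulrC ler_pdivlMr// mulrC.
  - by move: h1; rewrite mulrC ltr_pdivrMr// mulrC.
  - by move: h2; rewrite mulrC ler_pdivlMr// mulrC.
rewrite !lebesgue_measure_itv/= !lte_fin ltr_pM2l ?invr_gt0//.
case: ifPn => // _; last by rewrite mule0.
by rewrite -!EFinB -EFinM; congr (_%:E); field; rewrite gt_eqF.
Qed.

Lemma ge0_integral_scale c (f : R -> \bar R) : 0 < c ->
  measurable_fun setT f -> (forall x, 0 <= f x)%E ->
  (c%:E * \int[mu]_x f (c * x)%R = \int[mu]_x f x)%E.
Proof.
move=> c0 mf f0.
transitivity (\int[mscale (NngNum (ltW c0)) (pushforward_dilation c)]_x f x)%E.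
  rewrite ge0_integral_mscale//=; congr (_ * _)%E.
  by rewrite ge0_integral_pushforward//; exact: measurable_scale.
by apply: eq_measure_integral => //= A mA _; exact: lebesgue_measure_scale.
Qed.

End LebesgueSubstitution.

(** * The Gamma function *)

Section Gamma.
Context {R : realType}.
Local Notation mu := (@lebesgue_measure R).
Implicit Types (a b t x : R).

(** Cut off at 0, so that integrals over half-lines and over [[0, t]] become integrals over the
    whole line, where reflection, translation and Tonelli apply directly. *)
Definition trunc_pow a x : R := if 0 < x then x `^ (a - 1) else 0.

Lemma trunc_pow_ge0 a x : 0 <= trunc_pow a x.
Proof. by rewrite /trunc_pow; case: ifP => // _; exact: powR_ge0. Qed.

Lemma measurable_trunc_pow a : measurable_fun setT (trunc_pow a).
Proof.
have -> : trunc_pow a = (@powR R ^~ (a - 1)) \_ `]0, +oo[.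
  by apply/funext => x; rewrite patchE mem_setE in_itv/= andbT.
apply/(measurable_restrictT _ _).1 => //.
by apply: measurable_funTS; exact: measurable_powR.
Qed.

(** The primitive [x^a / a] bounds the integral over [[1 / (n + 1), 1]] by [1 / a]; these intervals
    exhaust []0, 1]] and avoid the possible singularity at 0. *)
Lemma integral_trunc_pow01 a : 0 < a ->
  (\int[mu]_(x in `]0%R, 1%R]) (trunc_pow a x)%:E < +oo)%E.
Proof.
move=> a0.
pose F (n : nat) : set R := `[n.+1%:R^-1, 1]%classic.
have F0 n x : F n x -> 0 < x.
  by rewrite /F/= in_itv/= => /andP[+ _]; apply: lt_le_trans; rewrite invr_gt0.
have UF : \bigcup_n F n = `]0, 1]%classic.
  apply/seteqP; split => [x [n _ Fx]|x /=]; rewrite /= in_itv/=.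
    by rewrite (F0 _ _ Fx) /=; move: Fx; rewrite /F/= in_itv/= => /andP[].
  move=> /andP[x0 x1]; exists (Num.truncn x^-1) => //; rewrite /F/= in_itv/= x1 andbT.
  by rewrite invf_ple ?posrE//; exact/ltW/truncnS_gt.
have nF : nondecreasing_seq F.
  apply/nondecreasing_seqP => n; apply/subsetPset => x; rewrite /F/= !in_itv/= => /andP[+ ->].
  by rewrite andbT; apply: le_trans; rewrite lef_pV2 ?posrE// ler_nat.
have mq (A : set R) : measurable_fun A (EFin \o trunc_pow a).
  by apply/measurable_EFinP/measurable_funTS; exact: measurable_trunc_pow.
have cF : (\int[mu]_(x in F n) (trunc_pow a x)%:E @[n --> \oo] -->
    \int[mu]_(x in `]0%R, 1%R]) (trunc_pow a x)%:E)%E.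
  rewrite -UF; apply: ge0_nondecreasing_set_cvg_integral => //.
  - by move=> i; exact: measurable_itv.
  - by move=> i; exact: mq.
  - by move=> i x _; rewrite lee_fin trunc_pow_ge0.
apply: (@le_lt_trans _ _ (a^-1)%:E); last exact: ltry.
rewrite -(cvg_lim _ cF)//; apply: lime_le; first by apply/cvg_ex; eexists; exact: cF.
apply: nearW => n /=.
(* For [n = 0] the interval is the single point 1, to which the fundamental theorem does not
   apply. *)
have [->|n0] := eqVneq n 0%N.
  rewrite /F invr1 set_itv1 integral_set1 lee_fin invr_ge0; exact: ltW.
have n1 : (n.+1%:R : R)^-1 < 1 by rewrite invf_lt1// ltr1n ltnS lt0n.
have -> : (\int[mu]_(x in F n) (trunc_pow a x)%:E = \int[mu]_(x in F n) (x `^ (a - 1))%:E)%E.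
  by apply: eq_integral => x /set_mem/F0 x0; rewrite /trunc_pow x0.
have dF x : 0 < x -> is_derive x 1 (fun x => a^-1 * x `^ a) (x `^ (a - 1)).
  move=> x0; have dp := @is_derive1_powR R a x x0.
  have := @is_deriveZ _ _ _ _ a^-1 _ _ _ dp.
  by rewrite /GRing.scale/= mulrA mulVf ?mul1r// gt_eqF.
have contF x : 0 < x -> {for x, continuous (fun x => a^-1 * x `^ a)}.
  move=> x0; apply: differentiable_continuous; apply/derivable1_diffP.
  exact: (@ex_derive _ _ _ _ _ _ _ (dF _ _)).
have cont p x : 0 < x -> {for x, continuous (fun x => x `^ p)}.
  move=> x0; apply: differentiable_continuous; apply/derivable1_diffP.
  by apply: derivable_powR; rewrite in_itv/= x0.
rewrite (@continuous_FTC2 _ _ (fun x => a^-1 * x `^ a))//; last first.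
- move=> x; rewrite in_itv/= => /andP[h _].
  have x0 : 0 < x by apply: lt_trans h; rewrite invr_gt0.
  by rewrite derive1E; apply: derive_val; exact: dF.
- split.
  + move=> x; rewrite in_itv/= => /andP[h _].
    have x0 : 0 < x by apply: lt_trans h; rewrite invr_gt0.
    exact: (@ex_derive _ _ _ _ _ _ _ (dF x x0)).
  + by apply: cvg_at_right_filter; apply: contF; rewrite invr_gt0.
  + by apply: cvg_at_left_filter; apply: contF.
- apply: continuous_in_subspaceT => x /set_mem/F0 x0; exact: cont.
by rewrite -EFinB lee_fin powR1 mulr1 gerBl mulr_ge0// ?invr_ge0 ?powR_ge0// ltW.
Qed.

Definition gamma_fun a x : R := trunc_pow a x * expR (- x).

Lemma gamma_fun_ge0 a x : 0 <= gamma_fun a x.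
Proof. by rewrite mulr_ge0 ?expR_ge0 ?trunc_pow_ge0. Qed.

Lemma measurable_gamma_fun a : measurable_fun setT (gamma_fun a).
Proof.
apply: measurable_funM; first exact: measurable_trunc_pow.
by apply: measurableT_comp => //; exact: measurable_expR.
Qed.

(** [x^(a-1) <= x^(n+1) <= 2^(n+1) (n+1)! e^(x/2)] by the exponential series at [x / 2]. What is
    left of [e^(-x)] is, up to the factor 2, the density of the exponential law of rate [1 / 2],
    whose integral is known. *)
Lemma gamma_fun_le_exp a : exists C, forall x, 1 <= x ->
  gamma_fun a x <= C * exponential_pdf 2^-1 x.
Proof.
pose n := Num.truncn (`|a| + 1).
exists (2 ^+ n.+1 * n.+1`!%:R * 2) => x x1.
have x0 : 0 < x by lra.
rewrite /gamma_fun /trunc_pow x0 (exponential_pdfE _ (ltW x0)).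
have h1 : x `^ (a - 1) <= x ^+ n.+1.
  rewrite -(powR_mulrn _ (ltW x0)); apply: ler_powR => //.
  have : `|a| + 1 < n.+1%:R by exact: truncnS_gt.
  by move=> h; have := ler_norm a; lra.
have h2 : x ^+ n.+1 <= 2 ^+ n.+1 * n.+1`!%:R * expR (x / 2).
  have := @expR_ge1Dxn _ (x / 2) n (divr_ge0 (ltW x0) (ler0n _ 2)).
  rewrite expr_div_n => h.
  have -> : x ^+ n.+1 = 2 ^+ n.+1 * n.+1`!%:R * (x ^+ n.+1 / 2 ^+ n.+1 / n.+1`!%:R).
    field; rewrite expf_neq0//= pnatr_eq0 -lt0n fact_gt0//.
  apply: ler_wpM2l; last lra.
  by rewrite mulr_ge0// exprn_ge0.
apply: (@le_trans _ _ (2 ^+ n.+1 * n.+1`!%:R * expR (x / 2) * expR (- x))).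
  by apply: ler_wpM2r; [exact: expR_ge0|exact: le_trans h1 h2].
rewrite -!mulrA -expRD; apply: ler_wpM2l; first exact: exprn_ge0.
apply: ler_wpM2l => //.
have -> : x / 2 - x = - 2^-1 * x by field.
by rewrite mulrA divff// mul1r.
Qed.

Lemma integral_gamma_fun_lty a : 0 < a -> (\int[mu]_x (gamma_fun a x)%:E < +oo)%E.
Proof.
move=> a0.
have mg (A : set R) : measurable_fun A (EFin \o gamma_fun a).
  by apply/measurable_EFinP/measurable_funTS; exact: measurable_gamma_fun.
have [C hC] := gamma_fun_le_exp a.
have C0 : 0 <= `|C| by [].
pose G x : \bar R := (((trunc_pow a) \_ `]0, 1]) x)%:E + (`|C| * exponential_pdf 2^-1 x)%:E.
have mq : measurable_fun setT (fun x : R => (((trunc_pow a) \_ `]0, 1]) x)%:E).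
  apply/measurable_EFinP; apply/(measurable_restrictT _ _).1 => //.
  by apply: measurable_funTS; exact: measurable_trunc_pow.
have me : measurable_fun setT (fun x : R => (`|C| * exponential_pdf 2^-1 x)%:E).
  by apply/measurable_EFinP; apply: measurable_funM => //; exact: measurable_exponential_pdf.
have q0 x : 0 <= ((trunc_pow a) \_ `]0, 1]) x.
  by rewrite patchE; case: ifP => // _; exact: trunc_pow_ge0.
apply: (@le_lt_trans _ _ (\int[mu]_x G x)%E).
  apply: ge0_le_integral => //.
  - by move=> x _; rewrite lee_fin gamma_fun_ge0.
  - exact: mg.
  - exact: emeasurable_funD.
  move=> x _; rewrite /G -EFinD lee_fin patchE mem_setE in_itv/=.
  have [x0|x0] := ltP 0 x; last first.
    rewrite /gamma_fun /trunc_pow ltNge x0/= mul0r add0r mulr_ge0//.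
    by apply: exponential_pdf_ge0; rewrite invr_ge0.
  have [x1|x1] /= := leP x 1.
    apply: (@le_trans _ _ (trunc_pow a x)).
      rewrite /gamma_fun ler_piMr ?trunc_pow_ge0// expR_le1 oppr_le0; exact: ltW.
    by rewrite lerDl mulr_ge0//; apply: exponential_pdf_ge0; rewrite invr_ge0.
  rewrite add0r; apply: (le_trans (hC x (ltW x1))).
  apply: ler_wpM2r; last exact: ler_norm.
  by apply: exponential_pdf_ge0; rewrite invr_ge0.
rewrite ge0_integralD//; last 2 first.
- by move=> x _; rewrite lee_fin.
- by move=> x _; rewrite lee_fin mulr_ge0//; apply: exponential_pdf_ge0; rewrite invr_ge0.
apply: lte_add_pinfty.
  have -> : (\int[mu]_x (((trunc_pow a) \_ `]0, 1]) x)%:E =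
      \int[mu]_(x in `]0%R, 1%R]) (trunc_pow a x)%:E)%E.
    by rewrite [RHS]integral_mkcond; apply: eq_integral => x _; rewrite !patchE; case: ifP.
  exact: integral_trunc_pow01.
under eq_integral do rewrite EFinM.
rewrite ge0_integralZl//=.
- by rewrite integral_exponential_pdf// mule1 ltry.
- by apply/measurable_EFinP; exact: measurable_exponential_pdf.
- by move=> x _; rewrite lee_fin; apply: exponential_pdf_ge0; rewrite invr_ge0.
Qed.

(** [Gamma] is the [fine] of an extended integral, which would be 0 if that integral were infinite;
    [0 < a] gives the finiteness. *)
Lemma GammaE a : 0 < a -> (Gamma a)%:E = (\int[mu]_x (gamma_fun a x)%:E)%E.
Proof.
move=> a0; rewrite /Gamma /Rintegral.
have -> : (\int[mu]_(x in `]0%R, +oo[) (x `^ (a - 1) * expR (- x))%:E =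
          \int[mu]_x (gamma_fun a x)%:E)%E.
  rewrite integral_mkcond; apply: eq_integral => x _.
  rewrite patchE mem_setE in_itv/= andbT /gamma_fun /trunc_pow.
  by case: ifP => //; rewrite mul0r.
rewrite fineK// ge0_fin_numE; first exact: integral_gamma_fun_lty.
by apply: integral_ge0 => x _; rewrite lee_fin gamma_fun_ge0.
Qed.

(** The integrand is estimated on [[M, M + 1]] only. The factor [1 / 2] serves [a < 1], where the
    power decreases and [x <= 2 M] is used. As [M] is free, [Gamma] outgrows every exponential,
    which makes the Mittag-Leffler series entire. *)
Lemma Gamma_lower_bound a (M : R) : 0 < a -> 1 <= M ->
  M `^ (a - 1) / 2 * expR (- (M + 1)) <= Gamma a.
Proof.
move=> a0 M1; rewrite -lee_fin GammaE//.
have M0 : 0 < M by lra.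
apply: (@le_trans _ _ (\int[mu]_(x in `[M, (M + 1)%R]) (M `^ (a - 1) / 2 * expR (- (M + 1)))%:E)%E).
  rewrite integral_cst//= lebesgue_measure_itv/= lte_fin ltrDl ltr01.
  by rewrite -EFinB addrAC subrr add0r mule1.
rewrite integral_mkcond; apply: ge0_le_integral => //.
- move=> x _; rewrite patchE; case: ifP => // _.
  by rewrite lee_fin mulr_ge0 ?mulr_ge0 ?powR_ge0 ?expR_ge0.
- by apply/(measurable_restrictT _ _).1 => //; exact: measurable_cst.
- by apply/measurable_EFinP; exact: measurable_gamma_fun.
move=> x _; rewrite patchE mem_setE in_itv/=; case: ifP => [/andP[h1 h2]|_]; last first.
  by rewrite lee_fin gamma_fun_ge0.
have x0 : 0 < x by lra.
have Ma := powR_gt0 (a - 1) M0.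
rewrite lee_fin /gamma_fun /trunc_pow x0; apply: ler_pM.
- by rewrite mulr_ge0 ?powR_ge0.
- exact: expR_ge0.
- have [a1|a1] := leP 1 a.
    apply: (@le_trans _ _ (M `^ (a - 1))); first lra.
    by apply: ge0_ler_powR; rewrite ?nnegrE//; lra.
  have -> : a - 1 = - (1 - a) by ring.
  apply: (@le_trans _ _ ((2 * M) `^ (- (1 - a)))).
    rewrite powRM//; last lra.
    rewrite mulrC; apply: ler_wpM2r; first exact: powR_ge0.
    by rewrite -[X in X <= _]powR_inv1//; apply: ler_powR; lra.
  rewrite !powRN lef_pV2 ?posrE ?powR_gt0//; last lra.
  by apply: ge0_ler_powR; rewrite ?nnegrE//; lra.
- by rewrite ler_expR; lra.
Qed.

Lemma Gamma_gt0 a : 0 < a -> 0 < Gamma a.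
Proof.
move=> a0; apply: lt_le_trans (Gamma_lower_bound a0 (lexx 1)).
by rewrite mulr_gt0 ?expR_gt0// divr_gt0 ?powR_gt0.
Qed.

Lemma Gamma1 : Gamma 1 = 1 :> R.
Proof.
apply: EFin_inj; rewrite GammaE// -(integral_exponential_pdf (ltr01 : 0 < 1 :> R)).
(* The two integrands differ at 0, where the density is 1 and [gamma_fun 1] is 0; this point is
   removed from both integrals. *)
rewrite -(@integral_setD1 _ _ 0 setT); last 2 first.
- exact: measurableD.
- by apply/measurable_EFinP/measurable_funTS; exact: measurable_gamma_fun.
rewrite -[RHS](@integral_setD1 _ _ 0 setT); last 2 first.
- exact: measurableD.
- by apply/measurable_EFinP/measurable_funTS; exact: measurable_exponential_pdf.
apply: eq_integral => x /set_mem[_ /= /eqP x0].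
rewrite /gamma_fun /trunc_pow /exponential_pdf patchE mem_setE in_itv/= andbT.
rewrite le_eqVlt eq_sym (negbTE x0)/=; case: ifP => // _; last by rewrite mul0r.
by rewrite subrr powRr0 !mul1r mulN1r.
Qed.

End Gamma.

(** * Convolution and Euler's beta integral *)

Section PowerKernel.
Context {R : realType}.
Local Notation mu := (@lebesgue_measure R).
Implicit Types (a b t x : R) (f g h : R -> R).

(* Locked, as are [conv] and [ml_kernel] below, because unification would unfold [Gamma]. *)
Fact pow_kernel_key : unit. Proof. by []. Qed.
Definition pow_kernel : R -> R -> R :=
  locked_with pow_kernel_key (fun a x => trunc_pow a x / Gamma a).

Lemma pow_kernel_def a x : pow_kernel a x = trunc_pow a x / Gamma a.
Proof. by rewrite /pow_kernel unlock. Qed.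

Lemma pow_kernel_ge0 a x : 0 < a -> 0 <= pow_kernel a x.
Proof. by move=> a0; rewrite pow_kernel_def divr_ge0 ?trunc_pow_ge0 ?ltW ?Gamma_gt0. Qed.

Lemma pow_kernel_le0 a x : x <= 0 -> pow_kernel a x = 0.
Proof. by rewrite leNgt pow_kernel_def /trunc_pow => /negbTE ->; rewrite mul0r. Qed.

Lemma pow_kernelE a x : 0 < x -> pow_kernel a x = x `^ (a - 1) / Gamma a.
Proof. by rewrite pow_kernel_def /trunc_pow => ->. Qed.

Lemma pow_kernel1 x : pow_kernel 1 x = if 0 < x then 1 else 0.
Proof. by rewrite pow_kernel_def /trunc_pow Gamma1 divr1 subrr powRr0. Qed.

Lemma pow_kernel_gt0 a x : 0 < a -> 0 < x -> 0 < pow_kernel a x.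
Proof. by move=> a0 x0; rewrite pow_kernelE// divr_gt0 ?powR_gt0 ?Gamma_gt0. Qed.

Lemma measurable_pow_kernel a : measurable_fun setT (pow_kernel a).
Proof.
rewrite (_ : pow_kernel a = fun x => trunc_pow a x / Gamma a); last first.
  by apply/funext => x; exact: pow_kernel_def.
by apply: measurable_funM => //; exact: measurable_trunc_pow.
Qed.

Lemma measurable_conv_integrand f g : measurable_fun setT f -> measurable_fun setT g ->
  measurable_fun setT (fun z : R * R => f (z.1 - z.2) * g z.2).
Proof.
move=> mf mg; apply: measurable_funM; last exact: measurableT_comp.
by apply: measurableT_comp => //; exact: measurable_funB.
Qed.

Lemma measurable_conv_integrand1 f g t : measurable_fun setT f -> measurable_fun setT g ->
  measurable_fun setT (fun x => f (t - x) * g x).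
Proof.
move=> mf mg; apply: measurable_funM => //.
by apply: measurableT_comp => //; exact: measurable_funB.
Qed.

(** Euler's beta integral, kept in the extended reals because its finiteness is only a consequence
    of [beta_gamma]. *)
Let beta_int a b : \bar R := (\int[mu]_y (trunc_pow a (1 - y) * trunc_pow b y)%:E)%E.

Let beta_scale a b t : 0 < t ->
  (\int[mu]_y (trunc_pow a (t - y) * trunc_pow b y)%:E =
   (t `^ (a + b - 1))%:E * beta_int a b)%E.
Proof.
move=> t0; rewrite -(@ge0_integral_scale _ t
  (fun y => (trunc_pow a (t - y) * trunc_pow b y)%:E)); last 3 first.
- exact: t0.
- apply/measurable_EFinP; apply: measurable_conv_integrand1; exact: measurable_trunc_pow.
- by move=> x; rewrite lee_fin mulr_ge0 ?trunc_pow_ge0.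
have -> : (\int[mu]_x (trunc_pow a (t - t * x) * trunc_pow b (t * x))%:E =
    (t `^ (a + b - 2))%:E * beta_int a b)%E.
  rewrite /beta_int -ge0_integralZl//; last 3 first.
  - apply/measurable_EFinP; apply: measurable_conv_integrand1; exact: measurable_trunc_pow.
  - by move=> x _; rewrite lee_fin mulr_ge0 ?trunc_pow_ge0.
  - by rewrite lee_fin powR_ge0.
  apply: eq_integral => x _; rewrite -EFinM; congr (_%:E).
  have -> : t - t * x = t * (1 - x) by ring.
  rewrite /trunc_pow !pmulr_rgt0//.
  case: ifPn => [x1|_]; last by rewrite !(mul0r, mulr0).
  case: ifPn => [x0|_]; last by rewrite !(mul0r, mulr0).
  rewrite !powRM ?ltW//; have -> : a + b - 2 = (a - 1) + (b - 1) by ring.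
  rewrite (@powRD _ t (a - 1) (b - 1)); last by rewrite (gt_eqF t0) implybT.
  by ring.
rewrite muleA -EFinM; congr (_%:E * _)%E.
have -> : a + b - 2 = (a + b - 1) - 1 by ring.
rewrite powRB; last by rewrite (gt_eqF t0) implybT.
by rewrite powRr1 ?ltW// mulrC divfK// gt_eqF.
Qed.

Let trunc_pow_conv0 a b t y : t <= 0 -> trunc_pow a (t - y) * trunc_pow b y = 0.
Proof.
move=> t0; rewrite /trunc_pow; case: ifPn => [h|_]; last by rewrite mul0r.
by case: ifPn => [h'|_]; [exfalso; lra|rewrite mulr0].
Qed.

(** Tonelli for [(x - y)^(a-1) y^(b-1) e^(-x)] on [0 < y < x]. Integrating over [y] first gives
    [x^(a+b-1) e^(-x)] times the beta integral; integrating over [x] first splits [e^(-x)] as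
    [e^(-y) e^(-(x-y))] and gives the product of two Gamma values. *)
Let beta_gamma a b : 0 < a -> 0 < b ->
  ((Gamma a * Gamma b)%:E = (Gamma (a + b))%:E * beta_int a b)%E.
Proof.
move=> a0 b0.
pose F (z : R * R) : \bar R :=
  (trunc_pow a (z.1 - z.2) * trunc_pow b z.2 * expR (- z.1))%:E.
have mF : measurable_fun setT F.
  apply/measurable_EFinP; apply: measurable_funM.
    by apply: measurable_conv_integrand; exact: measurable_trunc_pow.
  by apply: measurableT_comp; [exact: measurable_expR|exact: measurableT_comp].
have F0 z : (0 <= F z)%E.
  by rewrite lee_fin mulr_ge0 ?expR_ge0 ?mulr_ge0 ?trunc_pow_ge0.
have := fubini_tonelli (m1 := mu) (m2 := mu) F mF F0.
rewrite /F/=.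
have -> : (\int[mu]_x \int[mu]_y (trunc_pow a (x - y) * trunc_pow b y * expR (- x))%:E =
   (Gamma (a + b))%:E * beta_int a b)%E.
  rewrite GammaE ?addr_gt0// muleC -ge0_integralZl//; last 3 first.
  - by apply/measurable_EFinP; exact: measurable_gamma_fun.
  - by move=> x _; rewrite lee_fin gamma_fun_ge0.
  - by apply: integral_ge0 => x _; rewrite lee_fin mulr_ge0 ?trunc_pow_ge0.
  apply: eq_integral => x _; rewrite /gamma_fun [in RHS]/trunc_pow.
  case: ifPn => [x0|]; last first.
    rewrite -leNgt => x0; rewrite mul0r mule0 integral0_eq// => y _.
    by rewrite trunc_pow_conv0// mul0r.
  under eq_integral do rewrite mulrC EFinM.
  rewrite ge0_integralZl//; last 2 first.
  - by apply/measurable_EFinP; apply: measurable_conv_integrand1; exact: measurable_trunc_pow.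
  - by move=> y _; rewrite lee_fin mulr_ge0 ?trunc_pow_ge0.
  by rewrite beta_scale// muleA -EFinM muleC mulrC.
move=> ->.
rewrite EFinM (GammaE b0) -ge0_integralZl//; last 3 first.
- by apply/measurable_EFinP; exact: measurable_gamma_fun.
- by move=> x _; rewrite lee_fin gamma_fun_ge0.
- by rewrite lee_fin ltW// Gamma_gt0.
apply: eq_integral => y _.
rewrite GammaE// muleC -ge0_integralZl//; last 3 first.
- by apply/measurable_EFinP; exact: measurable_gamma_fun.
- by move=> x _; rewrite lee_fin gamma_fun_ge0.
- by rewrite lee_fin gamma_fun_ge0.
rewrite -(@integral_shift _ y); last first.
  apply: emeasurable_funM => //; apply/measurable_EFinP; exact: measurable_gamma_fun.
apply: eq_integral => x _; rewrite -EFinM /gamma_fun; congr (_%:E).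
have -> : expR (- x) = expR (- y) * expR (- (x - y)) by rewrite -expRD; congr expR; ring.
by ring.
Qed.

(** The semigroup law of fractional integration: the division by Gamma in [pow_kernel] cancels the
    beta factor. *)
Lemma integral_pow_kernel_conv a b t : 0 < a -> 0 < b ->
  (\int[mu]_x (pow_kernel a (t - x) * pow_kernel b x)%:E = (pow_kernel (a + b) t)%:E)%E.
Proof.
move=> a0 b0; have ab0 : 0 < a + b by exact: addr_gt0.
have ga := Gamma_gt0 a0; have gb := Gamma_gt0 b0; have gab := Gamma_gt0 ab0.
have -> : (\int[mu]_x (pow_kernel a (t - x) * pow_kernel b x)%:E =
    ((Gamma a * Gamma b)^-1)%:E * \int[mu]_x (trunc_pow a (t - x) * trunc_pow b x)%:E)%E.
  rewrite -ge0_integralZl//; last 3 first.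
  - by apply/measurable_EFinP; apply: measurable_conv_integrand1; exact: measurable_trunc_pow.
  - by move=> y _; rewrite lee_fin mulr_ge0 ?trunc_pow_ge0.
  - by rewrite lee_fin invr_ge0; exact: ltW (mulr_gt0 ga gb).
  apply: eq_integral => x _; rewrite -EFinM !pow_kernel_def invfM mulrACA mulrC; exact: erefl.
have [t0|t0] := leP t 0.
  rewrite pow_kernel_le0// integral0_eq ?mule0// => x _.
  by rewrite trunc_pow_conv0.
rewrite beta_scale//.
have gagb := mulr_gt0 ga gb; have gagbV : 0 < (Gamma a * Gamma b)^-1 by rewrite invr_gt0.
have := beta_gamma a0 b0.
(* An infinite beta integral would stay infinite after multiplication by [Gamma (a + b) > 0],
   against the finite product of Gamma values. *)
case: (beta_int a b) => [r| |].
- rewrite -EFinM => -[e]; rewrite -!EFinM; congr (_%:E).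
  rewrite e pow_kernelE//; field.
  rewrite (gt_eqF gab)/=; apply/eqP => r0; move: gagb; rewrite e r0 mulr0.
  by rewrite ltxx.
- by rewrite gt0_muley.
- by rewrite gt0_muleNy.
Qed.

(* The convolution over [0, t], for functions that vanish on the negative half-line. *)
Fact conv_key : unit. Proof. by []. Qed.
Definition conv : (R -> R) -> (R -> R) -> R -> R :=
  locked_with conv_key (fun f g t => \int[mu]_x (f (t - x) * g x)).

Lemma convE f g t : conv f g t = \int[mu]_x (f (t - x) * g x).
Proof. by rewrite /conv unlock. Qed.

Lemma conv_pow_kernel a b t : 0 < a -> 0 < b ->
  conv (pow_kernel a) (pow_kernel b) t = pow_kernel (a + b) t.
Proof.
by move=> a0 b0; rewrite convE /Rintegral integral_pow_kernel_conv.
Qed.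

Lemma convC f g : measurable_fun setT f -> measurable_fun setT g -> conv f g = conv g f.
Proof.
move=> mf mg; apply/funext => t; rewrite !convE /Rintegral; congr fine.
rewrite -(@integral_reflect _ t); last first.
  by apply/measurable_EFinP; exact: measurable_conv_integrand1.
by apply: eq_integral => x _; rewrite subKr mulrC.
Qed.

Definition conv_int f g t := mu.-integrable setT (fun x => (f (t - x) * g x)%:E).

Lemma conv_int_norm f g t : conv_int f g t -> conv_int (Num.norm \o f) (Num.norm \o g) t.
Proof.
move=> h; have : mu.-integrable setT (abse \o (fun x => (f (t - x) * g x)%:E)).
  exact: integrable_abse.
by apply: eq_integrable => // x _ /=; rewrite normrM.
Qed.

Lemma EFin_conv f g t : conv_int f g t ->
  ((conv f g t)%:E = \int[mu]_x (f (t - x) * g x)%:E)%E.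
Proof. by move=> h; rewrite convE /Rintegral fineK//; exact: integrable_fin_num. Qed.

Lemma convZl c f g t : conv_int f g t -> conv (fun x => c * f x) g t = c * conv f g t.
Proof.
move=> h; rewrite !convE -RintegralZl//.
by congr Rintegral; apply/funext => x; rewrite mulrA.
Qed.

Lemma convZr c f g t : conv_int f g t -> conv f (fun x => c * g x) t = c * conv f g t.
Proof.
move=> h; rewrite !convE -RintegralZl//.
by congr Rintegral; apply/funext => x; ring.
Qed.

Lemma convDl f g h t : conv_int f h t -> conv_int g h t ->
  conv (fun x => f x + g x) h t = conv f h t + conv g h t.
Proof.
move=> fh gh; rewrite !convE -RintegralD//.
by congr Rintegral; apply/funext => x; rewrite mulrDl.
Qed.

Lemma convDr f g h t : conv_int f g t -> conv_int f h t ->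
  conv f (fun x => g x + h x) t = conv f g t + conv f h t.
Proof.
move=> fg fh; rewrite !convE -RintegralD//.
by congr Rintegral; apply/funext => x; rewrite mulrDr.
Qed.

Lemma conv_ge0 f g t : (forall x, 0 <= f x) -> (forall x, 0 <= g x) -> 0 <= conv f g t.
Proof. by move=> f0 g0; rewrite convE; apply: Rintegral_ge0 => x _; rewrite mulr_ge0. Qed.

(* Stated at a fixed [t], so that the inner convolutions need only exist where they are used:
   the derivative in the uniqueness proof is controlled on a bounded interval only. *)
Lemma convA f g h t :
  measurable_fun setT f -> measurable_fun setT g -> measurable_fun setT h ->
  (forall s, f (t - s) != 0 -> conv_int g h s) ->
  (forall x, h x != 0 -> conv_int f g (t - x)) ->
  conv_int (conv (Num.norm \o f) (Num.norm \o g)) h t ->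
  conv f (conv g h) t = conv (conv f g) h t.
Proof.
move=> mf mg mh gh fg fgh.
pose F (z : R * R) : \bar R := (f (t - z.1) * g (z.1 - z.2) * h z.2)%:E.
have mF : measurable_fun setT F.
  apply/measurable_EFinP; apply: measurable_funM; last exact: measurableT_comp.
  apply: measurable_funM; first by apply: measurableT_comp => //; exact: measurable_funB.
  by apply: measurableT_comp => //; exact: measurable_funB.
(* A translation by [x] turns the integral over [s] into a convolution at [t - x]. It is stated for
   general functions because it also serves the absolute values. *)
have shift x (f' g' : R -> R) : measurable_fun setT f' -> measurable_fun setT g' ->
    (\int[mu]_s (f' (t - s) * g' (s - x))%:E = \int[mu]_s (f' ((t - x) - s) * g' s)%:E)%E.
  move=> mf' mg'.
  rewrite -(@integral_shift _ x (fun s => (f' ((t - x) - s) * g' s)%:E)); last first.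
    by apply/measurable_EFinP; exact: measurable_conv_integrand1.
  by apply: eq_integral => s _; congr ((f' _ * _)%:E); ring.
have shift_int x : h x != 0 -> mu.-integrable setT (fun s => (f (t - s) * g (s - x))%:E).
  move=> /fg/integrableP[_ hx]; apply/integrableP; split.
    apply/measurable_EFinP; apply: measurable_funM.
      by apply: measurableT_comp => //; exact: measurable_funB.
    by apply: measurableT_comp => //; exact: measurable_funB.
  apply: le_lt_trans hx; rewrite le_eqVlt; apply/orP; left; apply/eqP.
  under eq_integral do rewrite abse_EFin normrM.
  under [RHS]eq_integral do rewrite abse_EFin normrM.
  by apply: (shift x (Num.norm \o f) (Num.norm \o g)); exact: measurableT_comp.
(* By Tonelli it suffices that one iterated integral of the absolute value is finite; integrating
   over [s] first leaves the convolution of the norms times [|h|]. Where [h] vanishes nothing is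
   known of the inner convolution, but there the integrand is 0. *)
have iF : (product_measure1 mu mu).-integrable setT F.
  apply/integrable21ltyP => //.
  move: fgh => /integrableP[_]; apply: le_lt_trans.
  rewrite le_eqVlt; apply/orP; left; apply/eqP.
  apply: eq_integral => x _.
  have [hx|hx] := eqVneq (h x) 0.
    rewrite hx mulr0 abse0 integral0_eq// => s _.
    by rewrite /F/= hx mulr0 normr0.
  rewrite /F/=.
  under eq_integral do rewrite normrM mulrC EFinM.
  rewrite ge0_integralZl//; last first.
    apply/measurable_EFinP; apply: measurableT_comp => //; apply/measurable_EFinP.
    exact: measurable_int (shift_int _ hx).
  under eq_integral do rewrite normrM.
  have := shift x (Num.norm \o f) (Num.norm \o g) (measurableT_comp (@normr_measurable _ _) mf)
    (measurableT_comp (@normr_measurable _ _) mg) => /= ->.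
  rewrite -(@EFin_conv (Num.norm \o f) (Num.norm \o g)); last exact/conv_int_norm/fg.
  rewrite -EFinM normrM mulrC (ger0_norm (x := conv _ _ _))//.
  by apply: conv_ge0 => y /=.
have := Fubini iF; rewrite /F/= => FE.
have -> : conv f (conv g h) t = fine (\int[mu]_s (f (t - s) * conv g h s)%:E)%E by rewrite convE.
have -> : conv (conv f g) h t = fine (\int[mu]_s (conv f g (t - s) * h s)%:E)%E by rewrite convE.
congr fine.
transitivity (\int[mu]_x \int[mu]_y (f (t - x) * g (x - y) * h y)%:E)%E.
  apply: eq_integral => s _.
  have [fs|fs] := eqVneq (f (t - s)) 0.
    by rewrite fs mul0r integral0_eq// => x _; rewrite mul0r mul0r.
  under [RHS]eq_integral do rewrite -mulrA EFinM.
  rewrite integralZl//; last exact: gh.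
  by rewrite EFinM EFin_conv//; exact: gh.
rewrite FE; apply: eq_integral => x _.
have [hx|hx] := eqVneq (h x) 0.
  by rewrite hx mulr0 integral0_eq// => s _; rewrite mulr0.
under eq_integral do rewrite mulrC EFinM.
rewrite integralZl//; last exact: shift_int.
by rewrite shift// -EFin_conv ?EFinM 1?muleC//; exact: fg.
Qed.

End PowerKernel.

(** * Locally integrable causal functions *)

Section Tame.
Context {R : realType}.
Local Notation mu := (@lebesgue_measure R).
Implicit Types (a b t x : R) (f g h : R -> R).

(** One exponent serves all [T], only the constant varies. The bound forces [f] to vanish for
    [x <= 0] and allows an integrable power singularity at 0; two such functions have a convolution
    at every point, again of this kind. *)
Definition tame f : Prop := measurable_fun setT f /\
  exists2 a : R, 0 < a & forall T, exists2 C : R, 0 <= C & forall x, x <= T -> `|f x| <= C * pow_kernel a x.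

Lemma tame_measurable f : tame f -> measurable_fun setT f. Proof. by case. Qed.

Lemma tame_le0 f x : tame f -> x <= 0 -> f x = 0.
Proof.
move=> [_ [a a0 /(_ 0)[C C0 h]]] x0; apply/eqP; rewrite -normr_le0.
by rewrite (le_trans (h _ x0))// pow_kernel_le0// mulr0.
Qed.

Lemma tame_pow_kernel a : 0 < a -> tame (pow_kernel a).
Proof.
move=> a0; split; first exact: measurable_pow_kernel.
by exists a => // T; exists 1 => // x _; rewrite mul1r ger0_norm// pow_kernel_ge0.
Qed.

Lemma tame_le f g : measurable_fun setT f -> tame g ->
  (forall T, exists2 C : R, 0 <= C & forall x, x <= T -> `|f x| <= C * `|g x|) -> tame f.
Proof.
move=> mf [mg [a a0 hg]] fg; split => //; exists a => // T.
have [C C0 hC] := hg T; have [C' C'0 hC'] := fg T; exists (C' * C); first exact: mulr_ge0.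
move=> x xT; apply: (le_trans (hC' _ xT)); rewrite -mulrA; apply: ler_wpM2l => //; exact: hC.
Qed.

Lemma pow_kernel_le a b T : 0 < a -> a <= b -> exists2 C : R, 0 <= C &
  forall x, x <= T -> pow_kernel b x <= C * pow_kernel a x.
Proof.
move=> a0 ab; have b0 : 0 < b by apply: lt_le_trans ab.
exists (`|T| `^ (b - a) * (Gamma a / Gamma b)).
  by rewrite mulr_ge0 ?powR_ge0 ?divr_ge0// ltW// Gamma_gt0.
move=> x xT; have [x0|x0] := leP x 0; first by rewrite !pow_kernel_le0// mulr0.
rewrite !pow_kernelE//.
have -> : b - 1 = (b - a) + (a - 1) by ring.
rewrite powRD; last by rewrite (gt_eqF x0) implybT.
have h : x `^ (b - a) <= `|T| `^ (b - a).
  apply: ge0_ler_powR; rewrite ?nnegrE ?normr_ge0 ?subr_ge0 ?(ltW x0)//.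
  exact: le_trans xT (ler_norm _).
have ga := Gamma_gt0 a0; have gb := Gamma_gt0 b0.
move: (Gamma a) (Gamma b) ga gb => ga gb ga0 gb0.
have -> : `|T| `^ (b - a) * (ga / gb) * (x `^ (a - 1) / ga) =
   `|T| `^ (b - a) * (x `^ (a - 1) / gb) by field; rewrite (gt_eqF ga0) (gt_eqF gb0).
by rewrite -mulrA; apply: ler_wpM2r => //; rewrite divr_ge0 ?powR_ge0// ltW.
Qed.

Lemma tame_bounded f : measurable_fun setT f -> (forall x, x <= 0 -> f x = 0) ->
  (forall T, exists C : R, forall x, x <= T -> `|f x| <= C) -> tame f.
Proof.
move=> mf f0 fb; split => //; exists 1 => // T.
have [C hC] := fb T; exists `|C| => // x xT.
have [x0|x0] := leP x 0; first by rewrite f0// normr0 mulr_ge0// pow_kernel_ge0.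
by rewrite pow_kernel1 x0 mulr1; exact: le_trans (hC _ xT) (ler_norm _).
Qed.

Lemma tameZ c f : tame f -> tame (fun x => c * f x).
Proof.
move=> tf; apply: (tame_le _ tf); first exact: measurable_funM (tame_measurable tf).
by move=> T; exists `|c| => // x _; rewrite normrM.
Qed.

Lemma tame_norm f : tame f -> tame (Num.norm \o f).
Proof.
move=> tf; apply: (tame_le _ tf); first exact: measurableT_comp (tame_measurable tf).
by move=> T; exists 1 => // x _; rewrite /= mul1r normr_id.
Qed.

Lemma tameD f g : tame f -> tame g -> tame (fun x => f x + g x).
Proof.
move=> [mf [a a0 hf]] [mg [b b0 hg]]; split; first exact: measurable_funD.
have m0 : 0 < Num.min a b by rewrite lt_min a0.
exists (Num.min a b) => // T.
have [C C0 hC] := hf T; have [C' C'0 hC'] := hg T.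
have ma : Num.min a b <= a by rewrite ge_min lexx.
have mb : Num.min a b <= b by rewrite ge_min lexx orbT.
have [D D0 hD] := pow_kernel_le T m0 ma.
have [D' D'0 hD'] := pow_kernel_le T m0 mb.
exists (C * D + C' * D'); first by rewrite addr_ge0// mulr_ge0.
move=> x xT; rewrite (le_trans (ler_normD _ _))// mulrDl; apply: lerD.
  by rewrite (le_trans (hC _ xT))// -mulrA; apply: ler_wpM2l => //; exact: hD.
by rewrite (le_trans (hC' _ xT))// -mulrA; apply: ler_wpM2l => //; exact: hD'.
Qed.

Lemma tame_conv_bound f g t : tame f -> tame g -> exists2 C : R, 0 <= C & exists a b : R,
  [/\ 0 < a, 0 < b & forall t', t' <= t -> forall x,
  `|f (t' - x) * g x| <= C * (pow_kernel a (t' - x) * pow_kernel b x)].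
Proof.
move=> tf tg; have [mf [a a0 /(_ t)[C C0 hC]]] := tf.
have [mg [b b0 /(_ t)[C' C'0 hC']]] := tg.
exists (C * C'); first exact: mulr_ge0.
exists a, b; split => // t' tt x; rewrite normrM mulrACA.
have [x0|x0] := leP x 0.
  rewrite (tame_le0 tg x0) normr0 mulr0; exact: (mulr_ge0 (mulr_ge0 C0 (pow_kernel_ge0 _ a0)) (mulr_ge0 C'0 (pow_kernel_ge0 _ b0))).
have [xt|xt] := leP t' x.
  rewrite (tame_le0 tf) ?subr_le0// normr0 mul0r; exact: (mulr_ge0 (mulr_ge0 C0 (pow_kernel_ge0 _ a0)) (mulr_ge0 C'0 (pow_kernel_ge0 _ b0))).
by apply: ler_pM => //; [apply: hC; lra|apply: hC'; lra].
Qed.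

Lemma pow_kernel_conv_int a b t : 0 < a -> 0 < b -> conv_int (pow_kernel a) (pow_kernel b) t.
Proof.
move=> a0 b0; apply/integrableP; split.
  by apply/measurable_EFinP; apply: measurable_conv_integrand1; exact: measurable_pow_kernel.
under eq_integral do rewrite /= (ger0_norm (mulr_ge0 (pow_kernel_ge0 _ a0) (pow_kernel_ge0 _ b0))).
by rewrite integral_pow_kernel_conv// ltry.
Qed.

Lemma tame_conv_int f g t : tame f -> tame g -> conv_int f g t.
Proof.
move=> tf tg; have [C C0 [a [b [a0 b0 hb]]]] := tame_conv_bound t tf tg.
have := integrableZl measurableT C (pow_kernel_conv_int t a0 b0).
apply: le_integrable => //.
  by apply/measurable_EFinP; apply: measurable_conv_integrand1; exact: tame_measurable.
move=> x _; rewrite -EFinM !abse_EFin lee_fin (le_trans (hb t _ x))//.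
exact: ler_norm.
Qed.

(** [Rintegral] is the [fine] of a difference of two integrals of non-negative functions, each
    measurable in the parameter by Tonelli. *)
Lemma measurable_conv f g : measurable_fun setT f -> measurable_fun setT g ->
  measurable_fun setT (conv f g).
Proof.
move=> mf mg.
pose F (z : R * R) : \bar R := (f (z.1 - z.2) * g z.2)%:E.
have mF : measurable_fun setT F by apply/measurable_EFinP; exact: measurable_conv_integrand.
have -> : conv f g = fine \o (fun t => \int[mu]_x (fun z => F^\+ z) (t, x) - \int[mu]_x F^\- (t, x))%E.
  apply/funext => t; rewrite convE /Rintegral /= [in LHS]integralE.
  by congr (fine (_ - _)%E); apply: eq_integral => x _; rewrite ?funeposE ?funenegE.
apply: measurableT_comp; first exact: fine_measurable.
apply: emeasurable_funB.
  have := measurable_fun_fubini_tonelli_F (m2 := mu) (F^\+)%E (measurable_funepos mF) (funepos_ge0 F).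
  by rewrite /fubini_F; apply.
have := measurable_fun_fubini_tonelli_F (m2 := mu) (F^\-)%E (measurable_funeneg mF) (funeneg_ge0 F).
by rewrite /fubini_F; apply.
Qed.

Lemma norm_conv_le f g t : conv_int f g t -> `|conv f g t| <= conv (Num.norm \o f) (Num.norm \o g) t.
Proof.
move=> h; rewrite !convE; apply: (le_trans (le_normr_Rintegral _ h)) => //.
by under eq_Rintegral do rewrite normrM.
Qed.

Lemma le_conv f g f' g' t : conv_int f g t -> conv_int f' g' t ->
  (forall x, f (t - x) * g x <= f' (t - x) * g' x) -> conv f g t <= conv f' g' t.
Proof. by move=> h h' le; rewrite !convE; apply: le_Rintegral => // x _; exact: le. Qed.

(** By the semigroup law the two bounding kernels convolve to [pow_kernel (a + b)], so the exponents
    add. *)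
Lemma tame_conv f g : tame f -> tame g -> tame (conv f g).
Proof.
move=> tf tg; split; first by apply: measurable_conv; exact: tame_measurable.
have [mf [a a0 hf]] := tf; have [mg [b b0 hg]] := tg.
exists (a + b); first exact: addr_gt0.
move=> T.
have [C C0 hC] := hf T; have [C' C'0 hC'] := hg T.
exists (C * C'); first exact: mulr_ge0.
move=> t tT; apply: (le_trans (norm_conv_le (tame_conv_int t tf tg))).
rewrite -conv_pow_kernel// -mulrA.
rewrite -convZr; last exact: pow_kernel_conv_int.
rewrite -convZl; last first.
  by apply: tame_conv_int; [exact: tame_pow_kernel|apply: tameZ; exact: tame_pow_kernel].
apply: le_conv.
- by apply: tame_conv_int; exact: tame_norm.
- by apply: tame_conv_int; apply: tameZ; exact: tame_pow_kernel.
move=> x /=.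
have [x0|x0] := leP x 0.
  rewrite (tame_le0 tg x0) normr0 mulr0; exact: (mulr_ge0 (mulr_ge0 C0 (pow_kernel_ge0 _ a0)) (mulr_ge0 C'0 (pow_kernel_ge0 _ b0))).
have [xt|xt] := leP t x.
  rewrite (tame_le0 tf) ?subr_le0// normr0 mul0r; exact: (mulr_ge0 (mulr_ge0 C0 (pow_kernel_ge0 _ a0)) (mulr_ge0 C'0 (pow_kernel_ge0 _ b0))).
by apply: ler_pM => //; [apply: hC; lra|apply: hC'; lra].
Qed.

Lemma tame_convA f g h t : tame f -> tame g -> tame h ->
  conv f (conv g h) t = conv (conv f g) h t.
Proof.
move=> tf tg th; apply: convA; do ?exact: tame_measurable.
- by move=> s _; exact: tame_conv_int.
- by move=> s _; exact: tame_conv_int.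
- by apply: tame_conv_int => //; apply: tame_conv; exact: tame_norm.
Qed.

Lemma tame_convC f g : tame f -> tame g -> conv f g = conv g f.
Proof. by move=> /tame_measurable mf /tame_measurable mg; exact: convC. Qed.

Lemma eq_conv f f' g g' t : (forall x, 0 < x -> x < t -> f x = f' x) ->
  (forall x, 0 < x -> x < t -> g x = g' x) ->
  (forall x, x <= 0 -> f x = 0) -> (forall x, x <= 0 -> f' x = 0) ->
  (forall x, x <= 0 -> g x = 0) -> (forall x, x <= 0 -> g' x = 0) ->
  conv f g t = conv f' g' t.
Proof.
move=> ff gg f0 f'0 g0 g'0; rewrite !convE; apply: eq_Rintegral => x _.
have [x0|x0] := leP x 0; first by rewrite g0// g'0// !mulr0.
have [xt|xt] := leP t x; first by rewrite f0 ?f'0 ?mul0r//; lra.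
by rewrite ff ?gg//; lra.
Qed.

Lemma integrable_tame f t : tame f -> mu.-integrable `]-oo, t] (EFin \o f).
Proof.
move=> tf.
(* Taken at [t + 1] because [pow_kernel 1] vanishes at 0: the Heaviside factor is then 1 on all of
   []-oo, t]], its end included. *)
have h := tame_conv_int (t + 1) (tame_pow_kernel (ltr01 : 0 < 1 :> R)) tf.
have := @integrableS _ _ _ mu setT `]-oo, t] _ measurableT (measurable_itv _) (@subsetT _ _) h.
apply: eq_integrable => // x; rewrite inE/= in_itv/= => xt.
by rewrite pow_kernel1 ifT ?mul1r//; lra.
Qed.

Lemma conv_heaviside f t : tame f ->
  conv (pow_kernel 1) f t = \int[mu]_(x in `]-oo, t]) f x.
Proof.
move=> tf; rewrite -Rintegral_itv_bndo_bndc; last first.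
  have := @integrableS _ _ _ mu `]-oo, t] `]-oo, t[ _ (measurable_itv _) (measurable_itv _) _ (integrable_tame t tf).
  by apply => x /=; rewrite !in_itv/=; exact: ltW.
rewrite [RHS]Rintegral_mkcond convE; apply: eq_Rintegral => x _.
rewrite patchE mem_setE in_itv/= pow_kernel1 subr_gt0.
by case: ifP => _; rewrite ?mul1r ?mul0r.
Qed.

Lemma conv_heaviside_derivable f t : tame f -> {for t, continuous f} ->
  is_derive t 1 (conv (pow_kernel 1) f) (f t).
Proof.
move=> tf ct.
have -> : conv (pow_kernel 1) f = (fun t => \int[mu]_(x in `]-oo, t]) f x).
  by apply/funext => x; rewrite conv_heaviside.
have t1 : t < t + 1 by lra.
have [d <-] := @continuous_FTC1 _ f (BInfty R true) t (t + 1) t1 (integrable_tame _ tf) (ltNyr _) ct.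
by rewrite derive1E; split.
Qed.

(** Dominated convergence along sequences. [g] may jump at 0, as the Heaviside function does: in the
    integrand this affects only the point [x = t], a null set. *)
Lemma conv_continuous f g t : tame f -> tame g ->
  (forall T, exists C : R, forall x, x <= T -> `|g x| <= C) ->
  (forall x, x != 0 -> {for x, continuous g}) -> {for t, continuous (conv f g)}.
Proof.
move=> tf tg gb gc.
apply/continuous_withinNx/(cvgr_dnbhsP (conv f g)) => u [_ ut].
have [B [_ hB]] : bounded_fun u by apply: cvg_seq_bounded; apply/cvg_ex; exists t.
have uB n : u n <= B + 1 by rewrite (le_trans (ler_norm _))//; apply: hB => //; rewrite ltrDl.
have [C hC] := gb (B + 1).
have tB : t <= B + 1.
  by apply: (cvgr_to_le ut); apply: nearW.
rewrite (tame_convC tf tg).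
(* The sequence stays below [B + 1]; the Heaviside cut-off at [B + 2] is then 1 wherever
   [g (u n - x)] can be nonzero, and it makes the majorant integrable. *)
have [] := @dominated_convergence _ _ _ mu setT measurableT
  (fun n x => (g (u n - x) * f x)%:E) (fun x => (g (t - x) * f x)%:E)
  (fun x => (`|C| * (pow_kernel 1 (B + 2 - x) * `|f x|))%:E).
- move=> n; apply/measurable_EFinP.
  exact: (measurable_conv_integrand1 (u n) (tame_measurable tg) (tame_measurable tf)).
- apply/measurable_EFinP.
  exact: (measurable_conv_integrand1 t (tame_measurable tg) (tame_measurable tf)).
- exists [set t]; split; [exact: measurable_set1|exact: lebesgue_measure_set1|].
  move=> x /=; apply: contra_notP => /eqP xt _.
  apply: cvg_EFin; first exact: nearW.
  apply: cvgM; last exact: cvg_cst.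
  apply: (@continuous_cvg _ _ _ _ _ (fun n => u n - x) g (t - x)).
    by apply: gc; rewrite subr_eq0 eq_sym.
  by apply: cvgB => //; exact: cvg_cst.
- have := integrableZl measurableT `|C| (tame_conv_int (B + 2) (tame_pow_kernel ltr01) (tame_norm tf)).
  by apply: eq_integrable.
- apply: aeW => x n _; rewrite abse_EFin lee_fin normrM mulrA.
  have [x0|x0] := leP x 0; first by rewrite (tame_le0 tf x0) normr0 !mulr0.
  apply: ler_wpM2r => //.
  have [xu|xu] := leP (u n) x.
    by rewrite (tame_le0 tg) ?subr_le0// normr0 mulr_ge0// pow_kernel_ge0.
  rewrite pow_kernel1 ifT; last by have := uB n; lra.
  rewrite mulr1 (le_trans _ (ler_norm _))//; apply: hC.
  by have := uB n; lra.
move=> _ _ /=; rewrite -(EFin_conv (tame_conv_int t tg tf)) => /fine_cvgP[_].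
rewrite (_ : fine \o _ = fun n => conv g f (u n))//.
by apply/funext => n /=; rewrite convE.
Qed.

Lemma eq_conv_continuous f g t : {for t, continuous f} -> (\forall x \near t, f x = g x) ->
  {for t, continuous g}.
Proof.
move=> cf fg; rewrite /prop_for /continuous_at -(nbhs_singleton fg).
by apply: cvg_trans cf; apply: near_eq_cvg.
Qed.

Lemma pow_kernel_continuous a x : x != 0 -> {for x, continuous (pow_kernel a)}.
Proof.
rewrite neq_lt => /orP[x0|x0].
  apply: (@eq_conv_continuous (cst 0)); first exact: cst_continuous.
  near=> y; rewrite pow_kernel_le0//; apply: ltW.
  by near: y; exact: lt_nbhsl.
apply: (@eq_conv_continuous (fun y => y `^ (a - 1) / Gamma a)).
  have cp : {for x, continuous (@powR R ^~ (a - 1))}.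
    apply: differentiable_continuous; apply/derivable1_diffP.
    by apply: derivable_powR; rewrite in_itv/= x0.
  by apply: cvgM; [exact: cp|exact: cvg_cst].
near=> y; rewrite pow_kernelE//.
by near: y; exact: lt_nbhsr.
Unshelve. all: by end_near. Qed.

End Tame.

(** * Mittag-Leffler functions *)

Section EntireSeries.
Context {R : realType}.
Implicit Types (c : nat -> R) (x z K : R).

(** Infinite radius of convergence in the form of Cauchy estimates, which pass easily to the
    differentiated series. *)
Definition entire_coef c := forall K, 0 < K -> exists C, forall n, `|c n| * K ^+ n <= C.

(** Comparison with a geometric series of ratio [1 / 2], from the estimate at the radius
    [2 (|z| + 1)]. *)
Lemma entire_coef_cvg c z : entire_coef c -> cvgn (pseries c z).
Proof.
move=> ec; have K0 : 0 < 2 * (`|z| + 1) by rewrite mulr_gt0// ltr_wpDl.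
have [C hC] := ec _ K0.
apply: normed_cvg; apply: (@series_le_cvg _ _ (geometric C 2^-1)).
- by move=> n /=.
- move=> n /=; rewrite mulr_ge0 ?exprn_ge0 ?invr_ge0//.
  by apply: le_trans (hC 0%N); rewrite expr0 mulr1.
- move=> n /=; rewrite exprVn ler_pdivlMr ?exprn_gt0//.
  apply: le_trans (hC n); rewrite normrM -mulrA; apply: ler_wpM2l => //.
  rewrite exprMn mulrC; apply: ler_wpM2l; first exact: exprn_ge0.
  by rewrite normrX; apply: lerXn2r; rewrite ?nnegrE ?addr_ge0 ?lerDl//.
by apply: is_cvg_geometric_series; rewrite ger0_norm ?invr_ge0// invf_lt1// ltr1n.
Qed.

Lemma entire_coef_diffs c : entire_coef c -> entire_coef (pseries_diffs c).
Proof.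
move=> ec K K0; have K20 : 0 < 2 * K by rewrite mulr_gt0.
(* Doubling the radius absorbs the factor [n + 1 <= 2^(n+1)] that differentiation produces. *)
have [C hC] := ec _ K20; exists (C / K) => n.
rewrite ler_pdivlMr// /pseries_diffs normrM ger0_norm// -mulrA -exprSr.
apply: le_trans (hC n.+1); rewrite exprMn.
rewrite (mulrC n.+1%:R) -!mulrA; apply: ler_wpM2l => //.
apply: ler_wpM2r; first by rewrite exprn_ge0// ltW.
by rewrite -natrX ler_nat ltnW// ltn_expl.
Qed.

Lemma entire_is_derive c x : entire_coef c ->
  is_derive x 1 (fun x => limn (pseries c x)) (limn (pseries (pseries_diffs c) x)).
Proof.
move=> ec; have ec1 := entire_coef_diffs ec; have ec2 := entire_coef_diffs ec1.
apply: (@pseries_snd_diffs _ c (`|x| + 1)); do ?exact: entire_coef_cvg.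
by rewrite [ltRHS]ger0_norm ?addr_ge0// ltrDl.
Qed.

End EntireSeries.

(** * Mittag-Leffler functions and their kernels *)

Section MittagLeffler.
Context {R : realType}.
Local Notation mu := (@lebesgue_measure R).
Variables (rho : R) (rho_gt0 : 0 < rho).
Implicit Types (a b x z lam t : R).

Definition ml_coef a (n : nat) : R := (Gamma (rho * n%:R + a))^-1.

Lemma ml_coef_arg_gt0 a (n : nat) : 0 < a -> 0 < rho * n%:R + a.
Proof. by move=> a0; rewrite ltr_wpDl// mulr_ge0// ltW. Qed.

Lemma ml_coef_gt0 a n : 0 < a -> 0 < ml_coef a n.
Proof. by move=> a0; rewrite invr_gt0 Gamma_gt0// ml_coef_arg_gt0. Qed.

Lemma ml_coef_entire a : 0 < a -> entire_coef (ml_coef a).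
Proof.
move=> a0 K K0.
(* Chosen so that [M^rho >= K]: then [Gamma (rho n + a)] exceeds a constant times [K^n]. The summand
   1 makes [M >= 1]. *)
pose M := (K + 1) `^ rho^-1.
have M1 : 1 <= M.
  by rewrite -(powRr0 (K + 1)); apply: ler_powR; [rewrite lerDr ltW|rewrite invr_ge0 ltW].
have M0 : 0 < M by lra.
have Mrho : K <= M `^ rho.
  rewrite /M -powRrM mulVf ?gt_eqF// powRr1; last lra.
  by rewrite lerDl.
pose C := 2 * expR (M + 1) / M `^ (a - 1).
have C0 : 0 < C by exact: (divr_gt0 (mulr_gt0 (ltr0n _ 2) (expR_gt0 _)) (powR_gt0 _ M0)).
exists C => n; rewrite ger0_norm; last exact/ltW/ml_coef_gt0.
have := Gamma_lower_bound (ml_coef_arg_gt0 n a0) M1.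
have g0 := Gamma_gt0 (ml_coef_arg_gt0 n a0).
rewrite /ml_coef; move: (Gamma _) g0 => g g0 hg.
rewrite mulrC ler_pdivrMr//.
apply: (@le_trans _ _ (C * (M `^ (rho * n%:R + a - 1) / 2 * expR (- (M + 1))))); last first.
  by apply: ler_wpM2l => //; exact: ltW.
have -> : rho * n%:R + a - 1 = rho * n%:R + (a - 1) by ring.
rewrite powRD; last by rewrite (gt_eqF M0) implybT.
rewrite powRrM powR_mulrn ?powR_ge0//.
have -> : C * (M `^ rho ^+ n * M `^ (a - 1) / 2 * expR (- (M + 1))) = M `^ rho ^+ n.
  rewrite /C expRN; move: (expR_gt0 (M + 1)) (powR_gt0 (a - 1) M0).
  by move: (expR (M + 1)) (M `^ (a - 1)) => e p e0 p0; field; rewrite !gt_eqF.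
by apply: lerXn2r; rewrite ?nnegrE ?powR_ge0// ltW.
Qed.

Lemma mittag_lefflerE a z : mittag_leffler rho a z = limn (pseries (ml_coef a) z).
Proof.
rewrite /mittag_leffler /pseries; congr (limn (series _)); apply/funext => n.
by rewrite mulrC.
Qed.

Lemma mittag_leffler_cvg a z : 0 < a ->
  pseries (ml_coef a) z n @[n --> \oo] --> mittag_leffler rho a z.
Proof. by move=> a0; rewrite mittag_lefflerE; exact/entire_coef_cvg/ml_coef_entire. Qed.

Lemma mittag_leffler_derivable a z : 0 < a -> derivable (mittag_leffler rho a) z 1.
Proof.
move=> a0; rewrite (_ : mittag_leffler rho a = fun x => limn (pseries (ml_coef a) x)); last first.
  by apply/funext => x; exact: mittag_lefflerE.
by have /@ex_derive := entire_is_derive z (ml_coef_entire a0).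
Qed.

Lemma mittag_leffler0 a : mittag_leffler rho a 0 = (Gamma a)^-1.
Proof.
rewrite mittag_lefflerE; apply/cvg_lim => //.
rewrite -(cvg_shiftS (pseries _ _)).
apply: cvg_near_cst; apply: nearW => n; apply/eqP.
rewrite /pseries /series/= big_nat_recl//= expr0 mulr1 /ml_coef mulr0 add0r.
rewrite big1 ?addr0// => i _; by rewrite expr0n mulr0.
Qed.

Fact ml_kernel_key : unit. Proof. by []. Qed.
(** The overview's [e] is the case [a = rho] and [s] the case [a = 1]; a general [a] is kept because
    convolution with [pow_kernel b] turns it into [b + a]. *)
Definition ml_kernel : R -> R -> R -> R := locked_with ml_kernel_key (fun lam a x =>
  if 0 < x then x `^ (a - 1) * mittag_leffler rho a (- lam * x `^ rho) else 0).

Lemma ml_kernelE lam a x : 0 < x ->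
  ml_kernel lam a x = x `^ (a - 1) * mittag_leffler rho a (- lam * x `^ rho).
Proof. by move=> x0; rewrite /ml_kernel unlock x0. Qed.

(** Partial sums of the series of [ml_kernel], written in power kernels so that the semigroup law
    acts term by term. *)
Definition ml_partial lam a (N : nat) x : R :=
  \sum_(0 <= i < N) (- lam) ^+ i * pow_kernel (a + rho * i%:R) x.

Lemma ml_kernel_le0 lam a x : x <= 0 -> ml_kernel lam a x = 0.
Proof. by rewrite leNgt /ml_kernel unlock => /negbTE ->. Qed.

Lemma ml_partialE lam a N x : 0 < x ->
  ml_partial lam a N x = x `^ (a - 1) * pseries (ml_coef a) (- lam * x `^ rho) N.
Proof.
move=> x0; rewrite /ml_partial /pseries /series/= mulr_sumr; apply: eq_bigr => i _.
rewrite pow_kernelE// /ml_coef (addrC a).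
have -> : rho * i%:R + a - 1 = rho * i%:R + (a - 1) by ring.
rewrite (@powRD _ x (rho * i%:R)); last by rewrite (gt_eqF x0) implybT.
by rewrite powRrM powR_mulrn ?powR_ge0// exprMn; ring.
Qed.

Lemma ml_partial_cvg lam a x : 0 < a -> ml_partial lam a N x @[N --> \oo] --> ml_kernel lam a x.
Proof.
move=> a0; have [x0|x0] := leP x 0.
  rewrite ml_kernel_le0//; apply: cvg_near_cst; apply: nearW => N.
  by rewrite /ml_partial big1// => i _; rewrite pow_kernel_le0// mulr0.
rewrite (_ : (fun N => _) = fun N => x `^ (a - 1) * pseries (ml_coef a) (- lam * x `^ rho) N); last first.
  by apply/funext => N; rewrite ml_partialE.
rewrite ml_kernelE//; apply: cvgM; [exact: cvg_cst|exact: mittag_leffler_cvg].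
Qed.

(** Up to the factor [x^(a-1)], every partial sum is bounded by the sum, with positive terms, of the
    series at [|lam| |T|^rho]. Uniformity in [N] makes the limit tame and provides the majorant in
    [conv_ml_kernel]. *)
Lemma ml_partial_bound lam a T : 0 < a -> exists2 C : R, 0 <= C &
  forall N x, x <= T -> `|ml_partial lam a N x| <= C * pow_kernel a x.
Proof.
move=> a0; have ga := Gamma_gt0 a0.
pose S := mittag_leffler rho a (`|lam| * `|T| `^ rho).
have hS N : 0 <= pseries (ml_coef a) (`|lam| * `|T| `^ rho) N <= S.
  rewrite /pseries /series/= sumr_ge0/=; last first.
    by move=> i _; rewrite mulr_ge0 ?exprn_ge0 ?mulr_ge0 ?powR_ge0// ltW// ml_coef_gt0.
  rewrite /S mittag_lefflerE.
  apply: (@nondecreasing_cvgn_le _ (pseries (ml_coef a) (`|lam| * `|T| `^ rho))).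
    apply/nondecreasing_seqP => n; rewrite /pseries /series/= big_nat_recr//= lerDl.
    by rewrite mulr_ge0 ?exprn_ge0 ?mulr_ge0 ?powR_ge0// ltW// ml_coef_gt0.
  exact/entire_coef_cvg/ml_coef_entire.
have S0 : 0 <= S by have /andP[h1 h2] := hS 0%N; exact: le_trans h1 h2.
exists (S * Gamma a); first by rewrite mulr_ge0// ltW.
move=> N x xT; have [x0|x0] := leP x 0.
  rewrite pow_kernel_le0// mulr0 /ml_partial big1 ?normr0// => i _.
  by rewrite pow_kernel_le0// mulr0.
rewrite ml_partialE// pow_kernelE// normrM ger0_norm ?powR_ge0//.
have -> : S * Gamma a * (x `^ (a - 1) / Gamma a) = x `^ (a - 1) * S.
  by rewrite mulrACA divff ?gt_eqF// mulr1 mulrC.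
apply: ler_wpM2l; first exact: powR_ge0.
have /andP[_] := hS N; apply: le_trans.
rewrite /pseries /series/=; apply: (le_trans (ler_norm_sum _ _ _)); apply: ler_sum => i _.
rewrite normrM ger0_norm; last exact/ltW/ml_coef_gt0.
apply: ler_wpM2l; first exact/ltW/ml_coef_gt0.
rewrite normrX normrM normrN (ger0_norm (powR_ge0 _ _)).
apply: lerXn2r; rewrite ?nnegrE ?mulr_ge0 ?powR_ge0//.
apply: ler_wpM2l => //; apply: ge0_ler_powR; rewrite ?nnegrE ?normr_ge0 ?(ltW x0) ?(ltW rho_gt0)//.
exact: le_trans xT (ler_norm _).
Qed.

Lemma tame_ml_partial lam a N : 0 < a -> tame (ml_partial lam a N).
Proof.
move=> a0; split.
  apply: measurable_sum => i; apply: measurable_funM => //; exact: measurable_pow_kernel.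
exists a => // T; have [C C0 hC] := ml_partial_bound lam T a0.
by exists C => // x xT; exact: hC.
Qed.

Lemma tame_ml_kernel lam a : 0 < a -> tame (ml_kernel lam a).
Proof.
move=> a0; split.
  apply: (@measurable_fun_cvg _ _ _ _ (ml_partial lam a)).
    by move=> N; exact: tame_measurable (tame_ml_partial lam N a0).
  by move=> x _; exact: ml_partial_cvg.
exists a => // T; have [C C0 hC] := ml_partial_bound lam T a0.
exists C => // x xT.
have h : `|ml_partial lam a N x| @[N --> \oo] --> `|ml_kernel lam a x|.
  by apply: cvg_norm; exact: ml_partial_cvg.
by apply: (cvgr_to_le h); apply: nearW => N; exact: hC.
Qed.

Lemma conv_ml_partial lam a b N t : 0 < a -> 0 < b ->
  conv (pow_kernel b) (ml_partial lam a N) t = ml_partial lam (b + a) N t.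
Proof.
move=> a0 b0; have tb := tame_pow_kernel b0.
have ai i : 0 < a + rho * i%:R by rewrite addrC ml_coef_arg_gt0.
elim: N => [|N IH].
  rewrite /ml_partial big_nil convE.
  under eq_Rintegral do rewrite big_nil mulr0.
  by rewrite Rintegral_cst// mul0r.
have -> : ml_partial lam a N.+1 = fun x => ml_partial lam a N x +
    (- lam) ^+ N * pow_kernel (a + rho * N%:R) x.
  by apply/funext => x; rewrite /ml_partial big_nat_recr.
rewrite convDr; last 2 first.
- by apply: tame_conv_int => //; exact: tame_ml_partial.
- by apply: tame_conv_int => //; apply: tameZ; exact: tame_pow_kernel.
rewrite IH convZr; last by apply: tame_conv_int => //; exact: tame_pow_kernel.
by rewrite conv_pow_kernel// addrA /ml_partial big_nat_recr.
Qed.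

(** The partial sums obey the semigroup law, and dominated convergence passes to the limit. *)
Lemma conv_ml_kernel lam a b t : 0 < a -> 0 < b ->
  conv (pow_kernel b) (ml_kernel lam a) t = ml_kernel lam (b + a) t.
Proof.
move=> a0 b0; have tb := tame_pow_kernel b0.
have [C C0 hC] := ml_partial_bound lam t a0.
have ab := @ml_partial_cvg lam (b + a) t (addr_gt0 b0 a0).
have [] := @dominated_convergence _ _ _ mu setT measurableT
  (fun N x => (pow_kernel b (t - x) * ml_partial lam a N x)%:E)
  (fun x => (pow_kernel b (t - x) * ml_kernel lam a x)%:E)
  (fun x => (C * (pow_kernel b (t - x) * pow_kernel a x))%:E).
- move=> N; apply/measurable_EFinP.
  exact: (measurable_conv_integrand1 t (tame_measurable tb) (tame_measurable (tame_ml_partial lam N a0))).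
- apply/measurable_EFinP.
  exact: (measurable_conv_integrand1 t (tame_measurable tb) (tame_measurable (tame_ml_kernel lam a0))).
- apply: aeW => x _; apply: cvg_EFin; first exact: nearW.
  by apply: cvgM; [exact: cvg_cst|exact: ml_partial_cvg].
- exact: (integrableZl measurableT C (pow_kernel_conv_int t b0 a0)).
- apply: aeW => x N _; rewrite abse_EFin lee_fin normrM mulrCA.
  have [xt|xt] := leP t x.
    by rewrite pow_kernel_le0 ?subr_le0// normr0 !mul0r.
  rewrite (ger0_norm (pow_kernel_ge0 _ b0)); apply: ler_wpM2l; first exact: pow_kernel_ge0.
  exact/hC/ltW.
move=> _ _ /=; rewrite -(EFin_conv (tame_conv_int t tb (tame_ml_kernel lam a0))) => /fine_cvgP[_].
rewrite (_ : fine \o _ = fun N => ml_partial lam (b + a) N t).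
  by move=> h; exact: (cvg_unique _ h ab).
by apply/funext => n /=; rewrite -conv_ml_partial// convE.
Qed.

(** The first term of the series is split off; the others carry a factor [- lam] and an exponent
    raised by [rho]. *)
Lemma ml_kernel_rec lam a x : 0 < a ->
  ml_kernel lam a x = pow_kernel a x - lam * ml_kernel lam (a + rho) x.
Proof.
move=> a0.
have h1 : ml_partial lam a N.+1 x @[N --> \oo] --> ml_kernel lam a x.
  by rewrite (cvg_shiftS (ml_partial lam a ^~ x)); exact: ml_partial_cvg.
apply: (cvg_unique _ h1) => //.
rewrite (_ : (fun N => _) = fun N => pow_kernel a x - lam * ml_partial lam (a + rho) N x).
  apply: cvgB; first exact: cvg_cst.
  apply: cvgM; first exact: cvg_cst.
  by apply: ml_partial_cvg; exact: addr_gt0.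
apply/funext => N; rewrite /ml_partial big_nat_recl//= expr0 mul1r mulr0 addr0; congr (_ + _).
rewrite -mulNr mulr_sumr; apply: eq_bigr => i _.
by rewrite exprS -mulrA; congr (_ * (_ * pow_kernel _ _)); rewrite -natr1; ring.
Qed.

Lemma ml_kernel_derivable lam a x : 0 < a -> 0 < x -> derivable (ml_kernel lam a) x 1.
Proof.
move=> a0 x0.
apply: (@near_eq_derivable _ _ _ (fun x => x `^ (a - 1) * mittag_leffler rho a (- lam * x `^ rho))) => //.
  by near=> y; rewrite ml_kernelE//; near: y; exact: lt_nbhsr.
have dp p : derivable (@powR R ^~ p) x 1 by apply: derivable_powR; rewrite in_itv/= x0.
apply: derivableM; first exact: dp.
apply/derivable1_diffP.
apply: (@differentiable_comp _ _ _ _ (fun x => - lam * x `^ rho) (mittag_leffler rho a)).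
  by apply/derivable1_diffP; apply: derivableM => //; exact: derivable_cst.
by apply/derivable1_diffP; exact: mittag_leffler_derivable.
Unshelve. all: by end_near. Qed.

Lemma ml_kernel_continuous lam a x : 0 < a -> x != 0 -> {for x, continuous (ml_kernel lam a)}.
Proof.
move=> a0; rewrite neq_lt => /orP[x0|x0].
  apply: (@eq_conv_continuous _ (cst 0)); first exact: cst_continuous.
  near=> y; rewrite ml_kernel_le0//; apply: ltW.
  by near: y; exact: lt_nbhsl.
by apply: differentiable_continuous; apply/derivable1_diffP; exact: ml_kernel_derivable.
Unshelve. all: by end_near. Qed.

End MittagLeffler.

(** * Positivity of the resolvent kernel *)

Section RelaxationKernel.
Context {R : realType}.
Local Notation mu := (@lebesgue_measure R).
Variables (rho lam : R) (rho_gt0 : 0 < rho) (lam_gt0 : 0 < lam).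
Implicit Types (a b x t : R).

Local Notation e := (ml_kernel rho lam rho).
Local Notation s := (ml_kernel rho lam 1).
Local Notation k := (pow_kernel rho).

Lemma Rintegral_indic_itv a b : a <= b -> \int[mu]_x (\1_(`[a, b]) x : R) = b - a.
Proof.
move=> ab; rewrite /Rintegral.
rewrite (_ : (\int[mu]_x _)%E = lebesgue_measure (`[a, b]%classic : set R)).
  rewrite lebesgue_measure_itv/= lte_fin; case: ltP => [_|ba]; first by rewrite -EFinB.
  by have -> : a = b; [apply/eqP; rewrite eq_le ab|rewrite subrr].
by rewrite integral_indic ?setIT.
Qed.

Lemma resolvent_eq t : e t = k t - lam * conv k e t.
Proof. by rewrite conv_ml_kernel//; exact: ml_kernel_rec. Qed.

Lemma ml_kernel1E t : s t = pow_kernel 1 t - lam * conv (pow_kernel 1) e t.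
Proof. by rewrite conv_ml_kernel//; exact: ml_kernel_rec. Qed.

(** The Mittag-Leffler function has the positive value [1 / Gamma(rho)] at 0 and is continuous; the
    witness makes [lam x^rho <= d / 2]. *)
Lemma ml_kernel_near0 : exists2 d : R, 0 < d & forall x, 0 < x -> x <= d -> 0 < e x.
Proof.
have c0 : {for 0, continuous (mittag_leffler rho rho)}.
  by apply: differentiable_continuous; apply/derivable1_diffP; exact: mittag_leffler_derivable.
have M0 : 0 < mittag_leffler rho rho 0 by rewrite mittag_leffler0// invr_gt0 Gamma_gt0.
have /cvgrPdist_lt/(_ _ M0)[d /= d0 hd] := c0.
exists ((d / 2 / lam) `^ rho^-1).
  by rewrite powR_gt0// !divr_gt0.
move=> x x0 xd; rewrite ml_kernelE// mulr_gt0 ?powR_gt0//.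
suff : `|mittag_leffler rho rho 0 - mittag_leffler rho rho (- lam * x `^ rho)| < mittag_leffler rho rho 0.
  by rewrite ltr_norml => /andP[_ h]; lra.
apply: hd; rewrite /= sub0r normrN normrM normrN (gtr0_norm lam_gt0) (ger0_norm (powR_ge0 _ _)).
have : x `^ rho <= d / 2 / lam.
  rewrite [leRHS](_ : _ = ((d / 2 / lam) `^ rho^-1) `^ rho); last first.
    by rewrite -powRrM (mulVf (lt0r_neq0 rho_gt0)) powRr1// !divr_ge0// ltW.
  apply: ge0_ler_powR => //.
  - exact: ltW.
  - by rewrite nnegrE ltW.
  - by rewrite nnegrE powR_ge0.
by rewrite ler_pdivlMr// mulrC => h; apply: le_lt_trans h _; lra.
Qed.

(** Young's inequality for [u^p] and 1 with the conjugate exponents [1 / p] and [1 / (1 - p)]. *)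
Lemma bernoulli_powR (u p : R) : 0 < u -> 0 < p < 1 -> u `^ p <= 1 + p * (u - 1).
Proof.
move=> u0 /andP[p0 p1].
have := @conjugate_powR _ (u `^ p) 1 p^-1 (1 - p)^-1 (powR_ge0 _ _) ler01.
rewrite !invr_gt0 !invrK mulr1 powR1 mul1r -powRrM (divff (lt0r_neq0 p0)) (powRr1 (ltW u0)) => h.
by apply: le_trans (h p0 _ _) _; lra.
Qed.

Lemma pow_kernel_small a (c : R) : 1 < a -> 0 < c -> exists2 d : R, 0 < d &
  forall x, x <= d -> pow_kernel a x < c.
Proof.
move=> a1 c0; have a0 : 0 < a - 1 by lra.
have ga : 0 < Gamma a by apply: Gamma_gt0; lra.
have cg : 0 < c * Gamma a / 2 by rewrite divr_gt0// mulr_gt0.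
exists ((c * Gamma a / 2) `^ (a - 1)^-1); first by rewrite powR_gt0.
move=> x xd; have [x0|x0] := leP x 0; first by rewrite pow_kernel_le0.
rewrite pow_kernelE// ltr_pdivrMr//.
apply: (@le_lt_trans _ _ (c * Gamma a / 2)); last first.
  by move: (mulr_gt0 c0 ga) => h; lra.
rewrite [leRHS](_ : _ = ((c * Gamma a / 2) `^ (a - 1)^-1) `^ (a - 1)); last first.
  by rewrite -powRrM (mulVf (lt0r_neq0 a0)) (powRr1 (ltW cg)).
apply: ge0_ler_powR => //.
- exact: ltW.
- by rewrite nnegrE ltW.
- by rewrite nnegrE powR_ge0.
Qed.

(** [e] is differentiable at its zero [t1], so it vanishes there at least linearly. This makes the
    contribution of []t, t1[] in [first_zero_absurd] of higher order than the gap. *)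
Lemma ml_kernel_left_bound t1 : 0 < t1 -> e t1 = 0 -> exists L d : R, [/\ 0 < L, 0 < d &
    forall x, t1 - d < x -> x < t1 -> e x <= L * (t1 - x)].
Proof.
move=> t10 et1.
have : derivable e t1 1 by exact: ml_kernel_derivable.
rewrite /derivable => /cvg_ex[l].
move=> /cvgrPdist_lt/(_ 1 ltr01)[d /= d0 hd].
have L0 : 0 < `|l| + 1 :> R by rewrite ltr_wpDl ?normr_ge0.
exists (`|l| + 1), d; split => //.
move=> x xd xt.
have x0 : x - t1 != 0 by rewrite subr_eq0 lt_eqF.
have := hd (x - t1); rewrite /= sub0r normrN ltr0_norm ?subr_lt0//.
move=> /(_ _ x0); rewrite [(x - t1)%:A]mulr1 subrK et1 subr0.
have -> : - (x - t1) < d by lra.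
move=> /(_ isT); rewrite /GRing.scale/= => hl.
have : `|(x - t1)^-1 * e x| < `|l| + 1.
  have := ler_normB l (l - (x - t1)^-1 * e x).
  rewrite opprB addrC subrK => h; apply: le_lt_trans h _; lra.
rewrite normrM normfV [`|x - t1|]ltr0_norm ?subr_lt0// opprB mulrC ltr_pdivrMr ?subr_gt0//.
by move=> h; rewrite (le_trans (ler_norm _))// ltW.
Qed.

Lemma ml_kernel_min t1 : 0 < t1 -> (forall x, 0 < x -> x < t1 -> 0 < e x) ->
  exists m : R, 0 < m /\ forall x, t1 / 4 <= x -> x <= t1 / 2 -> m <= e x.
Proof.
move=> t10 epos; have t12 : t1 / 4 <= t1 / 2 by lra.
have [|c cin hc] := @EVT_min R e (t1 / 4) (t1 / 2) t12.
  apply: continuous_in_subspaceT => x; rewrite inE/= in_itv/= => /andP[h1 h2].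
  by apply: ml_kernel_continuous => //; apply/lt0r_neq0; lra.
exists (e c); split.
  by move: cin; rewrite in_itv/= => /andP[h1 h2]; apply: epos; lra.
by move=> x h1 h2; apply: hc; rewrite in_itv/= h1.
Qed.

(* The strict log-convexity of [k], with an explicit gap, by Bernoulli's inequality. *)
Lemma pow_kernel_gap t t1 x : rho < 1 -> 0 < x -> x < t -> t < t1 ->
  k t / k t1 * k (t1 - x) - k (t - x) <= - (1 - rho) * (x * (t1 - t) / (t * (t1 - x))) * k (t - x).
Proof.
move=> rho1 x0 xt tt1.
have [t0 t10 h1 h2] : [/\ 0 < t, 0 < t1, 0 < t1 - x & 0 < t - x] by split; lra.
(* The quotient of [k t / k t1 * k (t1 - x)] by [k (t - x)] is [u^(1 - rho)], and [1 - u] is the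
   fraction in the statement. *)
pose u := t1 * (t - x) / (t * (t1 - x)).
have u0 : 0 < u by rewrite divr_gt0// mulr_gt0.
have -> : k t / k t1 * k (t1 - x) = u `^ (1 - rho) * k (t - x).
  have G0 := Gamma_gt0 rho_gt0; rewrite !pow_kernelE//.
  have -> : u `^ (1 - rho) = t1 `^ (1 - rho) * (t - x) `^ (1 - rho) * t `^ (rho - 1) * (t1 - x) `^ (rho - 1).
    rewrite /u powRM; last 2 first.
    - by rewrite mulr_ge0// ltW.
    - by rewrite invr_ge0 mulr_ge0// ltW.
    rewrite powRM ?(ltW t10) ?(ltW h2)// -powR_inv1 ?mulr_ge0 ?(ltW t0) ?(ltW h1)//.
    rewrite -powRrM mulN1r opprB powRM ?(ltW t0) ?(ltW h1)//.
    by rewrite mulrA.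
  have -> : 1 - rho = - (rho - 1) by ring.
  rewrite !powRN.
  move: (powR_gt0 (rho - 1) t0) (powR_gt0 (rho - 1) t10) (powR_gt0 (rho - 1) h1) (powR_gt0 (rho - 1) h2).
  move: (Gamma rho) (t `^ _) (t1 `^ _) ((t1 - x) `^ _) ((t - x) `^ _) G0 => G A B C D' G0 A0 B0 C0 D0.
  by field; rewrite !gt_eqF.
have hb : u `^ (1 - rho) <= 1 + (1 - rho) * (u - 1) by apply: bernoulli_powR => //; have r0 := rho_gt0; apply/andP; split; lra.
have -> : x * (t1 - t) / (t * (t1 - x)) = 1 - u.
  by rewrite /u; field; rewrite (gt_eqF t0) (gt_eqF h1).
have kp := pow_kernel_ge0 (t - x) rho_gt0.
rewrite -{2}[k (t - x)]mul1r -mulrBl; apply: ler_wpM2r => //; lra.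
Qed.

(** Multiplication by [e > 0] keeps the sign of the gap everywhere; a quantitative bound is only
    needed on [[t1 / 4, t1 / 2]], away from both ends, where [e] has a positive minimum. *)
Lemma gap_bound t1 : rho < 1 -> 0 < t1 -> (forall x, 0 < x -> x < t1 -> 0 < e x) ->
  exists c0 : R, 0 < c0 /\ forall t x, t < t1 -> 0 < x -> x < t ->
    (k t / k t1 * k (t1 - x) - k (t - x)) * e x <= - ((t1 - t) * c0 * \1_(`[t1 / 4, t1 / 2]) x).
Proof.
move=> rho1 t10 epos; have kt1 : 0 < k t1 by exact: pow_kernel_gt0.
have [m [m0 hm]] := ml_kernel_min t10 epos.
have t14 : 0 < (1 - rho) / (4 * t1) by rewrite divr_gt0 ?subr_gt0// mulr_gt0.
(* [k t1] bounds [k (t - x)] from below because [k] decreases, [(1 - rho) / (4 t1)] comes from the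
   Bernoulli gap with [x >= t1 / 4], and [m] bounds [e]. *)
exists (k t1 * ((1 - rho) / (4 * t1)) * m); split.
  exact: (mulr_gt0 (mulr_gt0 kt1 t14) m0).
move=> t x tt1 x0 xt.
have ex : 0 < e x by apply: epos; lra.
have g := pow_kernel_gap rho1 x0 xt tt1.
have kp := pow_kernel_ge0 (t - x) rho_gt0.
have ratio0 : 0 <= (1 - rho) * (x * (t1 - t) / (t * (t1 - x))).
  by rewrite mulr_ge0 ?divr_ge0 ?mulr_ge0//; lra.
have [xI|xI] := boolP (x \in `[t1 / 4, t1 / 2]); last first.
  rewrite indicE mem_setE (negbTE xI) mulr0 oppr0.
  rewrite pmulr_lle0//; apply: le_trans g _.
  by rewrite !mulNr oppr_le0 mulr_ge0.
rewrite indicE mem_setE xI mulr1.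
move: xI; rewrite in_itv/= => /andP[x1 x2].
apply: (@le_trans _ _ (- (1 - rho) * (x * (t1 - t) / (t * (t1 - x))) * k (t - x) * e x)).
  by apply: ler_wpM2r => //; exact: ltW.
rewrite !mulNr lerN2.
have hk : k t1 <= k (t - x).
  rewrite !pow_kernelE//; last lra.
  apply: ler_wpM2r; first by rewrite invr_ge0 ltW// Gamma_gt0.
  have -> : rho - 1 = - (1 - rho) by ring.
  rewrite !powRN lef_pV2 ?posrE ?powR_gt0//; last lra.
  by apply: ge0_ler_powR; rewrite ?nnegrE//; lra.
have hr : (t1 - t) / (4 * t1) <= x * (t1 - t) / (t * (t1 - x)).
  rewrite ler_pdivrMr ?mulr_gt0// mulrAC ler_pdivlMr; last by rewrite mulr_gt0//; lra.
  have -> : x * (t1 - t) * (4 * t1) = (t1 - t) * (4 * x * t1) by ring.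
  apply: ler_wpM2l; first lra.
  have h4 : t1 <= 4 * x by lra.
  have -> : 4 * x * t1 = t1 * (4 * x) by ring.
  by apply: ler_pM; lra.
have -> : (t1 - t) * (k t1 * ((1 - rho) / (4 * t1)) * m) =
   (1 - rho) * ((t1 - t) / (4 * t1)) * k t1 * m by ring.
have d0 : 0 <= (t1 - t) / (4 * t1) by rewrite divr_ge0//; lra.
apply: ler_pM; last exact: hm.
- by rewrite mulr_ge0 ?(ltW kt1)// mulr_ge0//; lra.
- exact: ltW.
apply: ler_pM => //.
- by rewrite mulr_ge0//; lra.
- exact: ltW.
by apply: ler_wpM2l => //; lra.
Qed.

(** The second factor is the indicator of []c, +oo[]; a translation by [c] reduces the integral to
    the semigroup law. *)
Lemma shifted_kernel t1 (c : R) : 0 <= c ->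
  mu.-integrable setT (EFin \o (fun x => k (t1 - x) * pow_kernel 1 (x - c))) /\
  \int[mu]_x (k (t1 - x) * pow_kernel 1 (x - c)) = pow_kernel (rho + 1) (t1 - c).
Proof.
move=> c0.
have mw : measurable_fun setT (fun x => k (t1 - x) * pow_kernel 1 (x - c)).
  apply: measurable_funM; (apply: measurableT_comp; [exact: measurable_pow_kernel|exact: measurable_funB]).
split.
  apply: le_integrable (pow_kernel_conv_int t1 rho_gt0 ltr01) => //.
    exact/measurable_EFinP.
  move=> x _ /=; rewrite lee_fin !normrM; apply: ler_wpM2l => //.
  rewrite !ger0_norm ?pow_kernel_ge0// !pow_kernel1.
  by case: ifPn => // h; [rewrite ifT//; lra|case: ifP].
rewrite /Rintegral.
rewrite -(@integral_shift _ (- c) (fun x => (k (t1 - x) * pow_kernel 1 (x - c))%:E)); last first.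
  exact/measurable_EFinP.
rewrite -(@conv_pow_kernel _ rho 1)// convE /Rintegral; congr fine; apply: eq_integral => x _.
congr ((pow_kernel _ _ * pow_kernel _ _)%:E); ring.
Qed.

(** For [0 < x < t] the gap applies, for [t <= x < t1] the linear bound on [e]; elsewhere both sides
    vanish. The cut at [2 t - t1] instead of [t] includes the point [x = t], where a Heaviside
    factor jumping at [t] would be 0. *)
Lemma integrand_bound t t1 (L d c0 : R) : tame e -> 0 < t -> t < t1 -> 3 / 4 * t1 < t -> t1 - d < t ->
  0 < L -> k t / k t1 <= 2 -> (forall x, 0 < x -> x < t1 -> 0 < e x) ->
  (forall x, t1 - d < x -> x < t1 -> e x <= L * (t1 - x)) ->
  (forall t x, t < t1 -> 0 < x -> x < t ->
    (k t / k t1 * k (t1 - x) - k (t - x)) * e x <= - ((t1 - t) * c0 * \1_(`[t1 / 4, t1 / 2]) x)) ->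
  forall x, k t / k t1 * (k (t1 - x) * e x) - k (t - x) * e x <=
    (t1 - t) * (2 * L) * (k (t1 - x) * pow_kernel 1 (x - (2 * t - t1))) -
    (t1 - t) * c0 * \1_(`[t1 / 4, t1 / 2]) x.
Proof.
move=> te t0 tt1 t34 td L0 q2 epos hL hgap x.
have t10 : 0 < t1 by lra.
have q1 : 0 < k t / k t1 by rewrite divr_gt0// pow_kernel_gt0.
have w0 : 0 <= k (t1 - x) * pow_kernel 1 (x - (2 * t - t1)) by rewrite mulr_ge0 ?pow_kernel_ge0.
have Lw : 0 <= (t1 - t) * (2 * L) * (k (t1 - x) * pow_kernel 1 (x - (2 * t - t1))).
  by rewrite mulr_ge0// mulr_ge0 ?mulr_ge0 ?subr_ge0 ?(ltW L0) ?(ltW tt1).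
have [x0|x0] := leP x 0.
  rewrite (tame_le0 te x0) !mulr0 subr0 indicE memNset ?mulr0 ?subr0//=.
  by rewrite in_itv/= => /andP[h _]; lra.
have [xt|xt] := ltP x t.
  rewrite mulrA -mulrBl; apply: le_trans (hgap _ _ tt1 x0 xt) _; rewrite lerBrDr addrC subrr.
  exact: Lw.
rewrite [k (t - x)]pow_kernel_le0; last lra.
rewrite mul0r subr0 indicE memNset ?mulr0 ?subr0//=; last first.
  by rewrite in_itv/= => /andP[_ h]; lra.
have [xt1|xt1] := leP t1 x.
  by rewrite [k (t1 - x)]pow_kernel_le0 ?mul0r ?mulr0//; lra.
rewrite [pow_kernel 1 _]pow_kernel1 ifT ?mulr1; last lra.
have hLx := hL x ltac:(lra) xt1.
have kp := pow_kernel_ge0 (t1 - x) rho_gt0.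
have -> : (t1 - t) * (2 * L) * k (t1 - x) = 2 * (k (t1 - x) * (L * (t1 - t))) by ring.
have ex : 0 < e x by apply: epos; lra.
apply: ler_pM => //; [exact: ltW|by rewrite mulr_ge0// ltW|].
apply: ler_wpM2l => //; apply: le_trans hLx _; apply: ler_wpM2l; lra.
Qed.

(* For [t < t1], subtract the equation [e = k - lam k * e] at [t] from [k t / k t1] times the
   equation at the zero [t1].  By log-convexity the part of the integrals over [`]0, t[] has a gap of
   order [t1 - t], which the part over [`]t, t1[], of order [(t1 - t)^(1 + rho)], cannot close. *)
Lemma first_zero_absurd t1 : rho < 1 -> 0 < t1 -> e t1 = 0 ->
  (forall x, 0 < x -> x < t1 -> 0 < e x) -> False.
Proof.
move=> rho1 t10 et1 epos.
have t142 : t1 / 4 <= t1 / 2 by lra.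
have t124 : t1 / 2 - t1 / 4 = t1 / 4 by field.
have te : tame e := tame_ml_kernel rho_gt0 lam rho_gt0.
have tk : tame k := tame_pow_kernel rho_gt0.
have kt1 : 0 < k t1 by exact: pow_kernel_gt0.
have [L [d [L0 d0 hL]]] := ml_kernel_left_bound t10 et1.
have [c0 [c00 hgap]] := gap_bound rho1 t10 epos.
(* Close to [t1], the linear bound is available on []t, t1[], the kernel ratio is at most 2, and the
   contribution of []t, t1[] is smaller than the gap, which is spread over an interval of length
   [t1 / 4]. *)
have [t [tt1 t34 td qt2 small]] : exists t, [/\ t < t1, 3 / 4 * t1 < t, t1 - d < t,
   k t <= 2 * k t1 & 2 * L * pow_kernel (rho + 1) (2 * (t1 - t)) < c0 * (t1 / 4)].
  have [d1 d10 hd1] : exists2 d1 : R, 0 < d1 & forall x, x <= d1 ->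
      pow_kernel (rho + 1) x < c0 * (t1 / 4) / (2 * L).
    apply: pow_kernel_small; first by rewrite ltrDr.
    by apply: divr_gt0; [apply: mulr_gt0 => //; lra|lra].
  have cv : {for t1, continuous k} by apply: pow_kernel_continuous; rewrite gt_eqF.
  have /cvgrPdist_lt/(_ _ kt1)[d2 /= d20 hd2] := cv.
  pose dd := Num.min (Num.min d d1) (Num.min d2 (t1 / 4)).
  have dd0 : 0 < dd by rewrite /dd !lt_min d0 d10 d20 divr_gt0.
  have [dd1 dd2 dd3 dd4] : [/\ dd <= d, dd <= d1, dd <= d2 & dd <= t1 / 4].
    by rewrite /dd !ge_min !lexx ?orbT; split.
  exists (t1 - dd / 2); split; try lra.
    have : `|k t1 - k (t1 - dd / 2)| < k t1.
      by apply: hd2; rewrite /= opprB addrC subrK ger0_norm; lra.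
    by rewrite ltr_norml => /andP[h _]; lra.
  rewrite mulrC -ltr_pdivlMr ?mulr_gt0//; apply: hd1; lra.
pose q := k t / k t1.
have t0 : 0 < t by lra.
have q1 : 0 < q by rewrite divr_gt0// pow_kernel_gt0.
have q2 : q <= 2 by rewrite ler_pdivrMr.
have E1 : conv k e t1 = k t1 / lam.
  have := resolvent_eq t1; rewrite et1 => /esym/eqP; rewrite subr_eq0 => /eqP ->.
  by rewrite mulrC mulKf// gt_eqF.
have E2 : lam^-1 * e t = q * conv k e t1 - conv k e t.
  rewrite resolvent_eq mulrBr mulKf ?gt_eqF// E1 /q; congr (_ - _).
  by rewrite mulrA divfK ?gt_eqF// mulrC.
have I1 := tame_conv_int t1 tk te; have I2 := tame_conv_int t tk te.
have c2 : 0 <= 2 * t - t1 by lra.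
pose w x := k (t1 - x) * pow_kernel 1 (x - (2 * t - t1)).
have [Iw] := shifted_kernel t1 c2; rewrite (_ : t1 - (2 * t - t1) = 2 * (t1 - t)); last by ring.
rewrite -/w => Ew.
have Ii : mu.-integrable setT (EFin \o (\1_(`[t1 / 4, t1 / 2]) : R -> R)).
  exact: integrable_indic_itv.
have J1 : mu.-integrable setT (EFin \o (fun x => q * (k (t1 - x) * e x))).
  exact: (integrableZl measurableT q I1).
have J2 : mu.-integrable setT (EFin \o (fun x => (t1 - t) * (2 * L) * w x)).
  exact: (integrableZl measurableT _ Iw).
have J3 : mu.-integrable setT (EFin \o (fun x => (t1 - t) * c0 * \1_(`[t1 / 4, t1 / 2]) x)).
  exact: (integrableZl measurableT _ Ii).
have : lam^-1 * e t <= (t1 - t) * (2 * L * pow_kernel (rho + 1) (2 * (t1 - t)) - c0 * (t1 / 4)).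
  have -> : lam^-1 * e t = \int[mu]_x (q * (k (t1 - x) * e x) - k (t - x) * e x).
    by rewrite (RintegralB measurableT J1 I2) (RintegralZl _ measurableT I1) -!convE.
  have -> : (t1 - t) * (2 * L * pow_kernel (rho + 1) (2 * (t1 - t)) - c0 * (t1 / 4)) =
     \int[mu]_x ((t1 - t) * (2 * L) * w x - (t1 - t) * c0 * \1_(`[t1 / 4, t1 / 2]) x).
    rewrite (RintegralB measurableT J2 J3) (RintegralZl _ measurableT Iw) (RintegralZl _ measurableT Ii) Ew.
    by rewrite (Rintegral_indic_itv t142) t124; ring.
  apply: le_Rintegral => //.
  - exact: (integrableB measurableT J1 I2).
  - exact: (integrableB measurableT J2 J3).
  by move=> x _; exact: (integrand_bound te t0 tt1 t34 td L0 q2 epos hL hgap x).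
apply/negP; rewrite -ltNge.
apply: (@lt_trans _ _ 0); last by rewrite mulr_gt0 ?invr_gt0//; exact: epos.
by rewrite pmulr_rlt0 ?subr_gt0// subr_lt0.
Qed.

(** The infimum of the points where [e <= 0] is positive by [ml_kernel_near0]; by continuity it is a
    zero of [e], the first one. *)
Lemma ml_kernel_gt0_lt1 t : rho < 1 -> 0 < t -> 0 < e t.
Proof.
move=> rho1 t0; rewrite ltNge; apply/negP => et.
have [d d0 hd] := ml_kernel_near0.
pose S : set R := [set x | 0 < x /\ e x <= 0].
have St : S t by [].
have Sd : lbound S d.
  move=> x [x0 ex]; rewrite leNgt; apply/negP => xd.
  by have := hd x x0 (ltW xd); rewrite ltNge ex.
have lbS : has_lbound S by exists d.
have t1d : d <= inf S by apply: lb_le_inf => //; exists t.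
have t10 : 0 < inf S by exact: lt_le_trans t1d.
have epos x : 0 < x -> x < inf S -> 0 < e x.
  move=> x0 xS; rewrite ltNge; apply/negP => ex.
  by have := ge_inf lbS (conj x0 ex); rewrite leNgt xS.
have ce : {for inf S, continuous e} by apply: ml_kernel_continuous => //; rewrite gt_eqF.
apply: (first_zero_absurd rho1 t10 _ epos); apply/eqP; rewrite eq_le; apply/andP; split.
  rewrite leNgt; apply/negP => e0.
  have /cvgrPdist_lt/(_ _ e0)[d' /= d'0 hd'] := ce.
  have [x [x0 ex] xS] := inf_adherent d'0 (conj (ex_intro _ t St) lbS).
  have Sx : inf S <= x := ge_inf lbS (conj x0 ex).
  have := hd' x; rewrite /= distrC ger0_norm ?subr_ge0// ltrBlDl => /(_ xS).
  by move=> /ltr_normlW; rewrite gtrBl ltNge ex.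
rewrite leNgt; apply/negP => e0.
have Ne0 : 0 < - e (inf S) by rewrite oppr_gt0.
have /cvgrPdist_lt/(_ _ Ne0)[d' /= d'0 hd'] := ce.
pose x := inf S - Num.min (d' / 2) (inf S / 2).
have m0 : 0 < Num.min (d' / 2) (inf S / 2) by rewrite lt_min !divr_gt0.
have m1 : Num.min (d' / 2) (inf S / 2) <= d' / 2 by rewrite ge_min lexx.
have m2 : Num.min (d' / 2) (inf S / 2) <= inf S / 2 by rewrite ge_min lexx orbT.
have half_lt (y : R) : 0 < y -> y / 2 < y by move=> y0; rewrite ltr_pdivrMr// ltr_pMr// ltr1n.
have ex : 0 < e x.
  apply: epos; first by rewrite subr_gt0 (le_lt_trans m2)// half_lt.
  by rewrite gtrBl.
have := hd' x; rewrite /x /= opprB addrC subrK ger0_norm ?(ltW m0)//.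
move=> /(_ (le_lt_trans m1 (half_lt _ d'0))); rewrite -/x ltr_norml opprK ltrDl oppr_gt0.
by rewrite ltNge (ltW ex).
Qed.

(** The resolvent equation differentiates to [e' = - lam e], so that [e(x) exp(lam x)] is constant,
    with a positive value near 0. *)
Lemma ml_kernel_gt0_eq1 t : rho = 1 -> 0 < t -> 0 < e t.
Proof.
move=> rho1 t0; have [d d0 hd] := ml_kernel_near0.
have te : tame e := tame_ml_kernel rho_gt0 lam rho_gt0.
have de x : 0 < x -> is_derive x 1 e (- lam * e x).
  move=> x0; have ce : {for x, continuous e} by apply: ml_kernel_continuous => //; rewrite gt_eqF.
  have dc := conv_heaviside_derivable te ce.
  have dd : is_derive x 1 (fun x => 1 - lam * conv (pow_kernel 1) e x) (- lam * e x).
    have h := is_deriveB (is_derive_cst (1 : R) x 1) (@is_deriveZ _ _ _ _ lam _ _ _ dc).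
    by rewrite mulNr -[- (lam * e x)]sub0r.
  apply: near_eq_is_derive dd; near=> y.
  rewrite [RHS]resolvent_eq rho1 pow_kernel1 ifT//.
  by near: y; exact: lt_nbhsr.
pose h x := e x * expR (lam * x).
have dh x : 0 < x -> is_derive x 1 h 0.
  move=> x0; have dx := de x x0.
  have dE : is_derive x 1 (fun x => expR (lam * x)) (expR (lam * x) * lam).
    apply: is_derive_eq; rewrite /GRing.scale/=; ring.
  have := is_deriveM dx dE; rewrite /GRing.scale/=.
  by rewrite (_ : _ + _ = 0)//; ring.
pose a := Num.min d (t / 2).
have a0 : 0 < a by rewrite lt_min d0 divr_gt0.
have ad : a <= d by rewrite ge_min lexx.
have at2 : a <= t / 2 by rewrite ge_min lexx orbT.
have at' : a < t by lra.
have [||c _] := @MVT _ h (fun=> 0) a t at'.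
- by move=> x; rewrite in_itv/= => /andP[ax _]; apply: dh; exact: lt_trans ax.
- apply: continuous_in_subspaceT => x; rewrite inE/= in_itv/= => /andP[ax _].
  apply: differentiable_continuous; apply/derivable1_diffP.
  by have /@ex_derive := dh x (lt_le_trans a0 ax).
rewrite mul0r => /eqP; rewrite subr_eq0 => /eqP ht.
have : 0 < h t by rewrite ht /h mulr_gt0 ?expR_gt0// hd.
by rewrite /h pmulr_lgt0// expR_gt0.
Unshelve. all: by end_near. Qed.

Hypothesis rho_le1 : rho <= 1.

Lemma ml_kernel_gt0 t : 0 < t -> 0 < e t.
Proof.
move: rho_le1; rewrite le_eqVlt => /orP[/eqP h|h]; first exact: ml_kernel_gt0_eq1.
exact: ml_kernel_gt0_lt1.
Qed.

Lemma ml_kernel_ge0 t : 0 <= e t.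
Proof.
have [t0|t0] := leP t 0; first by rewrite ml_kernel_le0.
exact/ltW/ml_kernel_gt0.
Qed.

Let te : tame e := tame_ml_kernel rho_gt0 lam rho_gt0.
Let ts : tame s := tame_ml_kernel rho_gt0 lam ltr01.
Let tk : tame k := tame_pow_kernel rho_gt0.
Let th : tame (pow_kernel 1 : R -> R) := tame_pow_kernel ltr01.

Lemma ml_kernel_le t : e t <= k t.
Proof.
rewrite resolvent_eq gerBl mulr_ge0 ?(ltW lam_gt0)//.
by apply: conv_ge0 => x; [exact: pow_kernel_ge0|exact: ml_kernel_ge0].
Qed.

(** For [rho < 1], [s] is the convolution of [pow_kernel (1 - rho)] with [e], both non-negative; for
    [rho = 1] it is [e] itself. *)
Lemma ml_kernel1_ge0 t : 0 <= s t.
Proof.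
move: rho_le1; rewrite le_eqVlt => /orP[/eqP h|h].
  by have := ml_kernel_ge0 t; rewrite h.
rewrite (_ : 1 = (1 - rho) + rho); last by ring.
rewrite -conv_ml_kernel//; last by rewrite subr_gt0.
by apply: conv_ge0 => x; [apply: pow_kernel_ge0; rewrite subr_gt0|exact: ml_kernel_ge0].
Qed.

Lemma ml_kernel1_le1 t : s t <= 1.
Proof.
rewrite ml_kernel1E.
have h : 0 <= lam * conv (pow_kernel 1) e t.
  rewrite mulr_ge0 ?(ltW lam_gt0)//; apply: conv_ge0 => x; last exact: ml_kernel_ge0.
  exact: pow_kernel_ge0.
by rewrite pow_kernel1; case: ifP => _; lra.
Qed.

Lemma ml_kernel1_nonincreasing x t : 0 < x -> x <= t -> s t <= s x.
Proof.
move=> x0 xt; have t0 : 0 < t by exact: lt_le_trans xt.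
rewrite !ml_kernel1E !pow_kernel1 x0 t0 lerD2l lerN2; apply: ler_wpM2l; first exact: ltW.
rewrite !convE; apply: le_Rintegral => //; do ?exact: tame_conv_int.
move=> y _; apply: ler_wpM2r; first exact: ml_kernel_ge0.
rewrite !pow_kernel1; case: ifPn => h1; case: ifPn => // h2.
by move: h2; rewrite subr_gt0 -leNgt; lra.
Qed.

Lemma ml_kernel1_eq t : 0 < t -> s t + lam * conv k s t = 1.
Proof.
move=> t0; rewrite conv_ml_kernel// (ml_kernel_rec rho_gt0 lam t ltr01) pow_kernel1 t0.
by rewrite addrC [rho + 1]addrC subrKC.
Qed.

(** In [s + lam k * s = 1] the monotonicity of [s] allows replacing [s] under the convolution by its
    smallest value [s t]. *)
Lemma ml_kernel1_bound t : 0 < t -> s t * (1 + lam * pow_kernel (rho + 1) t) <= 1.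
Proof.
move=> t0; rewrite -[leRHS](ml_kernel1_eq t0) mulrDr mulr1 lerD2l mulrCA; apply: ler_wpM2l.
  exact: ltW.
rewrite -conv_pow_kernel// -convZr; last exact: tame_conv_int.
apply: le_conv; do ?apply: tame_conv_int => //; first exact: tameZ.
move=> x; have [xt|xt] := leP t x.
  by rewrite pow_kernel_le0 ?mul0r// subr_le0.
apply: ler_wpM2l; first exact: pow_kernel_ge0.
rewrite pow_kernel1; case: ifPn => [x0|_]; last by rewrite mulr0 ml_kernel1_ge0.
by rewrite mulr1; apply: ml_kernel1_nonincreasing => //; exact: ltW.
Qed.

Lemma conv_ml_kernel1_le t : conv k s t <= lam^-1.
Proof.
have [t0|t0] := leP t 0.
  by rewrite conv_ml_kernel// ml_kernel_le0// invr_ge0 ltW.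
rewrite -(ler_pM2l lam_gt0) (divff (lt0r_neq0 lam_gt0)) -[leRHS](ml_kernel1_eq t0).
by rewrite lerDr ml_kernel1_ge0.
Qed.

Lemma caputo_kernel t : rho < 1 -> conv (pow_kernel (1 - rho)) e t = s t.
Proof.
by move=> h; rewrite conv_ml_kernel ?subr_gt0// subrK.
Qed.

End RelaxationKernel.

(** * The forced relaxation equation *)

Section ForcedRelaxation.
Context {R : realType}.
Local Notation mu := (@lebesgue_measure R).
Variables (rho : R) (rho_gt0 : 0 < rho) (rho_le1 : rho <= 1).
Variables (g0 M : R) (dg : R -> R).
Hypothesis dg_continuous : continuous dg.
Hypothesis dg_bounded : forall x, `|dg x| <= M.
Implicit Types (lam a b c x t T : R).

Local Notation e := (fun lam => ml_kernel rho lam rho).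
Local Notation s := (fun lam => ml_kernel rho lam 1).
Local Notation k := (pow_kernel rho).
Local Notation h := (@pow_kernel R 1).

Definition causal (f : R -> R) x : R := if 0 < x then f x else 0.

Lemma causal_gt0 f x : 0 < x -> causal f x = f x.
Proof. by rewrite /causal => ->. Qed.

Lemma causal_le0 f x : x <= 0 -> causal f x = 0.
Proof. by rewrite leNgt /causal => /negbTE ->. Qed.

Lemma measurable_causal f : measurable_fun setT f -> measurable_fun setT (causal f).
Proof.
move=> mf; have -> : causal f = f \_ `]0, +oo[.
  by apply/funext => x; rewrite patchE mem_setE in_itv/= andbT.
by apply/(measurable_restrictT _ _).1 => //; exact: measurable_funTS.
Qed.

Lemma causal_continuous f x : x != 0 -> {for x, continuous f} -> {for x, continuous (causal f)}.
Proof.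
rewrite neq_lt => /orP[x0|x0] cf.
  apply: (@eq_conv_continuous _ (cst 0)); first exact: cst_continuous.
  near=> y; rewrite causal_le0//; apply: ltW.
  by near: y; exact: lt_nbhsl.
apply: eq_conv_continuous cf _; near=> y; rewrite causal_gt0//.
by near: y; exact: lt_nbhsr.
Unshelve. all: by end_near. Qed.

Lemma M_ge0 : 0 <= M. Proof. exact: le_trans (normr_ge0 _) (dg_bounded 0). Qed.

Lemma causal_dg_le x : `|causal dg x| <= M * h x.
Proof.
rewrite /causal pow_kernel1; case: ifP => _; last by rewrite normr0 mulr0.
by rewrite mulr1.
Qed.

Lemma tame_causal_dg : tame (causal dg).
Proof.
apply: tame_bounded.
- by apply: measurable_causal; exact: continuous_measurable_fun.
- by move=> x; exact: causal_le0.
- move=> T; exists M => x _; apply: (le_trans (causal_dg_le x)).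
  by rewrite pow_kernel1; case: ifP; rewrite ?mulr1 ?mulr0 ?M_ge0.
Qed.

Let th : tame h := tame_pow_kernel ltr01.
Let tk : tame k := tame_pow_kernel rho_gt0.
Let td : tame (causal dg) := tame_causal_dg.
Let te lam : tame (e lam) := tame_ml_kernel rho_gt0 lam rho_gt0.
Let ts lam : tame (s lam) := tame_ml_kernel rho_gt0 lam ltr01.
Hint Resolve th tk td te ts : core.

Lemma conv_heaviside_continuous f t : tame f -> {for t, continuous (conv h f)}.
Proof.
move=> tf; rewrite tame_convC//; apply: conv_continuous => //.
  move=> T; exists 1 => x _; rewrite pow_kernel1; case: ifP => _; rewrite ?normr1 ?normr0//.
by move=> x x0; exact: pow_kernel_continuous.
Qed.

(* [forcing] is [g] on the positive half-line when [g0] is [g 0] and [dg] is the derivative of [g]. *)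
Definition forcing t : R := g0 * h t + conv h (causal dg) t.

Lemma tame_forcing : tame forcing.
Proof. by apply: tameD; [exact: tameZ|exact: tame_conv]. Qed.
Let tG : tame forcing := tame_forcing.
Hint Resolve tG : core.

Lemma conv_forcing f t : tame f ->
  conv f forcing t = g0 * conv f h t + conv (conv f h) (causal dg) t.
Proof.
move=> tf; rewrite /forcing convDr; last 2 first.
- by apply: tame_conv_int => //; exact: tameZ.
- by apply: tame_conv_int => //; exact: tame_conv.
by rewrite convZr ?tame_convA//; exact: tame_conv_int.
Qed.

Definition response lam t : R := conv (e lam) forcing t.

(** The derivative of [response]: differentiating the forcing yields [dg] and, from its jump at 0,
    the term [g0 e]. *)
Definition dresponse lam t : R := g0 * e lam t + conv (e lam) (causal dg) t.

Lemma tame_dresponse lam : tame (dresponse lam).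
Proof. by apply: tameD; [exact: tameZ|exact: tame_conv]. Qed.

Lemma responseE lam t : response lam t = conv h (dresponse lam) t.
Proof.
rewrite /response conv_forcing// /dresponse convDr; last 2 first.
- by apply: tame_conv_int => //; exact: tameZ.
- by apply: tame_conv_int => //; exact: tame_conv.
rewrite convZr; last exact: tame_conv_int.
by rewrite tame_convA// (tame_convC (te lam) th).
Qed.

(** An integration by parts in disguise: [lam] times the integral of [e] is [1 - s]. All the decay
    in [lam] of the coefficients [b_k] comes from this identity. *)
Lemma lam_response lam t :
  lam * response lam t = forcing t - g0 * s lam t - conv (s lam) (causal dg) t.
Proof.
rewrite /response conv_forcing// mulrDr -[X in _ + X = _]convZl; last by apply: tame_conv_int => //; exact: tame_conv.
have E : (fun x => lam * conv (e lam) h x) = fun x => h x + (-1) * s lam x.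
  by apply/funext => x; rewrite ml_kernel1E// (tame_convC (te lam) th); ring.
rewrite E convDl; [|exact: tame_conv_int|by apply: tame_conv_int => //; exact: tameZ].
rewrite convZl; last exact: tame_conv_int.
by have /= := congr1 (fun f => f t) E => Et; rewrite mulrCA Et /forcing; ring.
Qed.

(* The factor of [c] is [E_rho (- lam t^rho)] for [0 <= t], including [t = 0], where [s] is [0]. *)
Definition relax_sol lam c t : R := response lam t + c * (1 - lam * conv h (e lam) t).

Definition drelax_sol lam c t : R := dresponse lam t - c * lam * e lam t.

Lemma tame_drelax_sol lam c : tame (drelax_sol lam c).
Proof.
rewrite (_ : drelax_sol lam c = fun t => dresponse lam t + (- (c * lam)) * e lam t).
  by apply: tameD; [exact: tame_dresponse|exact: tameZ].
by apply/funext => t; rewrite /drelax_sol mulNr.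
Qed.

Lemma relax_solE lam c t : relax_sol lam c t = c + conv h (drelax_sol lam c) t.
Proof.
rewrite (_ : drelax_sol lam c = fun t => dresponse lam t + (- (c * lam)) * e lam t); last first.
  by apply/funext => x; rewrite /drelax_sol mulNr.
rewrite convDr; last 2 first.
- by apply: tame_conv_int => //; exact: tame_dresponse.
- by apply: tame_conv_int => //; exact: tameZ.
rewrite convZr; last exact: tame_conv_int.
by rewrite /relax_sol responseE; ring.
Qed.

Lemma relax_sol_continuous lam c t : {for t, continuous (relax_sol lam c)}.
Proof.
rewrite (_ : relax_sol lam c = fun t => c + conv h (drelax_sol lam c) t); last first.
  by apply/funext => x; exact: relax_solE.
by apply: cvgD; [exact: cvg_cst|apply: conv_heaviside_continuous; exact: tame_drelax_sol].
Qed.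

Lemma drelax_sol_continuous lam c t : 0 < t -> {for t, continuous (drelax_sol lam c)}.
Proof.
move=> t0; have ce : {for t, continuous (e lam)}.
  by apply: ml_kernel_continuous => //; rewrite gt_eqF.
apply: cvgB; last by apply: cvgM; [exact: cvg_cst|exact: ce].
apply: cvgD; first by apply: cvgM; [exact: cvg_cst|exact: ce].
apply: conv_continuous => //.
  move=> T; exists M => x _; apply: (le_trans (causal_dg_le x)).
  by rewrite pow_kernel1; case: ifP; rewrite ?mulr1 ?mulr0 ?M_ge0.
by move=> x x0; apply: causal_continuous => //; exact: dg_continuous.
Qed.

Lemma relax_sol_is_derive lam c t : 0 < t -> is_derive t 1 (relax_sol lam c) (drelax_sol lam c t).
Proof.
move=> t0; rewrite (_ : relax_sol lam c = fun t => c + conv h (drelax_sol lam c) t); last first.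
  by apply/funext => x; exact: relax_solE.
have ct : {for t, continuous (drelax_sol lam c)} by exact: drelax_sol_continuous.
have d := conv_heaviside_derivable (tame_drelax_sol lam c) ct.
have := is_deriveD (is_derive_cst c t 1) d; rewrite add0r; exact.
Qed.

Lemma relax_sol_gt0 lam c t : 0 < t -> relax_sol lam c t = response lam t + c * s lam t.
Proof. by move=> t0; rewrite /relax_sol ml_kernel1E// pow_kernel1 t0. Qed.

Lemma drelax_solE lam c t : 0 < t -> rho = 1 ->
  drelax_sol lam c t = forcing t - lam * relax_sol lam c t.
Proof.
move=> t0 rho1; rewrite relax_sol_gt0// mulrDr lam_response /drelax_sol /dresponse.
have -> : ml_kernel rho lam rho = ml_kernel rho lam 1 by rewrite rho1.
by ring.
Qed.

(** Convolution with [pow_kernel (1 - rho)] turns [e] into [s], after which [lam_response]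
    recognizes the right-hand side. *)
Lemma caputo_relax_sol lam c t : 0 < lam -> 0 < t -> rho < 1 ->
  conv (pow_kernel (1 - rho)) (drelax_sol lam c) t = forcing t - lam * relax_sol lam c t.
Proof.
move=> lam0 t0 rho1; have r0 : 0 < 1 - rho by rewrite subr_gt0.
have tK : tame (pow_kernel (1 - rho)) := tame_pow_kernel r0.
have -> : drelax_sol lam c = fun t => (g0 - c * lam) * e lam t + conv (e lam) (causal dg) t.
  by apply/funext => x; rewrite /drelax_sol /dresponse; ring.
rewrite convDr; last 2 first.
- by apply: tame_conv_int => //; exact: tameZ.
- by apply: tame_conv_int => //; exact: tame_conv.
rewrite convZr; last exact: tame_conv_int.
rewrite tame_convA//.
have -> : conv (pow_kernel (1 - rho)) (e lam) = s lam.
  by apply/funext => x; exact: caputo_kernel.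
by rewrite relax_sol_gt0// mulrDr lam_response; ring.
Qed.

Lemma heaviside_conv_heaviside t : 0 <= t -> conv h h t = t.
Proof.
move=> t0; rewrite conv_heaviside//.
rewrite -[RHS](_ : \int[mu]_(x in `]0, t]) 1 = t); last first.
  transitivity (fine (lebesgue_measure (`]0, t]%classic : set R))); first by rewrite Rintegral_cst// mul1r.
  rewrite lebesgue_measure_itv/= lte_fin.
  by case: ltP t0 => [_ _|t0 t0']; [rewrite -EFinB /= subr0|apply/eqP; rewrite eq_le t0 t0'].
rewrite Rintegral_mkcond [RHS]Rintegral_mkcond; apply: eq_Rintegral => x _.
rewrite !patchE !mem_setE !in_itv/= pow_kernel1.
by case: (x <= t); rewrite ?andbT ?andbF//; case: ifP.
Qed.

Lemma conv_causal_dg_le (f : R -> R) t : tame f -> (forall x, 0 <= f x) ->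
  `|conv f (causal dg) t| <= M * conv f h t.
Proof.
move=> tf f0; apply: (le_trans (norm_conv_le (tame_conv_int t tf td))).
rewrite -convZr; last exact: tame_conv_int.
apply: le_conv.
- by apply: tame_conv_int; exact: tame_norm.
- by apply: tame_conv_int => //; exact: tameZ.
by move=> x /=; rewrite ger0_norm//; apply: ler_wpM2l => //; exact: causal_dg_le.
Qed.

Let h_ge0 x : 0 <= h x. Proof. exact: pow_kernel_ge0. Qed.
Let h_le1 x : h x <= 1. Proof. by rewrite pow_kernel1; case: ifP. Qed.
Let k_ge0 x : 0 <= k x. Proof. exact: pow_kernel_ge0. Qed.

Lemma forcing_bound t T : 0 <= T -> t <= T -> `|forcing t| <= `|g0| + M * T.
Proof.
move=> T0 tT; rewrite /forcing (le_trans (ler_normD _ _))//; apply: lerD.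
  by rewrite normrM ler_piMr// ger0_norm.
apply: (le_trans (conv_causal_dg_le t th h_ge0)); apply: ler_wpM2l; first exact: M_ge0.
have [t0|t0] := leP t 0; last by rewrite heaviside_conv_heaviside// ltW.
by rewrite conv_pow_kernel// pow_kernel_le0.
Qed.

Section Bounds.
Variables (lam : R) (lam_gt0 : 0 < lam).

Let e_ge0 x : 0 <= e lam x. Proof. exact: ml_kernel_ge0. Qed.
Let s_ge0 x : 0 <= s lam x. Proof. exact: ml_kernel1_ge0. Qed.
Let s_le1 x : s lam x <= 1. Proof. exact: ml_kernel1_le1. Qed.

Lemma conv_ml_kernel1_heaviside_le t T : 0 <= T -> t <= T -> conv (s lam) h t <= T.
Proof.
move=> T0 tT; have [t0|t0] := leP t 0.
  by rewrite tame_convC// conv_ml_kernel// ml_kernel_le0.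
rewrite (le_trans _ tT)// -[leRHS](heaviside_conv_heaviside (ltW t0)).
apply: le_conv; do ?exact: tame_conv_int.
move=> x; apply: ler_wpM2r => //; have [tx|tx] := leP t x.
  by rewrite !(ml_kernel_le0, pow_kernel_le0) ?subr_le0.
by rewrite pow_kernel1 subr_gt0 tx.
Qed.

Lemma lam_response_bound t T : 0 <= T -> t <= T ->
  `|lam * response lam t| <= 2 * (`|g0| + M * T).
Proof.
move=> T0 tT; rewrite lam_response.
have b1 := forcing_bound T0 tT.
have b2 : `|g0 * s lam t| <= `|g0| by rewrite normrM ler_piMr// ger0_norm.
have b3 : `|conv (s lam) (causal dg) t| <= M * T.
  apply: (le_trans (conv_causal_dg_le t (ts lam) s_ge0)); apply: ler_wpM2l; first exact: M_ge0.
  exact: conv_ml_kernel1_heaviside_le.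
have := ler_normB (forcing t - g0 * s lam t) (conv (s lam) (causal dg) t).
have := ler_normB (forcing t) (g0 * s lam t).
lra.
Qed.

(** The majorant depends on [lam] only through [c * lam], which stays bounded along the modes. *)
Lemma drelax_sol_bound c x T : 0 <= T -> x <= T ->
  `|drelax_sol lam c x| <= (`|g0| + `|c * lam|) * k x + M * pow_kernel (rho + 1) x.
Proof.
move=> T0 xT; rewrite /drelax_sol /dresponse.
have ek : `|e lam x| <= k x by rewrite ger0_norm//; exact: ml_kernel_le.
have b1 : `|g0 * e lam x| <= `|g0| * k x by rewrite normrM; exact: ler_wpM2l.
have b2 : `|c * lam * e lam x| <= `|c * lam| * k x by rewrite normrM; exact: ler_wpM2l.
have b3 : `|conv (e lam) (causal dg) x| <= M * pow_kernel (rho + 1) x.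
  apply: (le_trans (conv_causal_dg_le x (te lam) e_ge0)); apply: ler_wpM2l; first exact: M_ge0.
  rewrite -conv_pow_kernel//; apply: le_conv; do ?exact: tame_conv_int.
  by move=> y; apply: ler_wpM2r => //; exact: ml_kernel_le.
have := ler_normB (g0 * e lam x + conv (e lam) (causal dg) x) (c * lam * e lam x).
have := ler_normD (g0 * e lam x) (conv (e lam) (causal dg) x).
lra.
Qed.

Lemma ml_kernel1_le_inv t : 0 < t -> s lam t <= (pow_kernel (rho + 1) t)^-1 / lam.
Proof.
move=> t0; have p0 : 0 < pow_kernel (rho + 1) t by apply: pow_kernel_gt0 => //; exact: addr_gt0.
rewrite -invfM mulrC -[leRHS]mul1r ler_pdivlMr ?mulr_gt0//.
apply: le_trans (ml_kernel1_bound rho_gt0 lam_gt0 rho_le1 t0).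
by apply: ler_wpM2l => //; rewrite lerDr.
Qed.

(** Comparing the Heaviside function with [k] gives access to [conv_ml_kernel1_le], and with it to
    the factor [1 / lam] that the bound [s <= 1] misses. *)
Lemma conv_ml_kernel1_heaviside_inv C t : (forall x, x <= t -> h x <= C * k x) -> 0 <= C ->
  conv (s lam) h t <= C / lam.
Proof.
move=> hC C0; rewrite tame_convC//.
apply: (@le_trans _ _ (C * conv k (s lam) t)); last first.
  by apply: ler_wpM2l => //; exact: conv_ml_kernel1_le.
rewrite -convZl; last exact: tame_conv_int.
apply: le_conv; [exact: tame_conv_int|by apply: tame_conv_int => //; exact: tameZ|move=> x].
have [x0|x0] := leP x 0; first by rewrite ml_kernel_le0// !mulr0.
by apply: ler_wpM2r => //; apply: hC; lra.
Qed.

End Bounds.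

(** Uniform in [lam], because the periodicity condition divides by [1 - s T] in every mode. *)
Lemma ml_kernel1_gap lam0 T : 0 < lam0 -> 0 < T ->
  exists2 d : R, 0 < d & forall lam, lam0 <= lam -> d <= 1 - s lam T.
Proof.
move=> l0 T0; have p0 : 0 < pow_kernel (rho + 1) T by apply: pow_kernel_gt0 => //; exact: addr_gt0.
set p := pow_kernel (rho + 1) T in p0 *.
have q0 : 0 < lam0 * p by rewrite mulr_gt0.
exists (1 - (1 + lam0 * p)^-1); first by rewrite subr_gt0 invf_lt1; lra.
move=> lam llam; rewrite lerD2l lerN2.
have lam0' : 0 < lam by exact: lt_le_trans llam.
have := ml_kernel1_bound rho_gt0 lam0' rho_le1 T0; rewrite -/p.
rewrite -ler_pdivlMr; last by rewrite addr_gt0 ?mulr_gt0.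
rewrite mul1r => /le_trans; apply.
rewrite lef_pV2 ?posrE ?addr_gt0 ?mulr_gt0// lerD2l; apply: ler_wpM2r => //; exact: ltW.
Qed.

Definition response_det lam t0 T : R :=
  (1 - s lam T) * response lam t0 + s lam t0 * response lam T.

(** The terms with a factor [s T] or [s t0] are of order [1 / lam], as [lam] times the response is
    bounded; the rest is [lam_response] at [t0]. *)
Lemma response_det_asymp t0 T : 0 < t0 -> t0 < T ->
  exists K : R, forall lam, 0 < lam -> `|lam * response_det lam t0 T - forcing t0| <= K / lam.
Proof.
move=> t00 t0T; have T0 : 0 < T by exact: lt_trans t0T.
have [C C0 hC] := pow_kernel_le t0 rho_gt0 rho_le1.
set B := 2 * (`|g0| + M * T).
have B0 : 0 <= B by rewrite mulr_ge0// addr_ge0// mulr_ge0 ?M_ge0// ltW.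
set p := (pow_kernel (rho + 1) t0)^-1; set p' := (pow_kernel (rho + 1) T)^-1.
exists (`|g0| * p + M * C + p' * B + p * B) => lam lam0.
have hs : s lam t0 <= p / lam by exact: ml_kernel1_le_inv.
have hs' : s lam T <= p' / lam by exact: ml_kernel1_le_inv.
have s0 : 0 <= s lam t0 by exact: ml_kernel1_ge0.
have s0' : 0 <= s lam T by exact: ml_kernel1_ge0.
have b0 := @lam_response_bound lam lam0 t0 T (ltW T0) (ltW t0T); rewrite -/B in b0.
have b1 := @lam_response_bound lam lam0 T T (ltW T0) (lexx _); rewrite -/B in b1.
have b2 : `|conv (s lam) (causal dg) t0| <= M * (C / lam).
  apply: (le_trans (conv_causal_dg_le t0 (ts lam) _)); first by move=> x; exact: ml_kernel1_ge0.
  by apply: ler_wpM2l; [exact: M_ge0|exact: conv_ml_kernel1_heaviside_inv].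
have -> : lam * response_det lam t0 T - forcing t0 =
    (lam * response lam t0 - forcing t0) - s lam T * (lam * response lam t0)
    + s lam t0 * (lam * response lam T) by rewrite /response_det; ring.
have e1 : `|lam * response lam t0 - forcing t0| <= `|g0| * (p / lam) + M * (C / lam).
  have -> : lam * response lam t0 - forcing t0 = - (g0 * s lam t0) - conv (s lam) (causal dg) t0.
    by rewrite lam_response; ring.
  apply: (le_trans (ler_normB _ _)); apply: lerD => //.
  by rewrite normrN normrM; apply: ler_wpM2l => //; rewrite ger0_norm.
have e2 : `|s lam T * (lam * response lam t0)| <= p' / lam * B.
  by rewrite normrM ger0_norm//; apply: ler_pM.
have e3 : `|s lam t0 * (lam * response lam T)| <= p / lam * B.
  by rewrite normrM ger0_norm//; apply: ler_pM.
apply: (le_trans (ler_normD _ _)).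
apply: (@le_trans _ _ (`|g0| * (p / lam) + M * (C / lam) + p' / lam * B + p / lam * B)).
  apply: lerD => //; apply: (le_trans (ler_normB _ _)); exact: lerD.
rewrite le_eqVlt; apply/orP; left; apply/eqP; field; exact: lt0r_neq0.
Qed.

(* Applying the resolvent [e] to [y + lam k * y = F] turns it into [y = F - lam e * F]. *)
Lemma volterra_solution lam (y : R -> R) y0 (phi : R) T :
  tame y ->
  (forall t, 0 < t -> t <= T -> y t + lam * conv k y t = y0 * h t + phi * conv k forcing t) ->
  forall t, 0 < t -> t <= T -> y t = y0 * s lam t + phi * response lam t.
Proof.
move=> ty yE t t0 tT.
pose F x := y0 * h x + phi * conv k forcing x.
pose Y x := y x + lam * conv k y x.
have tkG : tame (conv k forcing) by exact: tame_conv.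
have tky : tame (conv k y) by exact: tame_conv.
have tF : tame F by apply: tameD; exact: tameZ.
have tY : tame Y by apply: tameD => //; exact: tameZ.
have H1 : conv (e lam) Y t = conv (e lam) F t.
  apply: eq_conv => //; do ?[by move=> x; exact: tame_le0].
  by move=> x x0 xt; apply: yE => //; lra.
have E : conv (fun x => lam * e lam x) k = fun x => k x + (-1) * e lam x.
  apply/funext => x; rewrite convZl; last exact: tame_conv_int.
  by rewrite (tame_convC (te lam) tk) resolvent_eq//; ring.
(* By [E], [e] plus [lam] times its convolution with [k] is [k], so only the convolution of [k] and
   [y] remains. *)
have H2 : conv (e lam) Y t = conv k y t.
  rewrite /Y convDr; last 2 first.
  - exact: tame_conv_int.
  - by apply: tame_conv_int => //; exact: tameZ.
  have -> : conv (e lam) (fun x => lam * conv k y x) t = conv (fun x => lam * e lam x) (conv k y) t.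
    by rewrite convZr ?convZl//; exact: tame_conv_int.
  rewrite tame_convA//; last exact: tameZ.
  rewrite E convDl; last 2 first.
  - exact: tame_conv_int.
  - by apply: tame_conv_int => //; exact: tameZ.
  rewrite convZl; last exact: tame_conv_int.
  by ring.
have H3 : conv (e lam) F t = y0 * conv (e lam) h t + phi * conv (conv (e lam) k) forcing t.
  rewrite /F convDr; last 2 first.
  - by apply: tame_conv_int => //; exact: tameZ.
  - by apply: tame_conv_int => //; exact: tameZ.
  by rewrite !convZr ?tame_convA//; exact: tame_conv_int.
have -> : y t = F t - lam * conv (e lam) F t.
  by rewrite -H1 H2 -[F t](yE t t0 tT) addrK.
rewrite H3 /F.
have E2 : lam * conv (conv (e lam) k) forcing t = conv k forcing t - response lam t.
  rewrite -convZl; last by apply: tame_conv_int => //; exact: tame_conv.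
  have -> : (fun x => lam * conv (e lam) k x) = fun x => k x + (-1) * e lam x.
    by rewrite -E; apply/funext => x; rewrite convZl//; exact: tame_conv_int.
  rewrite convDl; last 2 first.
  - exact: tame_conv_int.
  - by apply: tame_conv_int => //; exact: tameZ.
  by rewrite convZl; [rewrite /response; ring|exact: tame_conv_int].
have -> : s lam t = h t - lam * conv (e lam) h t.
  by rewrite (tame_convC (te lam) th) ml_kernel1E.
by rewrite mulrDr [lam * (phi * _)]mulrCA E2; ring.
Qed.

End ForcedRelaxation.

(** * The integral of a derivative *)

Section FundamentalTheorem.
Context {R : realType}.
Local Notation mu := (@lebesgue_measure R).
Implicit Types (a b x t eta eps : R).

(* The measure has density [\sum_j j eta 1_(U j)], where the open set [U j] covers the level set
   of points at which [p / eta] has integral part [j]. *)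
Lemma open_cover_measure a b (p : R -> R) eta eps : 0 < eta -> 0 < eps ->
    measurable_fun setT p -> (forall x, 0 <= p x) ->
  exists m : {measure set (measurableTypeR R) -> \bar R},
    (m setT <= \int[mu]_(x in `[a, b]) (p x)%:E + eps%:E)%E /\
    forall x, x \in `[a, b] -> exists2 d : R, 0 < d &
      forall t, x < t < x + d -> (((p x - eta) * (t - x))%:E <= m `]x, t]%classic)%E.
Proof.
move=> eta0 eps0 mp p0.
pose E (j : nat) := `[a, b]%classic `&` p @^-1` `[j%:R * eta, j.+1%:R * eta[.
have mE j : measurable (E j).
  apply: measurableI => //; rewrite -[X in measurable X]setTI; apply: mp => //.
have Efin j : (mu (E j) < +oo)%E.
  apply: (@le_lt_trans _ _ (mu `[a, b]%classic)).
    by apply: le_measure; [rewrite inE; exact: mE|rewrite inE; exact: measurable_itv|exact: subIsetl].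
  apply: (@le_lt_trans _ _ (lebesgue_measure (`[a, b]%classic : set R))) => //.
  by rewrite lebesgue_measure_itv/=; case: ifP => _; rewrite -?EFinB ltry.
have tE : trivIset setT E.
  apply/trivIsetP => i j _ _ ij; apply/seteqP; split => // x [[_ /=]]; rewrite in_itv/= => hi.
  case=> _ /=; rewrite in_itv/= => hj.
  suff hle (m n : nat) : m%:R * eta <= p x -> p x < n.+1%:R * eta -> (m <= n)%N.
    case/andP: hi => h1 h2; case/andP: hj => h3 h4.
    by move/negP: ij; apply; rewrite eqn_leq !hle.
  by move=> h1 h2; rewrite -ltnS -(ltr_nat R) -(ltr_pM2r eta0) (le_lt_trans h1).
(* The excess of [U j] over [E j] is weighted by [j eta]; this choice makes the total excess at most
   [eps], and the 1 keeps the divisor positive at [j = 0]. *)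
pose dl j : R := eps / (2 ^ j.+1)%:R / (j%:R * eta + 1).
have q0 j : 0 < j%:R * eta + 1 by rewrite ltr_wpDl// mulr_ge0// ltW.
have dl0 j : 0 < dl j by rewrite divr_gt0// divr_gt0// ltr0n expn_gt0.
have /choice[U hU] : forall j, exists U : set R,
    [/\ open U, E j `<=` U & (mu (U `\` E j) < (dl j)%:E)%E].
  by move=> j; exact: (lebesgue_regularity_outer (mE j) (Efin j) (dl0 j)).
have mU j : measurable (U j) by apply: open_measurable; case: (hU j).
have je0 j : 0 <= j%:R * eta by rewrite mulr_ge0// ltW.
pose nu j : {measure set (measurableTypeR R) -> \bar R} := mscale (NngNum (je0 j)) (mrestr mu (mU j)).
have nuE j A : nu j A = ((j%:R * eta)%:E * mu (A `&` U j))%E by [].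
exists (mseries nu 0); split.
  rewrite /mseries.
  pose Aj (j : nat) := (\int[mu]_(x in E j) (p x)%:E)%E.
  have Aj0 j : (0 <= Aj j)%E by apply: integral_ge0 => x _; rewrite lee_fin.
  apply: (@le_trans _ _ (\sum_(0 <= i <oo) (Aj i + (eps / (2 ^ i.+1)%:R)%:E))%E).
    apply: lee_nneseries => [i _ _|i _]; first exact: measure_ge0.
    rewrite nuE setTI.
    have -> : U i = E i `|` (U i `\` E i) by rewrite setDUK//; case: (hU i).
    have -> : mu (E i `|` (U i `\` E i)) = (mu (E i) + mu (U i `\` E i))%E.
      have mD : measurable (U i `\` E i) by apply: measurableD; [exact: mU|exact: mE].
      by apply: measureU; [exact: mE|exact: mD|rewrite setDIK].
    rewrite muleDr// ?ge0_adde_def ?inE//; apply: leeD.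
      have <- : (\int[mu]_(x in E i) (i%:R * eta)%:E = (i%:R * eta)%:E * mu (E i))%E.
        by apply: integral_cst; exact: mE.
      apply: ge0_le_integral.
      - exact: mE.
      - by move=> x _; rewrite lee_fin.
      - exact: measurable_cst.
      - by apply/measurable_EFinP; exact: measurable_funTS.
      - by move=> x [_ /=]; rewrite in_itv/= lee_fin => /andP[].
    case: (hU i) => _ _ h.
    apply: (@le_trans _ _ ((i%:R * eta)%:E * (dl i)%:E)%E).
      by apply: lee_pmul => //; rewrite ?lee_fin// ltW.
    rewrite -EFinM lee_fin /dl mulrA ler_pdivrMr// mulrC ler_wpM2l//; last by rewrite lerDl.
    by rewrite divr_ge0// ltW.
  apply: (le_trans (epsilon_trick _ Aj0 (ltW eps0))); apply: leeD => //.
  rewrite /Aj -ge0_integral_bigcup//.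
  - apply: ge0_subset_integral => //.
    + by apply: bigcup_measurable => j _; exact: mE.
    + by apply/measurable_EFinP; exact: measurable_funTS.
    + by move=> x _; rewrite lee_fin.
    + by move=> x [j _ []].
  - by apply/measurable_EFinP; exact: measurable_funTS.
  - by move=> x _; rewrite lee_fin.
move=> x xab.
(* Since [U j] is open, the density near [x] is at least [j eta], which is within [eta] of [p x]. *)
pose j := Num.truncn (p x / eta).
have px : j%:R * eta <= p x < j.+1%:R * eta.
  by rewrite -ler_pdivlMr// -ltr_pdivrMr// truncn_itv// divr_ge0// ltW.
have xE : E j x by split => //=; rewrite in_itv.
case: (hU j) => oU EU _.
have /nbhs_ballP[d /= d0 hd] : nbhs x (U j) by apply: open_nbhs_nbhs; split => //; exact: EU.
exists d => // t /andP[xt td].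
apply: (@le_trans _ _ (nu j `]x, t]%classic)).
  rewrite nuE (_ : _ `&` _ = `]x, t]%classic); last first.
    apply/seteqP; split => [y []//|y yx]; split => //; apply: hd.
    move: yx => /=; rewrite in_itv/= => /andP[h1 h2].
    by rewrite /ball/= ltr_distlC; apply/andP; split; lra.
  rewrite lebesgue_measure_itv/= lte_fin xt -EFinB -EFinM lee_fin ler_wpM2r ?subr_ge0 1?ltW//.
  by case/andP: px => _; rewrite -natr1 mulrDl mul1r => h; lra.
rewrite /mseries.
have h : (\sum_(0 <= i < j.+1) nu i `]x, t]%classic <= \sum_(0 <= i <oo) nu i `]x, t]%classic)%E.
  by apply: nneseries_lim_ge => n _ _; exact: measure_ge0.
by apply: le_trans h; rewrite big_nat_recr//= leeDr// sume_ge0.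
Qed.

(** Let [c] be the supremum of the points with [F a <= F x]. The condition on the left shows that
    [c] is such a point, the one on the right that it cannot lie below [b]. *)
Lemma right_increasing a b (F : R -> R) : a <= b ->
    (forall x, a <= x < b -> exists2 d, 0 < d & forall t, x < t < x + d -> t <= b -> F x <= F t) ->
    (forall x eps, a < x <= b -> 0 < eps ->
      exists2 d, 0 < d & forall t, x - d < t < x -> a <= t -> F t <= F x + eps) ->
  F a <= F b.
Proof.
move=> ab hr hl.
pose S := [set x | a <= x <= b /\ F a <= F x].
have Sa : S a by rewrite /S/= lexx ab.
have ubS : has_ubound S by exists b => x [] /andP[].
have supS : has_sup S by split => //; exists a.
set c := sup S.
have ac : a <= c by exact: ub_le_sup.
have cb : c <= b by apply: ge_sup; [exists a|move=> x [] /andP[]].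
have Fc : F a <= F c.
  have [-> //|ca] := eqVneq c a.
  have {}ca : a < c by rewrite lt_neqAle eq_sym ca.
  apply/ler_addgt0Pr => eps eps0.
  case: (hl c eps _ eps0); first by rewrite ca.
  move=> d d0 hd.
  have [x [] /andP[ax xb] Fx xc] := sup_adherent d0 supS.
  have [->|xnc] := eqVneq c x; first by rewrite (le_trans Fx)// lerDl ltW.
  apply: (le_trans Fx); apply: hd => //; rewrite xc/= lt_neqAle eq_sym xnc.
  by rewrite andTb; apply: ub_le_sup => //; split; rewrite ?ax.
move: cb; rewrite le_eqVlt => /predU1P[<-//|cb].
have [|d d0 hd] := hr c; first by rewrite ac.
pose t := Num.min b (c + d / 2).
have ct : c < t by rewrite lt_min cb/= ltrDl divr_gt0.
have tb : t <= b by rewrite ge_min lexx.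
have td : t < c + d by rewrite gt_min; apply/orP; right; lra.
have St : S t.
  split; first by rewrite tb andbT (le_trans ac)// ltW.
  by apply: (le_trans Fc); apply: hd; rewrite ?ct.
by have := ub_le_sup ubS St; rewrite leNgt ct.
Qed.

Lemma within_continuous_dist (K : numFieldType) (V : normedModType K) (S : set R) (f : R -> V) x
    (e : K) : {within S, continuous f} -> S x -> 0 < e ->
  exists2 d : R, 0 < d & forall t, S t -> `|x - t| < d -> `|f x - f t| < e.
Proof.
move=> /subspace_continuousP cf Sx e0.
have /cvgrPdist_lt/(_ _ e0) := cf x Sx.
by move=> [d /= d0 hd]; exists d => // t St xt; exact: hd.
Qed.

Lemma is_derive_slope_le (y : R -> R) x (l eta : R) : is_derive x 1 y l -> 0 < eta ->
  exists2 d : R, 0 < d & forall t, x < t < x + d -> y t - y x <= (l + eta) * (t - x).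
Proof.
move=> [dy <-] eta0.
have /cvgrPdist_lt/(_ _ eta0)[d /= d0 hd] : h^-1 *: (y (h *: (1 : R) + x) - y x) @[h --> 0^'] -->
  'D_1 y x by exact: dy.
exists d => // t /andP[xt td].
have tx0 : 0 < t - x by rewrite subr_gt0.
have := hd (t - x); rewrite /ball/= sub0r normrN gtr0_norm// => /(_ _ _)/wrap[]; first lra.
  by rewrite gt_eqF.
rewrite /GRing.scale/= mulr1 subrK => /ltr_distlCDr; rewrite -ler_pdivrMr// mulrC.
exact: ltW.
Qed.

(** [y] is compared with the distribution function of a measure that locally dominates the
    derivative. Truncating from below and adding [M] makes the integrand non-negative, as
    [open_cover_measure] requires; the open cover turns a bound on integrals into a slope estimate
    at every point. *)
Lemma derivative_integral_trunc_le a b (y dy : R -> R) (M : R) : a < b -> 0 <= M ->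
    {within `[a, b], continuous y} ->
    (forall x, x \in `]a, b[ -> is_derive x 1 y (dy x)) ->
    mu.-integrable `]a, b[ (EFin \o dy) ->
  y b - y a <= \int[mu]_(x in `]a, b[) Num.max (dy x) (- M).
Proof.
move=> ab M0 cy dyE idy.
pose q x := Num.max (dy x) (- M) + M.
have mdy : measurable_fun `]a, b[%classic dy by apply/measurable_EFinP; case/integrableP: idy.
have mmax : measurable_fun `]a, b[%classic (fun x => Num.max (dy x) (- M)).
  by apply: measurable_maxr => //; exact: measurable_cst.
have imax : mu.-integrable `]a, b[ (EFin \o fun x => Num.max (dy x) (- M)).
  apply: le_integrable idy => //; first exact/measurable_EFinP.
  move=> x _ /=; rewrite lee_fin; case: (leP (dy x) (- M)) => // h.
  by rewrite normrN ger0_norm// ler0_norm; lra.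
have icst : mu.-integrable `]a, b[ (EFin \o fun=> M).
  apply: measurable_bounded_integrable => //.
    apply: (@le_lt_trans _ _ (lebesgue_measure (`]a, b[%classic : set R))) => //.
    by rewrite lebesgue_measure_itv/= lte_fin ab -EFinB ltry.
  by exists M; split; [exact: num_real|move=> A MA x _; rewrite /= ger0_norm// ltW].
have q0 x : 0 <= q x by rewrite /q -lerBlDr sub0r le_max lexx orbT.
pose p := q \_ `]a, b[%classic.
have p0 x : 0 <= p x by rewrite /p patchE; case: ifP.
have mp : measurable_fun setT p.
  by apply/(measurable_restrictT _ _).1 => //; apply: measurable_funD.
have iq : mu.-integrable `]a, b[ (EFin \o q)
  by have := integrableD _ imax icst; apply; exact: measurable_itv.
have ip : (\int[mu]_(x in `[a, b]) (p x)%:E =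
    (\int[mu]_(x in `]a, b[) Num.max (dy x) (- M) + M * (b - a))%:E)%E.
  transitivity (\int[mu]_(x in `[a, b]) (((EFin \o q) \_ `]a, b[) x))%E.
    by apply: eq_integral => x _; rewrite restrict_EFin.
  rewrite -integral_mkcondr setIidr; last by apply: subset_itvW.
  have -> : M * (b - a) = \int[mu]_(x in `]a, b[) M.
    rewrite Rintegral_cst//; congr (_ * _).
    transitivity (fine (lebesgue_measure (`]a, b[%classic : set R))) => //.
    by rewrite lebesgue_measure_itv/= lte_fin ab.
  rewrite -RintegralD// /Rintegral fineK//.
  by apply: integrable_fin_num.
(* No derivative is given at [a], so the slope argument starts at [a' > a], which then tends to [a]
   by continuity. *)
suff hle a' eps : a < a' -> a' < b -> 0 < eps ->
    y b - y a' <= \int[mu]_(x in `]a, b[) Num.max (dy x) (- M) + eps + M * (a' - a).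
  apply/ler_addgt0Pr => eps eps0.
  have e30 : 0 < eps / 3 by rewrite divr_gt0.
  have [|d d0 hd] := within_continuous_dist cy _ e30 (x := a).
    by rewrite /= in_itv/= lexx ltW.
  have M10 : 0 < M + 1 by rewrite ltr_wpDl.
  pose r := Num.min (d / 2) (Num.min ((b - a) / 2) (eps / 3 / (M + 1))).
  have r0 : 0 < r by rewrite !lt_min !divr_gt0 ?subr_gt0.
  have rd : r <= d / 2 by rewrite ge_min lexx.
  have rb : r <= (b - a) / 2 by rewrite !ge_min lexx orbT.
  have rM : r * (M + 1) <= eps / 3 by rewrite -ler_pdivlMr// !ge_min lexx !orbT.
  have := hle (a + r) (eps / 3); rewrite ltrDl r0 => /(_ isT _ e30)/wrap[]; first lra.
  have := hd (a + r); rewrite opprD addNKr normrN gtr0_norm// => /(_ _ _)/wrap[].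
  - by rewrite /= in_itv/=; apply/andP; split; lra.
  - lra.
  rewrite ltr_distl => /andP[h1 h2].
  have -> : a + r - a = r by ring.
  move: rM; rewrite mulrDr mulr1 (mulrC r).
  by move: h1 h2 (ltW r0) eps0; clear; move: (Rintegral _ _ _) (y b) (y a) (y (a + r)) (M * r) => *; lra.
move=> aa' a'b eps0.
have ba0 : 0 < b - a by rewrite subr_gt0.
(* So that [2 eta (b - a) = eps / 2]; the other half of [eps] is the excess of the measure. *)
pose eta := eps / (4 * (b - a)).
have eta0 : 0 < eta by rewrite divr_gt0// mulr_gt0.
have [m [mle mloc]] := open_cover_measure a b eta0 (divr_gt0 eps0 (ltr0n _ 2)) mp p0.
rewrite ip -EFinD in mle.
have mfin A : measurable A -> m A \is a fin_num.
  move=> mA; rewrite ge0_fin_numE ?measure_ge0//.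
  by apply: (@le_lt_trans _ _ (m setT)); [apply: le_measure; rewrite ?inE|
    exact: le_lt_trans mle (ltry _)].
pose Phi x := fine (m `]a', x]%classic).
have PhiB x t : a' <= x -> x < t -> Phi t - Phi x = fine (m `]x, t]%classic).
  move=> ax xt; rewrite /Phi; apply/eqP; rewrite subr_eq addrC; apply/eqP.
  rewrite -fineD ?mfin// -measureU//.
  - by rewrite -itv_bndbnd_setU// bnd_simp// ltW.
  - by apply/seteqP; split => // z [] /=; rewrite !in_itv/= => /andP[_ h1] /andP[]; rewrite ltNge h1.
have Phia : Phi a' = 0 by rewrite /Phi set_itvoc0 measure0.
have Phib : Phi b <= \int[mu]_(x in `]a, b[) Num.max (dy x) (- M) + M * (b - a) + eps / 2.
  rewrite -lee_fin /Phi fineK ?mfin//; apply: le_trans mle.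
  by apply: le_measure; rewrite ?inE.
(* To the right of [x], [Phi] grows at least with slope [p x - eta] and [y] at most with slope
   [dy x + eta]; the last term pays for both errors. *)
pose F x := Phi x - M * x - y x + 2 * eta * x.
suff : F a' <= F b.
  rewrite /F Phia => h.
  have e2 : 2 * eta * (b - a') <= eps / 2.
    have -> : eps / 2 = 2 * eta * (b - a) by rewrite /eta; field; rewrite gt_eqF.
    by apply: (ler_wpM2l (mulr_ge0 (ler0n _ 2) (ltW eta0))); rewrite lerD2l lerN2 ltW.
  move: e2 h Phib; rewrite !mulrBr; clear; move: (Rintegral _ _ _) => Q.
  by move: (M * _) (M * _) (M * _) (2 * eta * b) (2 * eta * a') (y b) (y a') (Phi b) => *; lra.
apply: right_increasing; first exact: ltW.
  move=> x /andP[ax xb].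
  have xab : x \in `]a, b[ by rewrite in_itv/= xb (lt_le_trans aa').
  have [|d1 d10 h1] := mloc x; first by apply: subset_itvW xab.
  have [d2 d20 h2] := is_derive_slope_le (dyE x xab) eta0.
  exists (Num.min d1 d2) => [|t /andP[xt]]; first by rewrite lt_min d10.
  rewrite -ltrBlDl lt_min !ltrBlDl => /andP[t1 t2] tb.
  have := h1 t; rewrite xt => /(_ t1); rewrite -[m _]fineK ?mfin// lee_fin -PhiB// => hPhi.
  have := h2 t; rewrite xt => /(_ t2) hy.
  have px : dy x + M <= p x by rewrite /p patchE mem_setE xab /q lerD2r le_max lexx.
  have tx : 0 <= t - x by rewrite subr_ge0 ltW.
  rewrite /F -subr_ge0.
  have : (dy x + M - eta) * (t - x) <= (p x - eta) * (t - x) by rewrite ler_wpM2r// lerD2r.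
  move: hPhi hy; rewrite !(mulrDl, mulrBl, mulrBr, mulrDr); lra.
move=> x e /andP[ax xb] e0.
have e30 : 0 < e / 2 by rewrite divr_gt0.
have [|d d0 hd] := within_continuous_dist cy _ e30 (x := x).
  by rewrite /= in_itv/= xb andbT ltW// (lt_trans aa').
have M10 : 0 < M + 2 * eta + 1 by lra.
have c0 : 0 < e / 2 / (M + 2 * eta + 1) by rewrite divr_gt0.
exists (Num.min d (e / 2 / (M + 2 * eta + 1))) => [|t]; first by rewrite lt_min d0.
rewrite ltrBlDr -ltrBlDl lt_min => /andP[/andP[t1 t2] tx] at'.
rewrite ltr_pdivlMr// in t2.
have := hd t; rewrite gtr0_norm ?subr_gt0// => /(_ _ t1)/wrap[].
  by rewrite /= in_itv/=; apply/andP; split; lra.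
rewrite ltr_distl => /andP[h1 h2].
have hP : Phi t <= Phi x by rewrite -subr_ge0 PhiB// fine_ge0.
have xt0 : 0 <= x - t by rewrite subr_ge0 ltW.
have hM : M * (x - t) <= e / 2.
  by rewrite mulrC (le_trans _ (ltW t2))// ler_wpM2l//; lra.
have heta : 2 * eta * t <= 2 * eta * x by apply: (ler_wpM2l (mulr_ge0 (ler0n _ 2) (ltW eta0))); exact: ltW.
by rewrite /F; move: hM; rewrite mulrBr; lra.
Qed.

(** The truncations at [- n] tend to [dy] and are dominated by [|dy|], so the bound passes to the
    limit. *)
Lemma derivative_integral_le a b (y dy : R -> R) : a < b ->
    {within `[a, b], continuous y} ->
    (forall x, x \in `]a, b[ -> is_derive x 1 y (dy x)) ->
    mu.-integrable `]a, b[ (EFin \o dy) ->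
  y b - y a <= \int[mu]_(x in `]a, b[) dy x.
Proof.
move=> ab cy dyE idy.
have mdy : measurable_fun `]a, b[%classic dy by apply/measurable_EFinP; case/integrableP: idy.
pose f (n : nat) x := (Num.max (dy x) (- n%:R))%:E.
have [|||||_ _ hcvg] := @dominated_convergence _ _ _ mu `]a, b[%classic (measurable_itv _)
  f (EFin \o dy) (fun x => `|dy x|%:E).
- move=> n; apply/measurable_EFinP.
  by apply: measurable_maxr => //; exact: measurable_cst.
- exact/measurable_EFinP.
- apply: aeW => x _; apply/fine_cvgP; split; first exact: nearW.
  apply: cvg_near_cst; near=> n; rewrite /f/=; apply/max_idPl.
  rewrite lerNl (le_trans (ler_norm _))// normrN.
  by near: n; exact: nbhs_infty_ger.
- exact: integrable_abse idy.
- apply: aeW => x n _; rewrite /f lee_fin; case: (leP (dy x) (- n%:R)) => // h.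
  rewrite normrN normr_nat ler0_norm; first by rewrite lerNr.
  by rewrite (le_trans h)// oppr_le0.
have J : (\int[mu]_(x in `]a, b[) (EFin \o dy) x = (\int[mu]_(x in `]a, b[) dy x)%R%:E)%E.
  by rewrite /Rintegral fineK//; apply: integrable_fin_num.
rewrite J in hcvg; move/fine_cvgP: hcvg => [_ hcvg].
rewrite -(cvg_lim _ hcvg)//; apply: limr_ge; first by apply/cvg_ex; eexists; exact: hcvg.
by near=> n; exact: derivative_integral_trunc_le.
Unshelve. all: by end_near. Qed.

(* The derivative is only assumed to be integrable, so that the classical version for continuous
   derivatives does not apply. *)
Theorem integral_derivative a b (y dy : R -> R) : a < b ->
    {within `[a, b], continuous y} ->
    (forall x, x \in `]a, b[ -> is_derive x 1 y (dy x)) ->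
    mu.-integrable `]a, b[ (EFin \o dy) ->
  y b - y a = \int[mu]_(x in `]a, b[) dy x.
Proof.
move=> ab cy dyE idy; apply/eqP; rewrite eq_le derivative_integral_le//=.
have idyN : mu.-integrable `]a, b[ (EFin \o (fun x => - dy x)) by exact: (integrableN idy).
have := @derivative_integral_le a b (fun x => - y x) (fun x => - dy x) ab _ _ idyN.
rewrite opprK addrC => /(_ _ _)/wrap[].
- by move=> x; apply: cvgN; exact: cy.
- by move=> x xab; apply: is_deriveN; exact: dyE.
have -> : \int[mu]_(x in `]a, b[) - dy x = - \int[mu]_(x in `]a, b[) dy x.
  transitivity (\int[mu]_(x in `]a, b[) (-1 * dy x)).
    by apply: eq_Rintegral => x _; rewrite mulN1r.
  by rewrite RintegralZl// mulN1r.
by rewrite lerNr opprB.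
Qed.
End FundamentalTheorem.

(** * Uniqueness for the scalar equation *)

Section CausalConvolution.
Context {R : realType}.
Local Notation mu := (@lebesgue_measure R).
Implicit Types (f g : R -> R) (t x : R).

Lemma causal_integrand f g t : (forall x, x <= 0 -> f x = 0) -> (forall x, x <= 0 -> g x = 0) ->
  (fun x => f (t - x) * g x) = (fun x => f (t - x) * g x) \_ `]0, t[%classic.
Proof.
move=> f0 g0; apply/funext => x; rewrite patchE mem_setE in_itv/=.
case: ltP => [x0|/g0 ->]; last by rewrite mulr0.
by case: ltP => // tx; rewrite f0 ?mul0r// subr_le0.
Qed.

Lemma conv_itv f g t : (forall x, x <= 0 -> f x = 0) -> (forall x, x <= 0 -> g x = 0) ->
  conv f g t = \int[mu]_(x in `]0, t[) (f (t - x) * g x).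
Proof.
move=> f0 g0; rewrite convE {1}(causal_integrand t f0 g0) /Rintegral; congr fine.
by rewrite [RHS]integral_mkcond; apply: eq_integral => x _; rewrite /= !patchE; case: ifP.
Qed.

Lemma conv_int_itv f g t : (forall x, x <= 0 -> f x = 0) -> (forall x, x <= 0 -> g x = 0) ->
  mu.-integrable `]0, t[ (EFin \o (fun x => f (t - x) * g x)) -> conv_int f g t.
Proof.
move=> f0 g0; rewrite /conv_int => /integrable_mkcond-/(_ (measurable_itv _)).
apply: eq_integrable => // x _; rewrite restrict_EFin/=.
by rewrite -causal_integrand.
Qed.

Lemma conv_le0 f g t : (forall x, x <= 0 -> f x = 0) -> (forall x, x <= 0 -> g x = 0) ->
  t <= 0 -> conv f g t = 0.
Proof.
move=> f0 g0 t0; rewrite conv_itv// set_itv_ge ?Rintegral_set0// -leNgt//.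
Qed.

Lemma conv_int_le0 f g t : (forall x, x <= 0 -> f x = 0) -> (forall x, x <= 0 -> g x = 0) ->
  t <= 0 -> conv_int f g t.
Proof.
move=> f0 g0 t0; apply: conv_int_itv => //.
rewrite set_itv_ge; last by rewrite bnd_simp -leNgt.
exact: integrable_set0.
Qed.
End CausalConvolution.

Section Clamp.
Context {R : realType}.
Variables (T : R) (T_gt0 : 0 < T).
Implicit Types (x : R).

(** The projection onto [[0, T]]: composition with it makes a function that is continuous on
    [[0, T]] continuous and bounded on the whole line. *)
Definition clamp x : R := Num.max 0 (Num.min x T).

Lemma clamp_itv x : clamp x \in `[0, T].
Proof. by rewrite in_itv/= /clamp le_max lexx ge_max (ltW T_gt0) ge_min lexx orbT. Qed.

Lemma clamp_id x : x \in `[0, T] -> clamp x = x.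
Proof. by rewrite in_itv/= /clamp => /andP[x0 xT]; rewrite (min_idPl xT) (max_idPr x0). Qed.

Lemma clamp_dist x x' : `|clamp x - clamp x'| <= `|x - x'|.
Proof.
have := ler_norm (x - x'); have := ler_norm (x' - x); rewrite (distrC x').
move: `|x - x'| => N h1 h2; rewrite ler_norml /clamp.
by case: (leP x T) => h3; case: (leP x' T) => h4; (case: (leP 0 x) => h5 || idtac);
  (case: (leP 0 x') => h6 || idtac); (case: (leP 0 T) => h7 || idtac); apply/andP; split; lra.
Qed.

Lemma clamp_continuous (f : R -> R) : {within `[0, T], continuous f} -> continuous (f \o clamp).
Proof.
move=> cf x; apply/cvgrPdist_lt => e e0.
have [|d d0 hd] := within_continuous_dist cf _ e0 (x := clamp x); first exact: clamp_itv.
exists d => //= x' xx'; apply: hd; first exact: clamp_itv.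
exact: le_lt_trans (clamp_dist x x') xx'.
Qed.

Lemma clamp_bounded (f : R -> R) : {within `[0, T], continuous f} ->
  exists C : R, forall x, `|f (clamp x)| <= C.
Proof.
move=> cf.
have /compact_bounded[C [_ hC]] := continuous_compact cf (@segment_compact _ 0 T).
exists (C + 1) => x; apply: (hC (C + 1)); first by rewrite ltrDl.
by exists (clamp x) => //; exact: clamp_itv.
Qed.
End Clamp.

Section Uniqueness.
Context {R : realType}.
Local Notation mu := (@lebesgue_measure R).
Variables (rho : R) (rho_gt0 : 0 < rho) (rho_le1 : rho <= 1).
Variables (g0 M : R) (dg : R -> R).
Hypothesis dg_continuous : continuous dg.
Hypothesis dg_bounded : forall x, `|dg x| <= M.
Variables (lam phi T : R) (y dy : R -> R).
Hypothesis T_gt0 : 0 < T.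
Hypothesis y_continuous : {within `[0, T], continuous y}.
Hypothesis y_derive : forall x, x \in `]0, T[ -> is_derive x 1 y (dy x).
Implicit Types (x t : R).
Local Notation k := (pow_kernel rho).
Local Notation h := (@pow_kernel R 1).
Local Notation forcing := (forcing g0 dg).
Local Notation response := (response rho g0 dg).

Let tk : tame k := tame_pow_kernel rho_gt0.
Let th : tame h := tame_pow_kernel ltr01.

Let Y := causal (y \o clamp T).

Lemma tame_clamped : tame Y.
Proof.
have [C hC] := clamp_bounded T_gt0 y_continuous.
apply: tame_bounded.
- apply: measurable_causal; apply: continuous_measurable_fun.
  exact: clamp_continuous.
- by move=> x; exact: causal_le0.
- move=> T'; exists C => x _; rewrite /Y /causal; case: ifP => _; first exact: hC.
  by rewrite normr0 (le_trans _ (hC 0)).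
Qed.

Lemma clampedE t : t \in `]0, T] -> Y t = y t.
Proof.
rewrite in_itv/= => /andP[t0 tT].
by rewrite /Y causal_gt0//= clamp_id// in_itv/= (ltW t0).
Qed.

Let W x := phi * forcing x + (- lam) * Y x.

Let tf : tame forcing := tame_forcing g0 dg_continuous dg_bounded.

Lemma tame_residual : tame W.
Proof. by apply: tameD; apply: tameZ => //; exact: tame_clamped. Qed.

(** [W] is the forcing minus [lam y]; in integrated form the equation is the one solved by
    [volterra_solution]. *)
Lemma integrated_uniqueness : (forall t, t \in `]0, T] -> y t - y 0 = conv k W t) ->
  forall t, t \in `]0, T] -> y t = y 0 * ml_kernel rho lam 1 t + phi * response lam t.
Proof.
move=> hW t tT; rewrite -clampedE//.
have tY := tame_clamped.
have /andP[t0 t'T] : 0 < t <= T by move: tT; rewrite in_itv.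
apply: (volterra_solution rho_gt0 dg_continuous dg_bounded (T := T)) => // x x0 xT.
have xI : x \in `]0, T] by rewrite in_itv/= x0.
rewrite clampedE// pow_kernel1 x0 mulr1.
have := hW x xI; rewrite convDr; try by apply: tame_conv_int => //; exact: tameZ.
by rewrite !convZr; try exact: tame_conv_int; move=> h1; lra.
Qed.

Lemma derivative_uniqueness : rho = 1 ->
    (forall t, t \in `]0, T[ -> dy t = phi * forcing t - lam * y t) ->
  forall t, t \in `]0, T] -> y t = y 0 * ml_kernel rho lam 1 t + phi * response lam t.
Proof.
move=> rho1 hdy; apply: integrated_uniqueness => t; rewrite in_itv/= => /andP[t0 tT].
have tW := tame_residual.
have W0 x : x <= 0 -> W x = 0 by exact: tame_le0.
have dyW x : x \in `]0, t[ -> dy x = W x.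
  rewrite in_itv/= => /andP[x0 xt].
  have xT : x < T by exact: lt_le_trans tT.
  by rewrite hdy ?in_itv/= ?x0// /W clampedE ?in_itv/= ?x0 ?ltW// mulNr.
have sub : {subset `]0, t[ <= `]0, T[} by move=> x; rewrite !in_itv/= => /andP[-> /lt_le_trans ->].
have iW : mu.-integrable `]0, t[ (EFin \o W).
  apply: integrableS (integrable_tame t tW) => //.
  by move=> x /=; rewrite !in_itv/= => /andP[_ /ltW].
have cy : {within `[0, t], continuous y}.
  by apply: continuous_subspaceW y_continuous => x /=; rewrite !in_itv/= => /andP[-> /le_trans]; exact.
have idy : mu.-integrable `]0, t[ (EFin \o dy).
  by apply: eq_integrable iW => // x; rewrite inE/= => /dyW ->.
rewrite (integral_derivative t0 cy (fun x xt => y_derive (sub x xt)) idy).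
rewrite rho1 conv_itv//; last by move=> x; exact: pow_kernel_le0.
apply: eq_Rintegral => x; rewrite inE/= => xt; rewrite dyW//.
by move: xt; rewrite in_itv/= => /andP[_ xt]; rewrite pow_kernel1 subr_gt0 xt mul1r.
Qed.

Local Notation kap := (pow_kernel (1 - rho)).

(** The Caputo equation says that [pow_kernel (1 - rho)] convolved with [dy] is [W]. A further
    convolution with [k] yields the integral of [dy], that is [y - y 0]. *)
Lemma caputo_uniqueness : rho < 1 ->
    (forall t, t \in `]0, T] ->
      mu.-integrable `]0, t[ (EFin \o (fun x => ((t - x) `^ rho)^-1 * dy x)) /\
      (Gamma (1 - rho))^-1 * \int[mu]_(x in `]0, t[) (((t - x) `^ rho)^-1 * dy x) =
        phi * forcing t - lam * y t) ->
  forall t, t \in `]0, T] -> y t = y 0 * ml_kernel rho lam 1 t + phi * response lam t.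
Proof.
move=> rho_lt1 hC; apply: integrated_uniqueness => t tI.
have rho'0 : 0 < 1 - rho by rewrite subr_gt0.
have tkap : tame kap := tame_pow_kernel rho'0.
have kap0 x : x <= 0 -> kap x = 0 by exact: pow_kernel_le0.
(* Set to 0 outside []0, T[], so that it is causal. No power bound is known for [d], hence [convA]
   with its local hypotheses takes the place of [tame_convA]. *)
pose d := dy \_ `]0, T[%classic.
have d0 x : x <= 0 -> d x = 0.
  by move=> x0; rewrite /d patchE mem_setE in_itv/= ltNge x0.
have dE s x : s <= T -> x \in `]0, s[ -> d x = dy x.
  move=> sT; rewrite in_itv/= => /andP[x0 xs].
  by rewrite /d patchE mem_setE in_itv/= x0 (lt_le_trans xs).
have kapE s x : x \in `]0, s[ -> kap (s - x) = (Gamma (1 - rho))^-1 * ((s - x) `^ rho)^-1.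
  rewrite in_itv/= => /andP[_ xs]; rewrite pow_kernelE ?subr_gt0// mulrC; congr (_ * _).
  by rewrite -powRN; congr (_ `^ _); ring.
(* The weighted derivative for [t = T] is measurable; multiplication by the inverse weight recovers
   [dy]. *)
have md : measurable_fun setT d.
  apply/(measurable_restrictT _ _).1 => //.
  have [|/integrableP[/measurable_EFinP + _] _] := hC T; first by rewrite in_itv/= lexx T_gt0.
  move=> m1.
  apply: (eq_measurable_fun (fun x => (T - x) `^ rho * (((T - x) `^ rho)^-1 * dy x))).
    move=> x; rewrite inE/= in_itv/= => /andP[_ xT]; rewrite mulrA mulfV ?mul1r//.
    by rewrite gt_eqF// powR_gt0// subr_gt0.
  apply: measurable_funM => //; apply: measurable_funTS.
  by apply: (measurableT_comp (measurable_powR _)); exact: measurable_funB.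
have ikap s : s <= T -> conv_int kap d s.
  move=> sT; have [s0|s0] := leP s 0; first exact: conv_int_le0.
  apply: conv_int_itv => //.
  have [|I _] := hC s; first by rewrite in_itv/= s0.
  have J : mu.-integrable `]0, s[ (fun x => ((Gamma (1 - rho))^-1)%:E * (((s - x) `^ rho)^-1 * dy x)%R%:E)%E.
    exact: integrableZl.
  apply: eq_integrable J => //.
  move=> x; rewrite inE/= => xs; rewrite /= kapE// (dE s)//.
  by rewrite -EFinM mulrA.
have ckap s : s \in `]0, T] -> conv kap d s = W s.
  move=> sI; have [I Ce] := hC s sI.
  have sT : s <= T by move: sI; rewrite in_itv/= => /andP[].
  rewrite /W clampedE// mulNr -Ce conv_itv// -RintegralZl//; apply: eq_Rintegral => x.
  by rewrite inE/= => xs; rewrite kapE// (dE s)// mulrA.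
have tT : t <= T by move: tI; rewrite in_itv/= => /andP[].
have t0 : 0 < t by move: tI; rewrite in_itv/= => /andP[].
have mdy : measurable_fun `]0, t[%classic dy.
  apply: (eq_measurable_fun d); last exact: measurable_funTS.
  by move=> x; rewrite inE/= => xt; rewrite (dE t).
(* The weight is at least [t^(- rho)] on []0, t[], so [dy] itself is integrable. *)
have id : mu.-integrable `]0, t[ (EFin \o dy).
  have [I _] := hC t tI.
  have J : mu.-integrable `]0, t[ (fun x => (t `^ rho)%:E * (((t - x) `^ rho)^-1 * dy x)%R%:E)%E.
    exact: integrableZl.
  apply: le_integrable J => //; first exact/measurable_EFinP.
  move=> x; rewrite /= in_itv/= => /andP[x0 xt]; rewrite lee_fin !normrM mulrA ler_peMl//.
  have tx : 0 < (t - x) `^ rho by rewrite powR_gt0// subr_gt0.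
  rewrite !ger0_norm ?invr_ge0 ?powR_ge0// ler_pdivlMr// mul1r.
  apply: ge0_ler_powR; rewrite ?nnegrE ?subr_ge0 ?(ltW xt) ?(ltW t0) ?(ltW rho_gt0)//.
  by rewrite gerBl ltW.
have ih : conv_int h d t.
  apply: conv_int_itv => //; first by move=> x; exact: pow_kernel_le0.
  apply: eq_integrable id => // x; rewrite inE/= => xt; rewrite (dE t)//.
  by move: xt; rewrite in_itv/= => /andP[_ xt]; rewrite pow_kernel1 subr_gt0 xt mul1r.
have cy : {within `[0, t], continuous y}.
  by apply: continuous_subspaceW y_continuous => x /=; rewrite !in_itv/= => /andP[-> /le_trans]; exact.
have sub x : x \in `]0, t[ -> x \in `]0, T[.
  by rewrite !in_itv/= => /andP[-> /lt_le_trans ->].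
transitivity (conv h d t).
  rewrite (integral_derivative t0 cy (fun x xt => y_derive (sub x xt)) id).
  rewrite conv_itv//; last by move=> x; exact: pow_kernel_le0.
  apply: eq_Rintegral => x; rewrite inE/= => xt; rewrite (dE t)//.
  by move: xt; rewrite in_itv/= => /andP[_ xt]; rewrite pow_kernel1 subr_gt0 xt mul1r.
have kk x : conv k kap x = h x by rewrite conv_pow_kernel// addrC subrK.
have -> : conv h d t = conv (conv k kap) d t by congr (conv _ d t); apply/funext => x; rewrite kk.
rewrite -convA//.
- apply: eq_conv => //.
  + by move=> x x0 xt; apply: ckap; rewrite in_itv/= x0; lra.
  + by move=> x; exact: pow_kernel_le0.
  + by move=> x; exact: pow_kernel_le0.
  + by move=> x; exact: conv_le0.
  + by move=> x; exact: (tame_le0 tame_residual).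
- exact: measurable_pow_kernel.
- exact: measurable_pow_kernel.
- move=> s ks; apply: ikap; apply: le_trans tT; rewrite leNgt; apply: contra ks => st.
  by rewrite pow_kernel_le0// subr_le0 ltW.
- by move=> x _; exact: pow_kernel_conv_int.
- move: ih; congr (conv_int _ d t); apply/funext => x; rewrite -kk; congr (conv _ _ x);
  by apply/funext => z /=; rewrite ger0_norm// pow_kernel_ge0.
Qed.

End Uniqueness.

(** * The coefficients b_k and Delta *)

Section DerivativeWithin.
Context {R : realType}.
Implicit Types (g : R -> R) (S : set R) (t l : R).

Lemma derivative_within_dist (K : numFieldType) (V : normedModType K) (c : R -> K) S (h : R -> V)
    t (l : V) : derivative_within c S h t l -> forall e : K, 0 < e ->
  exists2 d : R, 0 < d & forall s, S s -> s != t -> `|t - s| < d ->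
    `|l - c ((s - t)^-1) *: (h s - h t)| < e.
Proof.
move=> /cvgrPdist_lt hd e e0.
have [d /= d0 {}hd] := hd _ e0; exists d => // s Ss st ts.
exact: hd.
Qed.

Lemma derivative_within_is_derive S g t l : nbhs t S ->
  derivative_within (V := R^o) (fun x : R => x) S g t l -> is_derive t 1 g l.
Proof.
move=> /nbhs_ballP[r /= r0 hr] hg.
have D : h^-1 *: (g (h *: (1 : R) + t) - g t) @[h --> 0^'] --> l.
  apply/cvgrPdist_lt => e e0; have [d d0 hd] := derivative_within_dist hg e0.
  exists (Num.min r d) => /=; first by rewrite lt_min r0.
  move=> h; rewrite /ball_/= sub0r normrN lt_min => /andP[hr' hd'] h0.
  have e1 : t - (h + t) = - h by ring.
  have := hd (h + t); rewrite addrK e1 normrN /GRing.scale/= mulr1; apply => //.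
    by apply: hr; rewrite /ball/= e1 normrN.
  by rewrite -subr_eq0 addrK.
by split; [apply/cvg_ex; exists l|exact: cvg_lim].
Qed.

Lemma derivative_within_continuous S g : (forall t, S t ->
    exists l, derivative_within (V := R^o) (fun x : R => x) S g t l) ->
  {within S, continuous g}.
Proof.
move=> hg; apply/subspace_continuousP => t St; have [l hl] := hg t St.
have [d d0 hd] := derivative_within_dist hl (ltr01 : (0 : R) < 1).
apply/cvgrPdist_lt => e e0.
have L0 : 0 < `|l| + 1 by rewrite ltr_wpDl.
exists (Num.min d (e / (`|l| + 1))) => /=; first by rewrite lt_min d0 divr_gt0.
move=> s; rewrite /ball_/= lt_min => /andP[sd se] Ss.
have [->|st] := eqVneq s t; first by rewrite subrr normr0.
have := hd s Ss st sd; rewrite /GRing.scale/= => h1.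
have h2 : `|(s - t)^-1 * (g s - g t)| < `|l| + 1.
  have -> : (s - t)^-1 * (g s - g t) = l - (l - (s - t)^-1 * (g s - g t)) by ring.
  by apply: (le_lt_trans (ler_normB _ _)); rewrite ltrD2l.
rewrite distrC in se; rewrite distrC.
have -> : g s - g t = (s - t) * ((s - t)^-1 * (g s - g t)).
  by rewrite mulrA mulfV ?mul1r// subr_eq0.
rewrite normrM; rewrite ltr_pdivlMr// in se.
apply: le_lt_trans se; apply: ler_wpM2l => //; exact: ltW.
Qed.
End DerivativeWithin.

Section Coefficients.
Context {R : realType}.
Local Notation mu := (@lebesgue_measure R).
Implicit Types (T t lam : R) (g : R -> R).
Local Notation h := (@pow_kernel R 1).

(** The derivative is continued by its boundary values, which gives the global continuity and bound
    assumed in the scalar theory. The point 0 is excluded because [forcing] is cut off there. *)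
Lemma C1_on_forcing T g : 0 < T -> C1_on T g -> exists M dg,
  [/\ continuous dg, forall x, `|dg x| <= M & forall t, t \in `]0, T] -> g t = forcing (g 0) dg t].
Proof.
move=> T0 [dg0 [gd cdg]].
have [M hM] := clamp_bounded T0 cdg.
have cd := clamp_continuous T0 cdg.
exists M, (dg0 \o clamp T); split => // t; rewrite in_itv/= => /andP[t0 tT].
have cg : {within `[0, T], continuous g}.
  by apply: derivative_within_continuous => x xT; exists (dg0 x); exact: gd.
have cgt : {within `[0, t], continuous g}.
  by apply: continuous_subspaceW cg => x /=; rewrite !in_itv/= => /andP[-> /le_trans]; exact.
have td := tame_causal_dg cd hM.
have cE x : x \in `]0, t[ -> causal (dg0 \o clamp T) x = dg0 x.
  rewrite in_itv/= => /andP[x0 xt]; rewrite causal_gt0//= clamp_id// in_itv/= (ltW x0)/=.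
  by rewrite ltW// (lt_le_trans xt).
have gdt x : x \in `]0, t[ -> is_derive x 1 g (dg0 x).
  move=> xt; have xT : x \in `]0, T[.
    by move: xt; rewrite !in_itv/= => /andP[-> /lt_le_trans ->].
  apply: (derivative_within_is_derive (S := `[0, T]%classic)).
    apply: filterS (near_in_itvoo xT) => z /=; exact: subset_itvW.
  by apply: gd; apply: subset_itvW xT.
have idg : mu.-integrable `]0, t[ (EFin \o dg0).
  have I : mu.-integrable `]0, t[ (EFin \o causal (dg0 \o clamp T)).
    apply: integrableS (integrable_tame t td) => //.
    by move=> x /=; rewrite !in_itv/= => /andP[_ /ltW].
  by apply: eq_integrable I => // x; rewrite inE/= => /cE ->.
have := integral_derivative t0 cgt gdt idg.
move=> /(canRL (subrK _)) ->; rewrite addrC /forcing pow_kernel1 t0 mulr1; congr (_ + _).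
rewrite conv_itv; [|by move=> x; exact: pow_kernel_le0|by move=> x; exact: causal_le0].
apply: eq_Rintegral => x; rewrite inE/= => xt; rewrite cE//.
by move: xt; rewrite in_itv/= => /andP[_ xt]; rewrite pow_kernel1 subr_gt0 xt mul1r.
Qed.

Section Forced.
Variables (rho g0 M : R) (dg g : R -> R) (T : R).
Hypothesis rho_gt0 : 0 < rho.
Hypothesis dg_continuous : continuous dg.
Hypothesis dg_bounded : forall x, `|dg x| <= M.
Hypothesis gE : forall t, t \in `]0, T] -> g t = forcing g0 dg t.
Local Notation response := (response rho g0 dg).

Lemma b_coefE lam t : t \in `]0, T] -> b_coef rho g lam t = response lam t.
Proof.
rewrite in_itv/= => /andP[t0 tT].
have tf := tame_forcing g0 dg_continuous dg_bounded.
have te := tame_ml_kernel rho_gt0 lam rho_gt0.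
pose F s := (t - s) `^ (rho - 1) * mittag_leffler rho rho (- lam * (t - s) `^ rho) * g s.
have FE s : s \in `]0, t[ -> F s = ml_kernel rho lam rho (t - s) * forcing g0 dg s.
  rewrite in_itv/= => /andP[s0 st]; rewrite ml_kernelE ?subr_gt0// -gE// in_itv/= s0.
  by rewrite ltW// (lt_le_trans st).
have mF : measurable_fun `]0, t[%classic (EFin \o F).
  have mG := measurable_conv_integrand1 t (tame_measurable te) (tame_measurable tf).
  apply/measurable_EFinP; apply: eq_measurable_fun (measurable_funTS mG).
  by move=> s; rewrite inE/= => /FE.
(* At the endpoints of [[0, t]] the integrand of [b_coef] and the truncated kernels may differ; two
   points are a null set. *)
transitivity (\int[mu]_(x in `]0, t[) F x).
  by rewrite /b_coef /Rintegral (integral_itv_bndoo true false mF).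
rewrite /response conv_itv; [|by move=> x; exact: tame_le0|by move=> x; exact: tame_le0].
by apply: eq_Rintegral => s; rewrite inE/= => /FE.
Qed.

Lemma b_coef0 lam : b_coef rho g lam 0 = 0.
Proof. by rewrite /b_coef set_itv1 Rintegral_set1. Qed.

End Forced.
End Coefficients.

(** * Fourier series in a Hilbert space *)

Section ScalarField.
Context {R : realType} {k : scalar_kind}.
Local Notation K := (scalar_field R k).
Local Notation of_real := (@of_real R k).
Local Notation re := (@re_scalar R k).
Implicit Types (a b x y : R) (z w e : K).

Lemma of_real0 : of_real 0 = 0. Proof. by case: k. Qed.
Lemma of_real1 : of_real 1 = 1. Proof. by case: k. Qed.
Lemma of_realD x y : of_real (x + y) = of_real x + of_real y.
Proof. by case: k => //=; exact: (rmorphD (real_complex R)). Qed.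
Lemma of_realN x : of_real (- x) = - of_real x.
Proof. by case: k => //=; exact: (rmorphN (real_complex R)). Qed.
Lemma of_realB x y : of_real (x - y) = of_real x - of_real y.
Proof. by rewrite of_realD of_realN. Qed.
Lemma of_realM x y : of_real (x * y) = of_real x * of_real y.
Proof. by case: k => //=; exact: (rmorphM (real_complex R)). Qed.
Lemma of_realV x : of_real x^-1 = (of_real x)^-1.
Proof. by case: k => //=; exact: (fmorphV (real_complex R)). Qed.
Lemma of_real_sum (I : Type) (r : seq I) (P : pred I) (F : I -> R) :
  of_real (\sum_(i <- r | P i) F i) = \sum_(i <- r | P i) of_real (F i).
Proof. by elim/big_rec2: _ => [|i y1 y2 _ <-]; rewrite ?of_real0 ?of_realD. Qed.
Lemma of_real_norm x : `|of_real x| = of_real `|x|.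
Proof. by case: k => //=; rewrite normc_def/= expr0n/= addr0 sqrtr_sqr. Qed.
Lemma ler_of_real x y : (of_real x <= of_real y) = (x <= y).
Proof. by case: k => //=; rewrite lecR. Qed.
Lemma ltr_of_real x y : (of_real x < of_real y) = (x < y).
Proof. by case: k => //=; rewrite ltcR. Qed.
Lemma of_real_inj : injective of_real.
Proof. by case: k => //= x y []. Qed.
Lemma re_of_real x : re (of_real x) = x. Proof. by case: k. Qed.
Lemma of_real_re z : 0 <= z -> of_real (re z) = z.
Proof. by case: k z => //= -[x y]; rewrite lecE/= => /andP[/eqP <- _]. Qed.

Lemma re0 : re 0 = 0. Proof. by case: k. Qed.
Lemma reD z w : re (z + w) = re z + re w.
Proof. by case: k z w => //= -[x y] [x' y']. Qed.
Lemma reN z : re (- z) = - re z.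
Proof. by case: k z => //= -[x y]. Qed.
Lemma reB z w : re (z - w) = re z - re w.
Proof. by rewrite reD reN. Qed.
Lemma re_of_realM x z : re (of_real x * z) = x * re z.
Proof. by case: k z => //= -[a b]/=; rewrite mul0r subr0. Qed.
Lemma conj_of_real x : conj_scalar k (of_real x) = of_real x.
Proof. by case: k => //=; rewrite /Num.conj/= oppr0. Qed.
Lemma conj_scalarM z w : conj_scalar k (z * w) = conj_scalar k z * conj_scalar k w.
Proof. by case: k z w => //= z w; rewrite rmorphM. Qed.
Lemma conj_scalarK z : conj_scalar k (conj_scalar k z) = z.
Proof. by case: k z => //= z; rewrite conjCK. Qed.
Lemma mul_conj_scalar z : z * conj_scalar k z = `|z| ^+ 2.
Proof. by case: k z => //= z; [rewrite real_normK ?num_real|rewrite normCK]. Qed.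

(** Norms take values in [K]; this real version, like [hnorm] for vectors, makes the tools of real
    analysis available. *)
Definition nrm z : R := re `|z|.

Lemma nrmE z : `|z| = of_real (nrm z).
Proof. by rewrite /nrm of_real_re. Qed.
Lemma nrm_ge0 z : 0 <= nrm z.
Proof. by rewrite -ler_of_real of_real0 -nrmE. Qed.
Lemma nrmM z w : nrm (z * w) = nrm z * nrm w.
Proof. by apply: of_real_inj; rewrite of_realM -!nrmE normrM. Qed.
Lemma nrm_of_real x : nrm (of_real x) = `|x|.
Proof. by apply: of_real_inj; rewrite -nrmE of_real_norm. Qed.
Lemma nrm_eq0 z : (nrm z == 0) = (z == 0).
Proof. by rewrite -(normr_eq0 z) nrmE -(inj_eq of_real_inj) of_real0. Qed.
Lemma nrm_conj z : nrm (conj_scalar k z) = nrm z.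
Proof.
apply/eqP; rewrite -(eqrXn2 (n := 2))// ?nrm_ge0//; apply/eqP/of_real_inj.
by rewrite !expr2 !of_realM -!nrmE -!expr2 -!mul_conj_scalar conj_scalarK mulrC.
Qed.
Lemma re_le_nrm z : `|re z| <= nrm z.
Proof.
rewrite -ler_of_real -nrmE; case: k z => //= -[x y]; rewrite normc_def/= lecR.
by rewrite -sqrtr_sqr ler_wsqrtr// lerDl sqr_ge0.
Qed.
Lemma nrm_expr2 z : of_real (nrm z ^+ 2) = `|z| ^+ 2.
Proof. by rewrite !expr2 of_realM -nrmE. Qed.

(** Tested with the conjugate of [z] divided by its modulus, for which [re (w * z)] is the modulus
    of [z]. *)
Lemma re_unit_eq0 z : (forall w, nrm w <= 1 -> re (w * z) = 0) -> z = 0.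
Proof.
move=> hz; have [//|z0] := eqVneq z 0.
have n0 : 0 < nrm z by rewrite lt_neqAle nrm_ge0 eq_sym nrm_eq0 z0.
have := hz (of_real (nrm z)^-1 * conj_scalar k z).
rewrite nrmM nrm_of_real nrm_conj gtr0_norm ?invr_gt0// mulVf ?gt_eqF// lexx => /(_ isT).
rewrite -mulrA (mulrC _ z) mul_conj_scalar -nrm_expr2 -of_realM re_of_real expr2 mulrA mulVf ?gt_eqF//.
by rewrite mul1r => /eqP; rewrite gt_eqF.
Qed.
End ScalarField.

(** * The scalar product and its norm *)

Section InnerProduct.
Context {R : realType} {k : scalar_kind}.
Local Notation K := (scalar_field R k).
Context {H : completeNormedModType K}.
Variable dot : {dot H for conj_scalar k}.
Hypothesis dot_norm : forall x : H, `|x| ^+ 2 = dot x x.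
Local Notation of_real := (@of_real R k).
Local Notation re := (@re_scalar R k).
Implicit Types (x y z : H) (c w : K) (a b : R).

Definition hnorm x : R := re `|x|.

Lemma hnormE x : `|x| = of_real (hnorm x).
Proof. by rewrite /hnorm of_real_re. Qed.
Lemma hnorm_ge0 x : 0 <= hnorm x.
Proof. by rewrite -(@ler_of_real R k) of_real0 -hnormE. Qed.
Lemma hnorm0 : hnorm 0 = 0.
Proof. by rewrite /hnorm normr0 re0. Qed.
Lemma hnormN x : hnorm (- x) = hnorm x.
Proof. by rewrite /hnorm normrN. Qed.
Lemma hnorm_eq0 x : (hnorm x == 0) = (x == 0).
Proof. by rewrite -(normr_eq0 x) hnormE -(inj_eq (@of_real_inj R k)) of_real0. Qed.
Lemma ler_hnormD x y : hnorm (x + y) <= hnorm x + hnorm y.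
Proof. by rewrite -(@ler_of_real R k) of_realD -!hnormE ler_normD. Qed.
Lemma hnormZ c x : hnorm (c *: x) = nrm c * hnorm x.
Proof. by apply: (@of_real_inj R k); rewrite of_realM -!hnormE normrZ nrmE. Qed.
Lemma hnorm_cvgP (I : Type) (F : set_system I) (FF : Filter F) (f : I -> H) x :
  f @ F --> x <-> forall e : R, 0 < e -> \forall i \near F, hnorm (x - f i) < e.
Proof.
split=> [/cvgrPdist_lt fx e e0|fx].
  have := fx (of_real e); rewrite -of_real0 ltr_of_real => /(_ e0).
  by apply: filterS => i; rewrite hnormE ltr_of_real.
apply/cvgrPdist_lt => e e0.
have re0' : 0 < re e by rewrite -(@ltr_of_real R k) of_real0 of_real_re// ltW.
by apply: filterS (fx _ re0') => i; rewrite hnormE -{2}(of_real_re (ltW e0)) ltr_of_real.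
Qed.

Lemma dotDl x y z : dot (x + y) z = dot x z + dot y z.
Proof. exact: linearDl. Qed.
Lemma dotDr x y z : dot x (y + z) = dot x y + dot x z.
Proof. exact: linearDr. Qed.
Lemma dotBl x y z : dot (x - y) z = dot x z - dot y z.
Proof. exact: linearBl. Qed.
Lemma dotBr x y z : dot x (y - z) = dot x y - dot x z.
Proof. exact: linearBr. Qed.
Lemma dot0l x : dot 0 x = 0.
Proof. exact: linear0l. Qed.
Lemma dotZl c x y : dot (c *: x) y = c * dot x y.
Proof. exact: linearZl_LR. Qed.
Lemma dotZr c x y : dot x (c *: y) = conj_scalar k c * dot x y.
Proof. exact: linearZr_LR. Qed.
Lemma dotC x y : dot x y = conj_scalar k (dot y x).
Proof. by rewrite hermitian_subproof expr0 mul1r. Qed.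
Lemma dot_suml (I : Type) (r : seq I) (P : pred I) (F : I -> H) y :
  dot (\sum_(i <- r | P i) F i) y = \sum_(i <- r | P i) dot (F i) y.
Proof. by elim/big_rec2: _ => [|i y1 y2 _ <-]; rewrite ?dot0l ?dotDl. Qed.
Lemma dot_hnorm x : dot x x = of_real (hnorm x ^+ 2).
Proof. by rewrite -dot_norm hnormE expr2 -of_realM -expr2. Qed.

Lemma hnorm_pythagoras x y : dot x y = 0 -> hnorm (x + y) ^+ 2 = hnorm x ^+ 2 + hnorm y ^+ 2.
Proof.
move=> xy; apply: (@of_real_inj R k); rewrite of_realD -!dot_hnorm dotDl !dotDr xy.
rewrite (dotC y x) xy -of_real0 conj_of_real of_real0; ring.
Qed.

(** Cauchy-Schwarz, from Pythagoras for the projection of [x] onto the line of [y]. *)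
Lemma nrm_dot_le x y : nrm (dot x y) <= hnorm x * hnorm y.
Proof.
have [->|y0] := eqVneq y 0.
  by rewrite hnorm0 mulr0 dotC dot0l -of_real0 conj_of_real nrm_of_real normr0.
have n0 : 0 < hnorm y by rewrite lt_neqAle hnorm_ge0 eq_sym hnorm_eq0 y0.
pose c := of_real (hnorm y ^+ 2)^-1 * dot x y.
have p0 : dot (x - c *: y) (c *: y) = 0.
  rewrite dotZr dotBl dotZl dot_hnorm /c mulrAC -of_realM mulVf ?of_real1 ?mul1r ?subrr ?mulr0//.
  by rewrite gt_eqF// exprn_gt0.
have := hnorm_pythagoras p0; rewrite subrK => E.
have : hnorm (c *: y) ^+ 2 <= hnorm x ^+ 2 by rewrite E lerDr sqr_ge0.
rewrite ler_sqr ?nnegrE ?hnorm_ge0// hnormZ /c nrmM nrm_of_real gtr0_norm ?invr_gt0 ?exprn_gt0//.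
have -> : (hnorm y ^+ 2)^-1 * nrm (dot x y) * hnorm y = nrm (dot x y) / hnorm y.
  by field; rewrite gt_eqF.
by rewrite ler_pdivrMr.
Qed.

End InnerProduct.

(** * Expansions in a complete orthonormal system *)

Section FourierSeries.
Context {R : realType} {k : scalar_kind}.
Local Notation K := (scalar_field R k).
Context {H : completeNormedModType K}.
Variable dot : {dot H for conj_scalar k}.
Hypothesis dot_norm : forall x : H, `|x| ^+ 2 = dot x x.
Variable v : nat -> H.
Hypothesis v_complete : complete_orthonormal dot v.
Local Notation of_real := (@of_real R k).
Local Notation re := (@re_scalar R k).
Implicit Types (x y z : H) (c : nat -> K).

Definition square_summable c :=
  exists C : R, forall N, \sum_(0 <= n < N) nrm (c n) ^+ 2 <= C.

Lemma dot_basis i j : dot (v i) (v j) = (i == j)%:R.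
Proof. exact: v_complete.1. Qed.

Lemma dot_partial c m N i : dot (\sum_(m <= n < N) c n *: v n) (v i) =
  if (m <= i < N)%N then c i else 0.
Proof.
rewrite dot_suml; under eq_bigr do rewrite dotZl dot_basis.
case: ifP => iN.
  rewrite (bigD1_seq i) ?mem_index_iota ?iota_uniq//= eqxx mulr1 big1 ?addr0// => j /negbTE ->.
  by rewrite mulr0.
rewrite big_seq big1// => j; rewrite mem_index_iota => jN.
by case: eqP => [ji|]; rewrite ?mulr0//; rewrite -ji jN in iN.
Qed.

Lemma hnorm_basis n : hnorm (v n) = 1.
Proof.
apply/eqP; rewrite -(eqrXn2 (n := 2))// ?hnorm_ge0// expr1n; apply/eqP/(@of_real_inj R k).
by rewrite -(dot_hnorm dot_norm) dot_basis eqxx of_real1.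
Qed.

Lemma hnorm_partial c m N :
  hnorm (\sum_(m <= n < N) c n *: v n) ^+ 2 = \sum_(m <= n < N) nrm (c n) ^+ 2.
Proof.
have [mN|Nm] := leqP m N; last by rewrite !big_geq ?(ltnW Nm)// hnorm0 expr0n.
rewrite -(subnKC mN); elim: (N - m)%N => [|d IH]; first by rewrite addn0 !big_geq// hnorm0 expr0n.
rewrite addnS !big_nat_recr ?leq_addr//= -IH (hnorm_pythagoras dot_norm); last first.
  by rewrite dotZr dot_partial leq_addr ltnn mulr0.
by rewrite hnormZ hnorm_basis mulr1.
Qed.

Lemma square_summable_tail c e : square_summable c -> 0 < e ->
  exists N, forall m n, (N <= m)%N -> \sum_(m <= i < n) nrm (c i) ^+ 2 < e.
Proof.
move=> [C hC] e0.
have cc : cvgn (series (fun n => nrm (c n) ^+ 2)).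
  apply: nondecreasing_is_cvgn; last by exists C => _ [n _ <-]; exact: hC.
  by apply: nondecreasing_series => n _ _; exact: sqr_ge0.
have := cc; move/cauchy_cvgP/cauchy_seriesP/(_ e e0) => [[A B] /= [[NA _ hA] [NB _ hB]] h].
exists (maxn NA NB) => m n; rewrite geq_max => /andP[mA mB].
have [mn|nm] := leqP m n; last by rewrite big_geq// ltnW.
apply: le_lt_trans (ler_norm _) _; apply: (h (m, n)); split => /=; first exact: hA.
by apply: hB => /=; apply: leq_trans mn.
Qed.

Lemma dot_series_limit c x n :
  (\sum_(0 <= n < N) c n *: v n) @[N --> \oo] --> x -> dot x (v n) = c n.
Proof.
move=> Sx; apply/eqP; rewrite -subr_eq0 -nrm_eq0; apply/eqP/le_anti.
rewrite nrm_ge0 andbT; apply/ler_addgt0Pr => e e0; rewrite add0r.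
have [N _ hN] := (hnorm_cvgP _ _ _).1 Sx e e0.
have := hN (maxn N n.+1) (leq_maxl _ _); set S := \sum_(_ <= _ < _) _ => hS.
have <- : dot S (v n) = c n by rewrite dot_partial/= leq_maxr.
by rewrite -dotBl (le_trans (nrm_dot_le dot_norm _ _))// hnorm_basis mulr1 ltW.
Qed.

Lemma fourier_cvg c : square_summable c -> exists x,
  (\sum_(0 <= n < N) c n *: v n) @[N --> \oo] --> x /\ forall n, dot x (v n) = c n.
Proof.
move=> cc.
have S_cvg : cvgn (series (fun n => c n *: v n)).
  apply/cauchy_cvgP/cauchy_seriesP => e e0.
  have e1 : 0 < re e by rewrite -(@ltr_of_real R k) of_real0 of_real_re// ltW.
  have [N hN] := square_summable_tail cc (exprn_gt0 2 e1).
  exists ([set n | (N <= n)%N], setT); first by split; [exists N|exact: filterT].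
  move=> [m n] [/= Nm _]; have := hN m n Nm.
  rewrite -hnorm_partial ltr_sqr ?nnegrE ?hnorm_ge0 1?ltW// => h.
  by rewrite hnormE -(of_real_re (ltW e0)) ltr_of_real.
exists (limn (series (fun n => c n *: v n))); split => // n.
exact: (@dot_series_limit c _ n S_cvg).
Qed.

Lemma bessel x N : \sum_(0 <= n < N) nrm (dot x (v n)) ^+ 2 <= hnorm x ^+ 2.
Proof.
rewrite -hnorm_partial; set S := \sum_(_ <= _ < _) _.
have p : dot (x - S) S = 0.
  rewrite dotBl [X in X - _](_ : _ = of_real (hnorm S ^+ 2)); last first.
    rewrite -(dot_hnorm dot_norm) [LHS](dotC dot) [RHS](dotC dot); congr conj_scalar.
    rewrite {1}/S dot_suml [RHS]dot_suml; apply: eq_big_nat => n nN.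
    by rewrite !dotZl (dotC dot _ x) (dotC dot _ S) dot_partial nN.
  by rewrite (dot_hnorm dot_norm) subrr.
by have := hnorm_pythagoras dot_norm p; rewrite subrK => ->; rewrite lerDr sqr_ge0.
Qed.

Lemma fourier_summable x : square_summable (fun n => dot x (v n)).
Proof. by exists (hnorm x ^+ 2) => N; exact: bessel. Qed.

Lemma fourier_inj x y : (forall n, dot x (v n) = dot y (v n)) -> x = y.
Proof.
move=> xy; apply/eqP; rewrite -subr_eq0; apply/eqP; apply: v_complete.2 => n.
by rewrite dotBl xy subrr.
Qed.

Lemma fourier_exists c : square_summable c -> exists x, forall n, dot x (v n) = c n.
Proof. by move=> /fourier_cvg[x [_ hx]]; exists x. Qed.

Lemma fourier_series x : (\sum_(0 <= n < N) dot x (v n) *: v n) @[N --> \oo] --> x.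
Proof.
by have [y [Sy /fourier_inj yx]] := fourier_cvg (fourier_summable x); rewrite -{2}yx.
Qed.

Lemma hnorm_fourier_le x (C : R) : 0 <= C ->
  (forall N, \sum_(0 <= n < N) nrm (dot x (v n)) ^+ 2 <= C ^+ 2) -> hnorm x <= C.
Proof.
move=> C0 hC; apply/ler_addgt0Pr => e e0.
have [N _ hN] := (hnorm_cvgP _ _ _).1 (@fourier_series x) e e0.
have := hN N (leqnn _); set S := \sum_(_ <= _ < _) _ => hS.
rewrite -[x](subrK S) addrC (le_trans (ler_hnormD _ _))// lerD//; last exact: ltW.
by rewrite -ler_sqr ?nnegrE ?hnorm_ge0// hnorm_partial.
Qed.

(** Only the terms from [N0] on are compared, which leaves finitely many free; this accommodates the
    finite set [K_0]. *)
Lemma square_summable_le c c' (C : R) N0 : square_summable c ->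
  (forall n, (N0 <= n)%N -> nrm (c' n) <= C * nrm (c n)) -> square_summable c'.
Proof.
move=> [B hB] hc'.
have B0 : 0 <= B by have := hB 0%N; rewrite big_nil.
exists (\sum_(0 <= n < N0) nrm (c' n) ^+ 2 + C ^+ 2 * B) => N.
have h n : nrm (c' n) ^+ 2 <= (if (n < N0)%N then nrm (c' n) ^+ 2 else 0) + C ^+ 2 * nrm (c n) ^+ 2.
  case: ltnP => nN; first by rewrite lerDl mulr_ge0 ?sqr_ge0.
  rewrite add0r -exprMn; apply: lerXn2r; rewrite ?nnegrE ?nrm_ge0 ?hc'//.
  by apply: le_trans (hc' n nN); exact: nrm_ge0.
apply: (le_trans (ler_sum _ (fun n _ => h n))).
rewrite big_split/= -mulr_sumr; apply: lerD; last by rewrite ler_wpM2l ?sqr_ge0.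
rewrite -big_mkcond/=.
have [NN0|N0N] := leqP N N0.
  apply: (@le_trans _ _ (\sum_(0 <= n < N) nrm (c' n) ^+ 2)).
    by rewrite big_mkcond/=; apply: ler_sum => n _; case: ifP => // _; exact: sqr_ge0.
  rewrite [leRHS](@big_cat_nat _ _ _ N 0 N0)//= lerDl; apply: sumr_ge0 => *; exact: sqr_ge0.
rewrite (@big_cat_nat _ _ _ N0 0 N)//= 1?ltnW// addrC big_nat_cond big1 ?add0r.
  by rewrite big_mkcond/=; apply: ler_sum => n _; case: ifP => // _; exact: sqr_ge0.
by move=> n /andP[/andP[Nn _]]; rewrite ltnNge Nn.
Qed.

(** Dominated convergence for multipliers. The filter is arbitrary, so that continuity, difference
    quotients and sequences of simple functions are all covered. *)
Lemma hnorm_dominated (I : Type) (F : set_system I) (FF : Filter F) (y : I -> H) c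
    (a : nat -> I -> R) (C : R) : square_summable c ->
    (forall i n, dot (y i) (v n) = c n * of_real (a n i)) ->
    (\forall i \near F, forall n, `|a n i| <= C) ->
    (forall n, a n i @[i --> F] --> (0 : R)) ->
  y @ F --> (0 : H).
Proof.
move=> cc yE aC a0; apply/hnorm_cvgP => e e0.
have C1 : 0 < `|C| + 1 by rewrite ltr_wpDl.
have e2 : 0 < (e / 2) ^+ 2 by rewrite exprn_gt0 ?divr_gt0.
(* The tail from [N] on, with the squared bound on [a], takes half of [(e / 2)^2]; the finite head,
   which tends to 0, takes the other half. *)
have [N hN] := square_summable_tail cc (divr_gt0 (divr_gt0 e2 (ltr0n _ 2)) (exprn_gt0 2 C1)).
have hsum : \sum_(0 <= n < N) nrm (c n) ^+ 2 * a n i ^+ 2 @[i --> F] -->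
    \sum_(0 <= n < N) nrm (c n) ^+ 2 * (0 * 0 : R).
  apply: cvg_big => [|n _]; first exact: add_continuous.
  by apply: cvgM; [exact: cvg_cst|under eq_fun do rewrite expr2; apply: cvgM; exact: a0].
rewrite big1 in hsum => [|n _]; last by rewrite !mulr0.
have /cvgrPdist_lt/(_ _ (divr_gt0 e2 (ltr0n _ 2))) := hsum.
apply: filterS2 aC => i hi; rewrite sub0r normrN => /(le_lt_trans (ler_norm _)) hs.
rewrite sub0r hnormN; apply: (@le_lt_trans _ _ (e / 2)); last lra.
apply: hnorm_fourier_le; first by rewrite divr_ge0// ltW.
move=> M.
have -> : \sum_(0 <= n < M) nrm (dot (y i) (v n)) ^+ 2 = \sum_(0 <= n < M) nrm (c n) ^+ 2 * a n i ^+ 2.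
  by apply: eq_bigr => n _; rewrite yE nrmM nrm_of_real exprMn real_normK ?num_real.
have p0 n : 0 <= nrm (c n) ^+ 2 * a n i ^+ 2 by rewrite mulr_ge0 ?sqr_ge0.
apply: (@le_trans _ _ (\sum_(0 <= n < maxn N M) nrm (c n) ^+ 2 * a n i ^+ 2)).
  by rewrite [leRHS](@big_cat_nat _ _ _ M)//= ?leq_maxr// lerDl sumr_ge0.
rewrite (@big_cat_nat _ _ _ N)//= ?leq_maxl// (splitr ((e / 2) ^+ 2)) lerD//; first exact: ltW.
have := hN N (maxn N M) (leqnn _); rewrite ltr_pdivlMr ?exprn_gt0// => /ltW; apply: le_trans.
rewrite mulr_suml; apply: ler_sum => n _; apply: ler_wpM2l; first exact: sqr_ge0.
rewrite -[X in X <= _]real_normK ?num_real//; apply: lerXn2r; rewrite ?nnegrE ?(ltW C1)//.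
by apply: (le_trans (hi n)); rewrite (le_trans (ler_norm C))// lerDl.
Qed.

(** Turns the convergent series of the two assertions into identities between coefficients. *)
Lemma expansion_onP (P : set nat) c x : expansion_on v P c x <->
  forall n, dot x (v n) = if n \in P then c n else 0.
Proof.
pose c' n := if n \in P then c n else 0.
have E N : \sum_(0 <= n < N | n \in P) c n *: v n = \sum_(0 <= n < N) c' n *: v n.
  by rewrite big_mkcond/=; apply: eq_bigr => n _; rewrite /c'; case: ifP => // _; rewrite scale0r.
rewrite /expansion_on; under eq_fun do rewrite E; split=> [Sx n|hx]; last first.
  by under eq_fun do under eq_bigr do rewrite /c' -hx; exact: fourier_series.
exact: (@dot_series_limit c' x n Sx).
Qed.

End FourierSeries.

(** * The operator in its eigenbasis *)

Section DiagonalOperator.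
Context {R : realType} {k : scalar_kind}.
Local Notation K := (scalar_field R k).
Context {H : completeNormedModType K}.
Variable dot : {dot H for conj_scalar k}.
Hypothesis dot_norm : forall x : H, `|x| ^+ 2 = dot x x.
Variables (v : nat -> H) (D : set H) (A : H -> H) (lam : nat -> R).
Hypothesis v_complete : complete_orthonormal dot v.
Hypothesis A_self_adjoint : self_adjoint dot D A.
Hypothesis v_eigen : forall n, D (v n) /\ A (v n) = of_real k (lam n) *: v n.

Lemma dot_eigen x n : D x -> dot (A x) (v n) = of_real k (lam n) * dot x (v n).
Proof.
case: A_self_adjoint => _ _ adj Dx.
have /(_ x Dx) := (adj (v n) _).2 (v_eigen n).
by rewrite dotZr conj_of_real.
Qed.

(** By self-adjointness it suffices that [dot (A z) x = dot z y] for [z] in [D]. This is exact for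
    the partial sums of [x] and [y], and Cauchy-Schwarz passes to the limit. *)
Lemma diagonal_domain x y : (forall n, dot y (v n) = of_real k (lam n) * dot x (v n)) ->
  D x /\ A x = y.
Proof.
case: A_self_adjoint => _ _ adj xy; apply/adj => z Dz.
apply/eqP; rewrite -subr_eq0 -nrm_eq0; apply/eqP/le_anti.
rewrite nrm_ge0 andbT; apply/ler_addgt0Pr => e e0; rewrite add0r.
have c1 : 0 < hnorm (A z) + hnorm z + 1 by rewrite ltr_wpDl// addr_ge0 ?hnorm_ge0.
have d0 := divr_gt0 e0 c1.
have [N1 _ h1] := (hnorm_cvgP _ _ _).1 (@fourier_series _ _ _ _ dot_norm _ v_complete x) _ d0.
have [N2 _ h2] := (hnorm_cvgP _ _ _).1 (@fourier_series _ _ _ _ dot_norm _ v_complete y) _ d0.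
pose N := maxn N1 N2.
have := h1 N (leq_maxl _ _); have := h2 N (leq_maxr _ _) => /=.
set S := \sum_(_ <= _ < _) _; set S' := \sum_(_ <= _ < _) _ => hS hS'.
have E : dot (A z) S' = dot z S.
  rewrite (dotC dot _ S') (dotC dot z S) !dot_suml; congr conj_scalar.
  apply: eq_bigr => n _; rewrite !dotZl xy (dotC dot _ (A z)) dot_eigen// conj_scalarM conj_of_real.
  by rewrite -(dotC dot); ring.
have -> : dot (A z) x - dot z y = dot (A z) (x - S') - dot z (y - S).
  by rewrite !dotBr E; ring.
have trn (p q : scalar_field R k) : nrm (p - q) <= nrm p + nrm q.
  by rewrite -(@ler_of_real R k) of_realD -!nrmE ler_normB.
apply: (le_trans (trn _ _)).
apply: (@le_trans _ _ (hnorm (A z) * (e / (hnorm (A z) + hnorm z + 1)) +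
    hnorm z * (e / (hnorm (A z) + hnorm z + 1)))).
  by apply: lerD; apply: (le_trans (nrm_dot_le dot_norm _ _)); apply: ler_wpM2l;
    rewrite ?hnorm_ge0// ltW.
rewrite -mulrDl mulrA ler_pdivrMr// mulrC ler_wpM2l ?(ltW e0)//; lra.
Qed.
End DiagonalOperator.

(** * Bochner integrals of expansions *)

Section MonotoneIntegral.
Context {d : measure_display} {T : measurableType d} {R : realType}.
Variable mu : {measure set T -> \bar R}.

(* In the definition of the Bochner integral the norm of the difference need not be measurable. *)
Lemma ge0_le_integral_nonmeasurable (D : set T) (f g : T -> \bar R) :
  (forall x, D x -> 0 <= f x)%E -> (forall x, D x -> f x <= g x)%E ->
  (\int[mu]_(x in D) f x <= \int[mu]_(x in D) g x)%E.
Proof.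
move=> f0 fg; rewrite !ge0_integralE//; last by move=> x Dx; exact: le_trans (f0 x Dx) (fg x Dx).
apply: ub_ereal_sup => _ [h hf <-]; apply: ereal_sup_ubound; exists h => // x.
apply: (le_trans (hf x)); rewrite !patchE; case: ifPn => //; rewrite inE; exact: fg.
Qed.
End MonotoneIntegral.

Section StepFunctions.
Context {R : realType}.
Local Notation mu := (@lebesgue_measure R).

Lemma step_integral (S : set R) m (E : 'I_m -> set R) (a : 'I_m -> R) : measurable S ->
  (forall i, measurable (E i)) -> (forall i, mu (E i) < +oo)%E ->
  mu.-integrable S (EFin \o (fun x => \sum_(i < m) \1_(E i) x * a i)) /\
  \int[mu]_(x in S) (\sum_(i < m) \1_(E i) x * a i) = \sum_(i < m) fine (mu (E i `&` S)) * a i.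
Proof.
move=> mS mE Efin.
have fin i : (mu (E i `&` S) < +oo)%E.
  apply: le_lt_trans (Efin i); apply: le_measure; [|rewrite inE; exact: mE|exact: subIsetl].
  by rewrite inE; apply: measurableI; [exact: mE|exact: mS].
pose f (i : 'I_m) x : \bar R := ((a i)%:E * (\1_(E i) x)%:E)%E.
have i1 i : mu.-integrable S (fun x => (\1_(E i) x)%:E).
  apply/integrableP; split.
    by apply/measurable_EFinP; apply: measurable_indic; exact: mE.
  under eq_integral do rewrite gee0_abs ?lee_fin//.
  by rewrite integral_indic; [exact: fin|exact: mS|exact: mE].
have fi i : mu.-integrable S (f i) by exact: integrableZl.
have sE : (EFin \o (fun x => \sum_(i < m) \1_(E i) x * a i)) = fun x => \sum_(i < m) f i x.
  by apply/funext => x; rewrite /= -sumEFin; apply: eq_bigr => i _; rewrite /f -EFinM mulrC.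
split; first by rewrite sE; exact: integrable_sum.
rewrite /Rintegral; under eq_integral => x _ do rewrite -/((EFin \o (fun x => \sum_(i < m) \1_(E i) x * a i)) x) sE.
rewrite integral_sum// -sum_fine; last by move=> i _; exact: integrable_fin_num.
apply: eq_bigr => i _; rewrite /f integralZl// fineM//.
  by rewrite integral_indic; [rewrite mulrC|exact: mS|exact: mE].
by rewrite integral_indic; [rewrite ge0_fin_numE//; exact: fin|exact: mS|exact: mE].
Qed.
End StepFunctions.

(** * Bochner integrals tested by scalar products *)

Section BochnerPairing.
Context {R : realType} {k : scalar_kind}.
Local Notation K := (scalar_field R k).
Context {H : completeNormedModType K}.
Variable dot : {dot H for conj_scalar k}.
Hypothesis dot_norm : forall x : H, `|x| ^+ 2 = dot x x.
Local Notation mu := (@lebesgue_measure R).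
Implicit Types (S : set R) (F s : R -> H) (w x y z : H).

(** The real part reduces Bochner integrals to real Lebesgue integrals for both scalar fields. *)
Definition redot x y : R := re_scalar k (dot x y).

Lemma redotB x z y : redot (x - z) y = redot x y - redot z y.
Proof. by rewrite /redot dotBl reB. Qed.
Lemma redotD x z y : redot (x + z) y = redot x y + redot z y.
Proof. by rewrite /redot dotDl reD. Qed.
Lemma redotZ a x y : redot (of_real k a *: x) y = a * redot x y.
Proof. by rewrite /redot dotZl re_of_realM. Qed.
Lemma redot_sum (I : Type) (r : seq I) (P : pred I) (F : I -> H) y :
  redot (\sum_(i <- r | P i) F i) y = \sum_(i <- r | P i) redot (F i) y.
Proof.
by elim/big_rec2: _ => [|i y1 y2 _ <-]; rewrite ?redotD// /redot dot0l re0.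
Qed.
Lemma redot_le x y : hnorm y <= 1 -> `|redot x y| <= hnorm x.
Proof.
move=> y1; apply: (le_trans (re_le_nrm _)); apply: (le_trans (nrm_dot_le dot_norm _ _)).
by rewrite ler_piMr ?hnorm_ge0.
Qed.

Lemma simple_integral_pairing S s w y : measurable S -> simple_integral S s w ->
  mu.-integrable S (EFin \o (fun x : R => redot (s x) y)) /\
  \int[mu]_(x in S) redot (s x) y = redot w y.
Proof.
move=> mS [m [E [c [mE Efin sE ->]]]].
have := step_integral (fun i => redot (c i) y) mS mE Efin.
have -> : (fun x : R => redot (s x) y) = fun x : R => \sum_(i < m) \1_(E i) x * redot (c i) y.
  by apply/funext => x; rewrite sE redot_sum; apply: eq_bigr => i _; rewrite redotZ.
by move=> [? ->]; split => //; rewrite redot_sum; apply: eq_bigr => i _; rewrite redotZ.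
Qed.

(** Pairing with [y] does not increase norms, so the real step functions [redot (s n x) y] converge
    in mean to [redot (F x) y], and their integrals converge to [redot w y]. *)
Lemma bochner_pairing S F w y : measurable S -> bochner_integral S F w -> hnorm y <= 1 ->
    measurable_fun S (fun x : R => redot (F x) y) ->
  mu.-integrable S (EFin \o (fun x : R => redot (F x) y)) /\
  \int[mu]_(x in S) redot (F x) y = redot w y.
Proof.
move=> mS [s [I [hs _ hcvg hI]]] y1 mF.
have mS' : measurable (S : set (measurableTypeR R)) by exact: mS.
pose f (x : R) := redot (F x) y; pose fn n (x : R) := redot (s n x) y.
have fni n := (simple_integral_pairing y mS (hs n)).1.
have fnE n := (simple_integral_pairing y mS (hs n)).2.
have mfn n : measurable_fun S (fn n) by apply/measurable_EFinP; case/integrableP: (fni n).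
have md n : measurable_fun S (fun x : R => f x - fn n x) by exact: measurable_funB.
have dle n : (\int[mu]_(x in S) `|f x - fn n x|%R%:E <=
    \int[mu]_(x in S) (re_scalar k `|F x - s n x|)%:E)%E.
  apply: ge0_le_integral_nonmeasurable => x _; rewrite lee_fin//.
  by rewrite /f /fn -redotB redot_le.
have small e : 0 < e -> \forall n \near \oo, (\int[mu]_(x in S) `|f x - fn n x|%R%:E < e%:E)%E.
  move=> e0; move/fine_cvgP: hcvg => [fin /cvgrPdist_lt/(_ e e0)].
  apply: filterS2 fin => n nfin; rewrite sub0r normrN => h.
  apply: (le_lt_trans (dle n)); rewrite -(fineK nfin) lte_fin.
  exact: le_lt_trans (ler_norm _) h.
have di n e : (\int[mu]_(x in S) `|f x - fn n x|%R%:E < e%:E)%E ->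
    mu.-integrable S (EFin \o (fun x : R => f x - fn n x)).
  move=> h; apply/integrableP; split; first by apply/measurable_EFinP; exact: md.
  by apply: (le_lt_trans _ (ltry e)); exact: ltW.
have fi : mu.-integrable S (EFin \o f).
  have [N _ hN] := small 1 ltr01.
  have J := di N 1 (hN N (leqnn N)).
  have J2 : mu.-integrable S (fun x : R => (f x - fn N x)%R%:E + (fn N x)%:E)%E.
    exact: (integrableD mS' J (fni N)).
  by apply: eq_integrable J2 => // x _ /=; rewrite -EFinD subrK.
split => //; apply/eqP; rewrite -subr_eq0 -normr_eq0; apply/eqP/le_anti.
rewrite normr_ge0 andbT; apply/ler_addgt0Pr => e e0; rewrite add0r.
have e2 : 0 < e / 2 by rewrite divr_gt0.
have [n [h1 h2]] : exists n, (\int[mu]_(x in S) `|f x - fn n x|%R%:E < (e / 2)%:E)%E /\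
    hnorm (w - I n) < e / 2.
  have [N1 _ h1] := small _ e2; have [N2 _ h2] := (hnorm_cvgP _ _ _).1 hI _ e2.
  by exists (maxn N1 N2); split; [apply: h1; exact: leq_maxl|apply: h2; exact: leq_maxr].
have -> : \int[mu]_(x in S) redot (F x) y - redot w y =
    \int[mu]_(x in S) (f x - fn n x) - redot (w - I n) y.
  by rewrite (RintegralB mS' fi (fni n)) fnE redotB opprB addrA subrK.
apply: (le_trans (ler_normB _ _)); rewrite [leRHS]splitr lerD//; last first.
  by apply: ltW; apply: le_lt_trans h2; exact: redot_le.
have J := di n _ h1.
apply: (le_trans (le_normr_Rintegral mS' J)).
rewrite -lee_fin /Rintegral fineK; first exact: ltW.
by rewrite ge0_fin_numE ?(lt_trans h1) ?ltry//; apply: integral_ge0 => x _; rewrite lee_fin.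
Qed.
End BochnerPairing.

(** * Simple functions with values in the Hilbert space *)

Section SimpleIntegral.
Import HBNNSimple.
Context {R : realType} {k : scalar_kind}.
Local Notation K := (scalar_field R k).
Context {H : completeNormedModType K}.
Local Notation mu := (@lebesgue_measure R).
Implicit Types (S : set R) (s : R -> H) (w h : H).

Lemma simple_integral0 S : simple_integral S (fun=> 0 : H) 0.
Proof.
by exists 0%N, (fun=> set0), (fun=> 0); split => [[]|[]|x|]//; rewrite big_ord0.
Qed.

Lemma simple_integralD S s1 s2 w1 w2 : simple_integral S s1 w1 -> simple_integral S s2 w2 ->
  simple_integral S (fun x => s1 x + s2 x) (w1 + w2).
Proof.
move=> [m1 [E1 [c1 [mE1 fE1 sE1 ->]]]] [m2 [E2 [c2 [mE2 fE2 sE2 ->]]]].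
exists (m1 + m2)%N, (fun i => match fintype.split i with inl j => E1 j | inr j => E2 j end),
  (fun i => match fintype.split i with inl j => c1 j | inr j => c2 j end); split.
- by move=> i; case: fintype.split => j.
- by move=> i; case: fintype.split => j.
- move=> x; rewrite sE1 sE2 big_split_ord/=.
  by congr (_ + _); apply: eq_bigr => i _; rewrite ?(unsplitK (inl i)) ?(unsplitK (inr i)).
- rewrite big_split_ord/=.
  by congr (_ + _); apply: eq_bigr => i _; rewrite ?(unsplitK (inl i)) ?(unsplitK (inr i)).
Qed.

Lemma simple_integral_sum S (s : nat -> R -> H) (w : nat -> H) N :
  (forall n, simple_integral S (s n) (w n)) ->
  simple_integral S (fun x => \sum_(0 <= n < N) s n x) (\sum_(0 <= n < N) w n).
Proof.
move=> hs; elim: N => [|N IH].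
  rewrite big_geq//; have -> : (fun x => \sum_(0 <= n < 0) s n x) = fun=> 0.
    by apply/funext => x; rewrite big_geq.
  exact: simple_integral0.
rewrite big_nat_recr//=; have -> : (fun x => \sum_(0 <= n < N.+1) s n x) =
    fun x => \sum_(0 <= n < N) s n x + s N x.
  by apply/funext => x; rewrite big_nat_recr.
exact: simple_integralD.
Qed.

Lemma simple_integral_nnsfun S (f : {nnsfun (measurableTypeR R) >-> R}) h : measurable S ->
  (mu S < +oo)%E -> exists w, simple_integral S (fun x => of_real k (f x * \1_S x) *: h) w.
Proof.
move=> mS Sfin; set r := finmap.enum_fset (fset_set (range f)).
pose E (i : 'I_(size r)) := f @^-1` [set r`_i] `&` S.
have mE i : measurable (E i : set (measurableTypeR R)).
  by apply: measurableI; [rewrite -[X in measurable X]setTI; exact: measurable_funP|exact: mS].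
exists (\sum_(i < size r) of_real k (fine (mu (E i `&` S))) *: (of_real k r`_i *: h)).
exists (size r), E, (fun i => of_real k r`_i *: h); split => //.
- move=> i; apply: le_lt_trans Sfin; apply: le_measure; [|rewrite inE; exact: mS|exact: subIsetr].
  by rewrite inE; exact: mE.
- move=> x; rewrite {1}fimfunEord mulr_suml of_real_sum scaler_suml; apply: eq_bigr => i _.
  rewrite scalerA -of_realM; congr (of_real k _ *: h).
  by rewrite /E indicI/=; ring.
Qed.

(** Differences of approximations of the positive and negative parts. They do not exceed [|f|], so
    every majorant of [f] serves them too, and one scalar sequence serves every vector [h]. *)
Lemma step_approximation S (f : R -> R) : measurable S -> (mu S < +oo)%E -> measurable_fun S f ->
  exists sg : nat -> R -> R, [/\
    forall N h, exists w, simple_integral S (fun x => of_real k (sg N x) *: h) w,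
    forall N x, S x -> `|sg N x| <= `|f x| &
    forall x, S x -> sg N x @[N --> \oo] --> f x].
Proof.
move=> mS Sfin mf.
have mS' : measurable (S : set (measurableTypeR R)) by exact: mS.
have mp : measurable_fun (S : set (measurableTypeR R)) (EFin \o f^\+).
  by apply/measurable_EFinP; exact: measurable_funrpos.
have mn : measurable_fun (S : set (measurableTypeR R)) (EFin \o f^\-).
  by apply/measurable_EFinP; exact: measurable_funrneg.
pose p N := nnsfun_approx mS' mp N; pose n N := nnsfun_approx mS' mn N.
have p_cvg x : S x -> p N x @[N --> \oo] --> f^\+ x.
  move=> Sx; have f0 y : S y -> (0 <= (EFin \o (f^\+)%R) y)%E by rewrite lee_fin funrpos_ge0.
  by have /fine_cvgP[] := cvg_nnsfun_approx mS' mp f0 Sx.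
have n_cvg x : S x -> n N x @[N --> \oo] --> f^\- x.
  move=> Sx; have f0 y : S y -> (0 <= (EFin \o (f^\-)%R) y)%E by rewrite lee_fin funrneg_ge0.
  by have /fine_cvgP[] := cvg_nnsfun_approx mS' mn f0 Sx.
have p_le N x : S x -> p N x <= f^\+ x.
  move=> Sx; rewrite -(cvg_lim _ (p_cvg x Sx))//.
  apply: (@nondecreasing_cvgn_le _ (fun N => p N x)); last by apply/cvg_ex; eexists; exact: p_cvg.
  by move=> a b ab; have /lefP := nd_nnsfun_approx mS' mp ab; exact.
have n_le N x : S x -> n N x <= f^\- x.
  move=> Sx; rewrite -(cvg_lim _ (n_cvg x Sx))//.
  apply: (@nondecreasing_cvgn_le _ (fun N => n N x)); last by apply/cvg_ex; eexists; exact: n_cvg.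
  by move=> a b ab; have /lefP := nd_nnsfun_approx mS' mn ab; exact.
exists (fun N x => (p N x - n N x) * \1_S x); split.
- move=> N h; have [w1 h1] := simple_integral_nnsfun (p N) h mS Sfin.
  have [w2 h2] := simple_integral_nnsfun (n N) (- h) mS Sfin.
  exists (w1 + w2); have := simple_integralD h1 h2.
  congr simple_integral; apply/funext => x.
  by rewrite scalerN -scalerBl -of_realB mulrBl.
- move=> N x Sx; rewrite indicE mem_set// mulr1.
  have aux (a b c : R) : 0 <= a -> 0 <= b -> a <= Num.max c 0 -> b <= Num.max (- c) 0 ->
      `|a - b| <= `|c|.
    case: (leP 0 c) => c0.
      rewrite (_ : Num.max (- c) 0 = 0); last by apply/max_idPr; lra.
      by rewrite (ger0_norm c0) => *; rewrite ler_norml; apply/andP; split; lra.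
    rewrite (_ : Num.max (- c) 0 = - c); last by apply/max_idPl; lra.
    by rewrite (ltr0_norm c0) => *; rewrite ler_norml; apply/andP; split; lra.
  exact: (aux _ _ _ (@fun_ge0 _ _ (p N) x) (@fun_ge0 _ _ (n N) x) (p_le N x Sx) (n_le N x Sx)).
- move=> x Sx; have -> : (fun N => (p N x - n N x) * \1_S x) = fun N => p N x - n N x.
    by apply/funext => N; rewrite indicE mem_set// mulr1.
  rewrite [X in _ --> X](_ : _ = f^\+ x - f^\- x).
    by apply: cvgB; [exact: p_cvg|exact: n_cvg].
  have aux (c : R) : c = Num.max c 0 - Num.max (- c) 0.
    case: (leP 0 c) => c0; first by rewrite (_ : Num.max (- c) 0 = 0) ?subr0//; apply/max_idPr; lra.
    by rewrite (_ : Num.max (- c) 0 = - c) ?sub0r ?opprK//; apply/max_idPl; lra.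
  exact: aux.
Qed.
End SimpleIntegral.

(** * Bochner integration mode by mode *)

Section BochnerExpansion.
Context {R : realType} {k : scalar_kind}.
Local Notation K := (scalar_field R k).
Context {H : completeNormedModType K}.
Variable dot : {dot H for conj_scalar k}.
Hypothesis dot_norm : forall x : H, `|x| ^+ 2 = dot x x.
Variable v : nat -> H.
Hypothesis v_complete : complete_orthonormal dot v.
Local Notation mu := (@lebesgue_measure R).
Local Notation of_real := (@of_real R k).
Local Notation re := (@re_scalar R k).
Local Notation redot := (redot dot).

Lemma redot_basis (w : H) n (b : K) : redot w (b *: v n) = re (conj_scalar k b * dot w (v n)).
Proof. by rewrite /redot dotZr. Qed.

Lemma hnorm_unit n (b : K) : nrm b <= 1 -> hnorm (b *: v n) <= 1.
Proof. by rewrite hnormZ (hnorm_basis dot_norm v_complete) mulr1. Qed.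

Lemma redot_coef (w : H) n (z : K) :
  (forall b, nrm b <= 1 -> redot w (b *: v n) = re (conj_scalar k b * z)) -> dot w (v n) = z.
Proof.
move=> hz; apply/eqP; rewrite -subr_eq0; apply/eqP/re_unit_eq0 => b b1.
rewrite mulrBr reB -[b](conj_scalarK b) -redot_basis hz ?nrm_conj// subrr//.
Qed.

(** Exhibits the squared norm as a limit of finite sums of coefficients, from which its
    measurability follows. *)
Lemma parseval (x : H) : \sum_(0 <= n < N) nrm (dot x (v n)) ^+ 2 @[N --> \oo] --> hnorm x ^+ 2.
Proof.
have F := @fourier_series _ _ _ _ dot_norm _ v_complete x.
have hS : hnorm (\sum_(0 <= n < N) dot x (v n) *: v n) @[N --> \oo] --> hnorm x.
  apply/cvgrPdist_lt => e e0; apply: filterS ((hnorm_cvgP _ _ _).1 F e e0) => N.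
  apply: le_lt_trans.
  set S := \sum_(_ <= _ < _) _; rewrite ler_norml; apply/andP; split.
    have := ler_hnormD (S - x) x; rewrite subrK -opprB hnormN; lra.
  by have := ler_hnormD (x - S) S; rewrite subrK; lra.
have -> : (fun N => \sum_(0 <= n < N) nrm (dot x (v n)) ^+ 2) = fun N =>
    hnorm (\sum_(0 <= n < N) dot x (v n) *: v n) * hnorm (\sum_(0 <= n < N) dot x (v n) *: v n).
  by apply/funext => N; rewrite -expr2 (hnorm_partial dot_norm v_complete).
by rewrite expr2; exact: cvgM.
Qed.

(** [G] majorizes all modes at once. Hence [hnorm_dominated] gives the convergence of the simple
    functions at each point and of their integrals, and dominated convergence the convergence in
    mean. *)
Lemma bochner_expansion (S : set R) (F : R -> H) (c : nat -> K) (phi : nat -> R -> R) (G : R -> R) :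
    measurable S -> (mu S < +oo)%E -> square_summable c ->
    (forall x, S x -> forall n, dot (F x) (v n) = c n * of_real (phi n x)) ->
    (forall n, measurable_fun S (phi n)) ->
    (forall n x, S x -> `|phi n x| <= G x) -> mu.-integrable S (EFin \o G) ->
  exists w, bochner_integral S F w /\
    forall n, dot w (v n) = c n * of_real (\int[mu]_(x in S) phi n x).
Proof.
move=> mS Sfin cc hF mphi phiG iG.
have mS' : measurable (S : set (measurableTypeR R)) by exact: mS.
have G0 x : S x -> 0 <= G x by move=> Sx; exact: le_trans (normr_ge0 _) (phiG 0%N x Sx).
have /choice[sg hsg] : forall n, exists sg : nat -> R -> R, [/\
    forall N h, exists w, simple_integral S (fun x => of_real (sg N x) *: (h : H)) w,
    forall N x, S x -> `|sg N x| <= `|phi n x| &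
    forall x, S x -> sg N x @[N --> \oo] --> phi n x].
  by move=> n; exact: step_approximation.
have sgi n N : mu.-integrable S (EFin \o sg n N).
  have [h _ _] := hsg n; have [w hw] := h N (v 0%N).
  have := (simple_integral_pairing dot (v 0%N) mS hw).1.
  apply: eq_integrable => // x _ /=; congr EFin.
  by rewrite redotZ /redot (dot_basis v_complete) eqxx -of_real1 re_of_real mulr1.
have msg n N : measurable_fun S (sg n N) by apply/measurable_EFinP; case/integrableP: (sgi n N).
have phi_i n : mu.-integrable S (EFin \o phi n).
  apply: le_integrable iG => //; first by apply/measurable_EFinP; exact: mphi.
  by move=> x Sx /=; rewrite lee_fin (ger0_norm (G0 x Sx)); exact: phiG.
(* A diagonal choice: [N] is both the number of modes and the index of the approximation in each
   mode, which leaves a finite sum of simple functions. *)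
pose s N (x : R) := \sum_(0 <= n < N) of_real (sg n N x) *: (c n *: v n).
have /choice[I hI] : forall N, exists w, simple_integral S (s N) w.
  move=> N; have /choice[w hw] : forall n, exists w,
      simple_integral S (fun x => of_real (sg n N x) *: (c n *: v n)) w.
    by move=> n; have [h _ _] := hsg n; exact: h.
  by exists (\sum_(0 <= n < N) w n); exact: simple_integral_sum.
have sE N x n : dot (s N x) (v n) = c n * of_real (if (n < N)%N then sg n N x else 0).
  have -> : s N x = \sum_(0 <= m < N) (c m * of_real (sg m N x)) *: v m.
    by apply: eq_bigr => m _; rewrite scalerA mulrC.
  by rewrite (dot_partial v_complete)/=; case: ifP => // _; rewrite of_real0 mulr0.
have IE N n : dot (I N) (v n) = c n * of_real (if (n < N)%N then \int[mu]_(x in S) sg n N x else 0).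
  apply: redot_coef => b b1.
  rewrite -(simple_integral_pairing dot _ mS (hI N)).2.
  rewrite [in RHS]mulrA [in RHS]mulrC re_of_realM.
  transitivity (\int[mu]_(x in S) ((if (n < N)%N then sg n N x else 0) * re (conj_scalar k b * c n))).
    apply: eq_Rintegral => x _; rewrite redot_basis sE [X in re X]mulrA [X in re X]mulrC.
    by rewrite re_of_realM.
  case: ifP => _; first by rewrite RintegralZr.
  by rewrite mul0r Rintegral_cst// mul0r.
pose J := \int[mu]_(x in S) G x.
have J0 : 0 <= J by apply: Rintegral_ge0 => x; exact: G0.
have phiJ n : `|\int[mu]_(x in S) phi n x| <= J.
  apply: (le_trans (le_normr_Rintegral mS' (phi_i n))).
  by apply: le_Rintegral => //; [exact: (integrable_norm (phi_i n))|move=> x Sx; exact: phiG].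
have sgJ n N : `|\int[mu]_(x in S) sg n N x| <= J.
  apply: (le_trans (le_normr_Rintegral mS' (sgi n N))).
  apply: le_Rintegral => //; first exact: (integrable_norm (sgi n N)).
  by move=> x Sx; have [_ h _] := hsg n; exact: le_trans (h N x Sx) (phiG n x Sx).
have [w hw] : exists w, forall n, dot w (v n) = c n * of_real (\int[mu]_(x in S) phi n x).
  apply: (fourier_exists dot_norm v_complete).
  apply: (@square_summable_le _ _ c _ J 0%N) cc _ => n _.
  by rewrite nrmM nrm_of_real mulrC ler_wpM2r ?nrm_ge0.
pose a n N x := phi n x - if (n < N)%N then sg n N x else 0.
have aE N x n : S x -> dot (F x - s N x) (v n) = c n * of_real (a n N x).
  by move=> Sx; rewrite dotBl hF// sE of_realB mulrBr.
have aG n N x : S x -> `|a n N x| <= 2 * G x.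
  move=> Sx; apply: (le_trans (ler_normB _ _)); rewrite mulr_natl mulr2n lerD ?phiG//.
  case: ifP => _; last by rewrite normr0; exact: G0.
  by have [_ h _] := hsg n; exact: le_trans (h N x Sx) (phiG n x Sx).
have s_cvg x : S x -> (fun N => F x - s N x) @ \oo --> (0 : H).
  move=> Sx; apply: (@hnorm_dominated _ _ _ _ dot_norm _ v_complete _ _ _ _ c
      (fun n N => a n N x) (2 * G x) cc).
  - by move=> N n; exact: aE.
  - by apply: nearW => N n; exact: aG.
  - move=> n; rewrite -(subrr (phi n x)); apply: cvgB; first exact: cvg_cst.
    have [_ _ /(_ x Sx)] := hsg n; apply: cvg_trans; apply: near_eq_cvg.
    by near=> N; rewrite ifT//; near: N; exact: nbhs_infty_gt.
have I_cvg : (fun N => w - I N) @ \oo --> (0 : H).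
  apply: (@hnorm_dominated _ _ _ _ dot_norm _ v_complete _ _ _ _ c
      (fun n N => \int[mu]_(x in S) phi n x - if (n < N)%N then \int[mu]_(x in S) sg n N x else 0)
      (2 * J) cc).
  - by move=> N n; rewrite dotBl hw IE of_realB mulrBr.
  - apply: nearW => N n; apply: (le_trans (ler_normB _ _)); rewrite mulr_natl mulr2n lerD ?phiJ//.
    by case: ifP => _; rewrite ?normr0 ?sgJ.
  - move=> n; rewrite -[X in _ --> X](subrr (\int[mu]_(x in S) phi n x)); apply: cvgB; first exact: cvg_cst.
    have [_ sgphi sgc] := hsg n.
    have [|||||_ _ hcvg] := @dominated_convergence _ _ _ mu S mS'
      (fun N => EFin \o sg n N) (EFin \o phi n) (EFin \o G).
    + by move=> N; apply/measurable_EFinP; exact: msg.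
    + by apply/measurable_EFinP; exact: mphi.
    + by apply: aeW => x Sx; apply/fine_cvgP; split; [exact: nearW|exact: sgc].
    + exact: iG.
    + by apply: aeW => x N Sx; rewrite lee_fin; exact: le_trans (sgphi N x Sx) (phiG n x Sx).
    have phi_fin : (\int[mu]_(x in S) (EFin \o phi n) x = (\int[mu]_(x in S) phi n x)%R%:E)%E.
      by rewrite /Rintegral fineK//; exact: (integrable_fin_num mS' (phi_i n)).
    rewrite phi_fin in hcvg; move/fine_cvgP: hcvg => [_]; apply: cvg_trans; apply: near_eq_cvg.
    by near=> N; rewrite ifT//; near: N; exact: nbhs_infty_gt.
have [C hC] := cc.
have C0 : 0 <= C by have := hC 0%N; rewrite big_geq.
(* [C <= (C + 1)^2] avoids a square root. *)
have hB N x : S x -> hnorm (F x - s N x) <= (C + 1) * (2 * G x).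
  move=> Sx; have g0 : 0 <= 2 * G x by rewrite mulr_ge0 ?G0.
  apply: (hnorm_fourier_le dot_norm v_complete); first by rewrite mulr_ge0// addr_ge0.
  move=> M; apply: (@le_trans _ _ (C * (2 * G x) ^+ 2)).
    apply: (@le_trans _ _ ((\sum_(0 <= n < M) nrm (c n) ^+ 2) * (2 * G x) ^+ 2)).
      rewrite mulr_suml; apply: ler_sum => n _; rewrite aE// nrmM exprMn nrm_of_real.
      by apply: ler_wpM2l; rewrite ?sqr_ge0//; apply: lerXn2r; rewrite ?nnegrE// aG.
    by apply: ler_wpM2r; [exact: sqr_ge0|exact: hC].
  rewrite [leRHS]exprMn; apply: ler_wpM2r; first exact: sqr_ge0.
  by have := mulr_ge0 C0 C0; rewrite expr2 mulrDl mulrDr; lra.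
have mh N : measurable_fun S (fun x => hnorm (F x - s N x)).
  have m2 : measurable_fun S (fun x => hnorm (F x - s N x) ^+ 2).
    apply: (@measurable_fun_cvg _ _ _ S
      (fun M x => \sum_(0 <= n < M) nrm (c n) ^+ 2 * a n N x ^+ 2)).
      move=> M; apply: measurable_sum => n; apply: measurable_funM; first exact: measurable_cst.
      apply: measurable_funX; apply: measurable_funB; first exact: mphi.
      by case: (n < N)%N; [exact: msg|exact: measurable_cst].
    move=> x Sx; have := @parseval (F x - s N x); apply: cvg_trans; apply: near_eq_cvg.
    apply: nearW => M; apply: eq_bigr => n _.
    by rewrite aE// nrmM exprMn nrm_of_real real_normK ?num_real.
  have m3 := measurableT_comp (continuous_measurable_fun (@sqrt_continuous R)) m2.
  by apply: eq_measurable_fun m3 => x _ /=; rewrite sqrtr_sqr ger0_norm ?hnorm_ge0.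
exists w; split => //; exists s, I; split => //.
- apply: aeW => x Sx; apply/hnorm_cvgP => e e0.
  by apply: filterS ((hnorm_cvgP _ _ _).1 (s_cvg x Sx) e e0) => N; rewrite sub0r hnormN.
- have [|||||_ _ hcvg] := @dominated_convergence _ _ _ mu S mS'
      (fun N x => (hnorm (F x - s N x))%:E) (cst 0%E) (fun x => ((C + 1) * (2 * G x))%:E).
  + by move=> N; apply/measurable_EFinP; exact: mh.
  + exact: measurable_cst.
  + apply: aeW => x Sx; apply/fine_cvgP; split; first exact: nearW.
    apply/cvgrPdist_lt => e e0; apply: filterS ((hnorm_cvgP _ _ _).1 (s_cvg x Sx) e e0) => N.
    by rewrite !sub0r normrN hnormN ger0_norm ?hnorm_ge0.
  + have J2 := integrableZl mS' ((C + 1) * 2) iG.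
    by apply: eq_integrable J2 => // x _ /=; rewrite -EFinM mulrA.
  + by apply: aeW => x N Sx; rewrite lee_fin ger0_norm ?hnorm_ge0//; exact: hB.
  by move: hcvg; rewrite integral_cst// mul0e.
- apply/hnorm_cvgP => e e0.
  by apply: filterS ((hnorm_cvgP _ _ _).1 I_cvg e e0) => N; rewrite sub0r hnormN.
Unshelve. all: by end_near. Qed.
End BochnerExpansion.

(** * The modes *)

Section MeanValue.
Context {R : realType}.

Lemma lipschitz_derivative (f df : R -> R) (a b L : R) : a <= b ->
    {within `[a, b], continuous f} -> (forall x, x \in `]a, b[ -> is_derive x 1 f (df x)) ->
    (forall x, x \in `]a, b[ -> `|df x| <= L) ->
  `|f b - f a| <= L * (b - a).
Proof.
rewrite le_eqVlt => /predU1P[->|ab] cf fd fL; first by rewrite !subrr normr0 mulr0.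
have [c cab ->] := MVT ab fd cf.
by rewrite normrM (gtr0_norm (_ : 0 < b - a)) ?subr_gt0// ler_wpM2r ?subr_ge0 ?(ltW ab)// fL.
Qed.
End MeanValue.

Section Modes.
Context {R : realType}.
Local Notation mu := (@lebesgue_measure R).
Variables (rho : R) (rho_gt0 : 0 < rho) (rho_le1 : rho <= 1).
Variables (T : R) (g : R -> R) (M : R) (dg : R -> R).
Hypothesis T_gt0 : 0 < T.
Hypothesis dg_continuous : continuous dg.
Hypothesis dg_bounded : forall x, `|dg x| <= M.
Hypothesis gE : forall t, t \in `]0, T] -> g t = forcing (g 0) dg t.
Variables (lam : nat -> R).
Hypothesis lam_gt0 : 0 < lam 0%N.
Hypothesis lam_nondecreasing : forall n, lam n <= lam n.+1.
Hypothesis lam_cvg : lam n @[n --> \oo] --> +oo.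
Implicit Types (n : nat) (t x : R).

Local Notation s := (fun n => ml_kernel rho (lam n) 1).
Local Notation response := (response rho (g 0) dg).
Local Notation h := (@pow_kernel R 1).

Lemma lam_ge0th n : lam 0%N <= lam n.
Proof. by elim: n => // n /le_trans; apply. Qed.

Lemma lam_pos n : 0 < lam n.
Proof. exact: lt_le_trans (lam_ge0th n). Qed.

(** For a unit coefficient of [f], the initial value forced by [u(T) = u(0)]. *)
Definition mode_init n : R := response (lam n) T / (1 - s n T).
Definition mode n t : R := relax_sol rho (g 0) dg (lam n) (mode_init n) t.
Definition dmode n t : R := drelax_sol rho (g 0) dg (lam n) (mode_init n) t.
Definition mode_det (t0 : R) n : R := response_det rho (g 0) dg (lam n) t0 T.

Lemma one_sub_ml_gap : exists2 d : R, 0 < d & forall n, d <= 1 - s n T.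
Proof.
have [d d0 hd] := ml_kernel1_gap rho_gt0 rho_le1 lam_gt0 T_gt0.
by exists d => // n; apply: hd; exact: lam_ge0th.
Qed.

Lemma one_sub_ml_neq0 n : 1 - s n T != 0.
Proof. by have [d d0 hd] := one_sub_ml_gap; rewrite gt_eqF// (lt_le_trans d0). Qed.

Lemma one_sub_ml_le1 n : `|1 - s n T| <= 1.
Proof.
have s0 := ml_kernel1_ge0 rho_gt0 (lam_pos n) rho_le1 T.
have s1 := ml_kernel1_le1 rho_gt0 (lam_pos n) rho_le1 T.
by rewrite ger0_norm; lra.
Qed.

Lemma mittag_leffler_T n t : 0 < t -> mittag_leffler rho 1 (- lam n * t `^ rho) = s n t.
Proof. by move=> t0; rewrite /= ml_kernelE// subrr powRr0 mul1r. Qed.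

Lemma mode0 n : mode n 0 = mode_init n.
Proof.
rewrite /mode (relax_solE rho_gt0 (g 0) dg_continuous dg_bounded) conv_le0 ?addr0//.
- by move=> x; exact: pow_kernel_le0.
- by move=> x; exact: tame_le0 (tame_drelax_sol rho_gt0 _ dg_continuous dg_bounded _ _).
Qed.

Lemma mode_gt0 n t : 0 < t -> mode n t = response (lam n) t + mode_init n * s n t.
Proof. exact: relax_sol_gt0. Qed.

Lemma mode_periodic n : mode n T = mode n 0.
Proof.
rewrite mode0 mode_gt0// {2}/mode_init; have := one_sub_ml_neq0 n => d0.
by rewrite /mode_init; field.
Qed.

Lemma mode_t0 n t0 : 0 < t0 -> mode n t0 * (1 - s n T) = mode_det t0 n.
Proof.
move=> t00; rewrite mode_gt0// /mode_det /response_det /mode_init.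
by have := one_sub_ml_neq0 n => d0; field.
Qed.

Lemma u_coef_mode n t : t \in `[0, T] -> u_coef lam T rho g n t = mode n t.
Proof.
rewrite in_itv/= => /andP[t0 tT].
have ET : mittag_leffler rho 1 (- lam n * T `^ rho) = s n T by exact: mittag_leffler_T.
have bT : b_coef rho g (lam n) T = response (lam n) T.
  by apply: (b_coefE (T := T)) => //; rewrite in_itv/= T_gt0 lexx.
rewrite /u_coef ET bT -/(mode_init n); move: t0; rewrite le_eqVlt => /predU1P[<-|t0].
  by rewrite mode0 b_coef0 add0r powR0 ?gt_eqF// mulr0 mittag_leffler0 Gamma1 invr1 mulr1.
rewrite mittag_leffler_T// mode_gt0// (b_coefE (T := T) rho_gt0 dg_continuous dg_bounded gE)//.
by rewrite in_itv/= t0.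
Qed.

Lemma Delta_mode_det n t0 : 0 < t0 <= T -> Delta rho g (lam n) t0 T = mode_det t0 n.
Proof.
move=> /andP[t00 t0T]; rewrite /Delta !mittag_leffler_T// /mode_det /response_det.
rewrite !(b_coefE (T := T) rho_gt0 dg_continuous dg_bounded gE)//; rewrite in_itv/= ?t00//.
by rewrite T_gt0 lexx.
Qed.

Lemma mode_continuous n t : {for t, continuous (mode n)}.
Proof. exact: relax_sol_continuous. Qed.

Lemma mode_is_derive n t : 0 < t -> is_derive t 1 (mode n) (dmode n t).
Proof. exact: relax_sol_is_derive. Qed.

(** The gap below [1 - s T] is uniform, so the initial values inherit the order [1 / lam] of the
    response. *)
Lemma lam_mode_init_bound : exists2 B : R, 0 <= B & forall n, `|mode_init n * lam n| <= B.
Proof.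
have [d d0 hd] := one_sub_ml_gap.
have M0 := M_ge0 dg_bounded.
pose B := 2 * (`|g 0| + M * T).
have B0 : 0 <= B by rewrite mulr_ge0// addr_ge0// mulr_ge0// ltW.
exists (B / d) => [|n]; first by rewrite divr_ge0// ltW.
rewrite /mode_init mulrAC normrM normfV; apply: ler_pM => //.
  by rewrite mulrC; apply: lam_response_bound => //; [exact: lam_pos|exact: ltW].
rewrite lef_pV2 ?posrE//; first by rewrite (le_trans (hd n))// ler_norm.
by rewrite normr_gt0 one_sub_ml_neq0.
Qed.

Lemma lam_mode_bound : exists2 B : R, 0 <= B & forall n t, t \in `[0, T] -> `|lam n * mode n t| <= B.
Proof.
have [B B0 hB] := lam_mode_init_bound.
have M0 := M_ge0 dg_bounded.
exists (2 * (`|g 0| + M * T) + B) => [|n t].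
  by rewrite addr_ge0// mulr_ge0// addr_ge0// mulr_ge0// ltW.
rewrite in_itv/= => /andP[]; rewrite le_eqVlt => /predU1P[<-|t0] tT.
  rewrite mode0 mulrC (le_trans (hB n))// lerDr mulr_ge0// addr_ge0// mulr_ge0// ltW//.
rewrite mode_gt0// mulrDr (le_trans (ler_normD _ _))// lerD//.
  by apply: lam_response_bound => //; [exact: lam_pos|exact: ltW].
rewrite mulrA (mulrC (lam n)) normrM (le_trans _ (hB n))// ler_piMr//.
by rewrite ger0_norm ?ml_kernel1_le1 ?ml_kernel1_ge0// lam_pos.
Qed.

Lemma mode_bound : exists2 B : R, 0 <= B & forall n t, t \in `[0, T] -> `|mode n t| <= B.
Proof.
have [B B0 hB] := lam_mode_bound; exists (B / lam 0%N) => [|n t tT]; first by rewrite divr_ge0// ltW.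
rewrite ler_pdivlMr// (le_trans _ (hB n t tT))// mulrC normrM (gtr0_norm (lam_pos n)).
by rewrite ler_wpM2r// lam_ge0th.
Qed.

(** The constant in front of [t^(rho - 1)] is independent of [n]; this yields the majorant for the
    Bochner integral in the Caputo derivative. *)
Lemma dmode_bound : exists2 B : R, 0 <= B & forall n t, t <= T -> `|dmode n t| <= B * pow_kernel rho t.
Proof.
have [B B0 hB] := lam_mode_init_bound.
have M0 := M_ge0 dg_bounded.
have r1 : rho <= rho + 1 by rewrite lerDl.
have [C C0 hC] := pow_kernel_le T rho_gt0 r1.
exists (`|g 0| + B + M * C) => [|n t tT]; first by rewrite addr_ge0 ?addr_ge0 ?mulr_ge0.
have k0 : 0 <= pow_kernel rho t by exact: pow_kernel_ge0.
apply: (le_trans (drelax_sol_bound rho_gt0 rho_le1 _ dg_continuous dg_bounded (lam_pos n) _ (ltW T_gt0) tT)).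
rewrite [leRHS]mulrDl; apply: lerD; first by rewrite ler_wpM2r// lerD2l.
by rewrite -mulrA ler_wpM2l// hC.
Qed.

(** On [[p, T]] the kernel of [dmode_bound] is at most its value at [p]. Uniformity in [n] is what
    dominates the difference quotients of the series. *)
Lemma mode_lipschitz p : 0 < p -> exists2 L : R, 0 <= L &
  forall n t x, p <= t -> t <= T -> p <= x -> x <= T -> `|mode n t - mode n x| <= L * `|t - x|.
Proof.
move=> p0; have [B B0 hB] := dmode_bound.
have kp t : p <= t -> pow_kernel rho t <= pow_kernel rho p.
  move=> pt; have t0 := lt_le_trans p0 pt.
  rewrite !pow_kernelE// ler_wpM2r ?invr_ge0 ?(ltW (Gamma_gt0 rho_gt0))//.
  rewrite -opprB !powRN lef_pV2 ?posrE ?powR_gt0//.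
  by apply: ge0_ler_powR; rewrite ?nnegrE ?subr_ge0 ?(ltW p0) ?(ltW t0).
exists (B * pow_kernel rho p) => [|n]; first by rewrite mulr_ge0// pow_kernel_ge0.
suff hlt t x : p <= x -> x <= t -> t <= T -> `|mode n t - mode n x| <= B * pow_kernel rho p * (t - x).
  move=> t x pt tT px xT; case: (leP x t) => xt.
    by rewrite (ger0_norm (_ : 0 <= t - x)) ?subr_ge0// hlt.
  by rewrite distrC (distrC t) (gtr0_norm (_ : 0 < x - t)) ?subr_gt0// hlt// ltW.
move=> px xt tT.
apply: (@lipschitz_derivative _ (mode n) (dmode n)) => //.
- by apply: continuous_subspaceT => z; exact: mode_continuous.
- by move=> z; rewrite in_itv/= => /andP[xz _]; apply: mode_is_derive; lra.
- move=> z; rewrite in_itv/= => /andP[xz zt].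
  by rewrite (le_trans (hB n z _)) ?ler_wpM2l ?kp//; lra.
Qed.

Lemma mode_det_eventually t0 : 0 < t0 < T -> g t0 != 0 -> exists N (d : R), 0 < d /\
  forall n, (N <= n)%N -> d <= `|lam n * mode_det t0 n|.
Proof.
move=> /andP[t00 t0T] gt0.
have gt0E : g t0 = forcing (g 0) dg t0 by rewrite gE// in_itv/= t00 ltW.
have [K hK] := response_det_asymp rho_gt0 rho_le1 (g 0) dg_continuous dg_bounded t00 t0T.
have n0 : 0 < `|g t0| by rewrite normr_gt0.
(* From this threshold on the error [K / lam n] is at most half of [|g t0|]. *)
have [N _ hN] : \forall n \near \oo, 2 * (`|K| + 1) / `|g t0| <= lam n.
  have /cvgryPge := lam_cvg; exact.
exists N, (`|g t0| / 2); split; first by rewrite divr_gt0.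
move=> n /hN /= hn; have := hK _ (lam_pos n); rewrite -gt0E -/(mode_det t0 n).
set X := lam n * mode_det t0 n => hX.
have hKl : K / lam n <= `|g t0| / 2.
  rewrite ler_pdivrMr ?lam_pos//; rewrite ler_pdivrMr// in hn.
  by have := ler_norm K; move: hn; rewrite (mulrC (lam n)); lra.
have := ler_normB X (X - g t0); rewrite subKr.
have := ler_norm K; move: hX hKl; lra.
Qed.

End Modes.

(** * The inverse problem *)

Section Derivatives.
Context {R : realType}.

Lemma is_derive_derivative_within (S : set R) (f : R -> R) (t l : R) : is_derive t 1 f l ->
  derivative_within (V := R^o) (fun x : R => x) S f t l.
Proof.
move=> [df <-]; apply/cvgrPdist_lt => e e0.
have /cvgrPdist_lt/(_ _ e0)[d /= d0 hd] : h^-1 *: (f (h *: (1 : R) + t) - f t) @[h --> 0^'] -->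
  'D_1 f t by exact: df.
exists d => //= s ts st Ss.
have := hd (s - t); rewrite /ball_/= sub0r normrN distrC => /(_ ts).
rewrite subr_eq0 => /(_ st).
by rewrite /GRing.scale/= mulr1 subrK.
Qed.

(** The derivative is a limit of difference quotients with step [1 / (m + 1)]; clamping makes each
    of them a continuous function on the whole line. *)
Lemma measurable_derivative (T : R) (y dy : R -> R) : 0 < T -> {within `[0, T], continuous y} ->
  (forall x, x \in `]0, T[ -> is_derive x 1 y (dy x)) -> measurable_fun `]0, T[%classic dy.
Proof.
move=> T0 cy yd.
have cY := clamp_continuous T0 cy.
apply: (@measurable_fun_cvg _ _ _ `]0, T[%classic
    (fun m (x : R) => m.+1%:R * ((y \o clamp T) (x + m.+1%:R^-1) - (y \o clamp T) x))).
  move=> m; have mY := continuous_measurable_fun cY; apply: measurable_funTS.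
  apply: measurable_funM; first exact: measurable_cst.
  apply: measurable_funB; last exact: mY.
  by apply: (measurableT_comp mY); exact: measurable_funD.
move=> x; rewrite /= in_itv/= => /andP[x0 xT].
have xI : x \in `]0, T[ by rewrite in_itv/= x0.
have D := is_derive_derivative_within setT (yd x xI).
apply/cvgrPdist_lt => e e0.
have [d d0 hd] := derivative_within_dist D e0.
near=> m.
have m0 : 0 < m.+1%:R^-1 :> R by rewrite invr_gt0.
have md : m.+1%:R^-1 < Num.min d (T - x).
  near: m; have := @near_infty_natSinv_lt R (PosNum (_ : 0 < Num.min d (T - x))).
  by apply; rewrite lt_min d0 subr_gt0.
rewrite lt_min in md; case/andP: md => md mT.
have c1 : x + m.+1%:R^-1 \in `[0, T] by rewrite in_itv/= addr_ge0 ?(ltW m0) ?(ltW x0)// -lerBrDl ltW.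
have c2 : x \in `[0, T] by rewrite in_itv/= !ltW.
rewrite /= (clamp_id c1) (clamp_id c2).
have := hd (x + m.+1%:R^-1) I; rewrite opprD addNKr normrN gtr0_norm// addrAC subrr add0r invrK.
by apply => //; rewrite gt_eqF// ltrDl.
Unshelve. all: by end_near. Qed.
End Derivatives.

Section InverseProblem.
Context {R : realType} {k : scalar_kind}.
Local Notation K := (scalar_field R k).
Context {H : completeNormedModType K}.
Variable dot : {dot H for conj_scalar k}.
Hypothesis dot_norm : forall x : H, `|x| ^+ 2 = dot x x.
Variables (D : set H) (A : H -> H).
Hypothesis A_self_adjoint : self_adjoint dot D A.
Variables (v : nat -> H) (lam : nat -> R).
Hypothesis v_complete : complete_orthonormal dot v.
Hypothesis v_eigen : forall n, D (v n) /\ A (v n) = of_real k (lam n) *: v n.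
Hypothesis lam_gt0 : 0 < lam 0%N.
Hypothesis lam_nondecreasing : forall n, lam n <= lam n.+1.
Hypothesis lam_cvg : lam n @[n --> \oo] --> +oo.
Variables (rho : R) (rho_gt0 : 0 < rho) (rho_le1 : rho <= 1).
Variables (T : R) (g : R -> R) (M : R) (dg : R -> R).
Hypothesis T_gt0 : 0 < T.
Hypothesis g_continuous : {within `[0, T], continuous g}.
Hypothesis dg_continuous : continuous dg.
Hypothesis dg_bounded : forall x, `|dg x| <= M.
Hypothesis gE : forall t, t \in `]0, T] -> g t = forcing (g 0) dg t.
Local Notation mu := (@lebesgue_measure R).
Local Notation of_real := (@of_real R k).
Local Notation redot := (redot dot).
Local Notation mode := (mode rho T g dg lam).
Local Notation dmode := (dmode rho T g dg lam).
Local Notation summable := (@square_summable R k).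
Implicit Types (f w : H) (u : R -> H) (n : nat) (t x : R).

Lemma hnorm_sub_cvg (I : Type) (F : set_system I) (FF : Filter F) w (y : I -> H) :
  (fun i => w - y i) @ F --> (0 : H) -> y @ F --> w.
Proof.
move=> Y0; apply/hnorm_cvgP => e e0.
by apply: filterS ((hnorm_cvgP _ _ _).1 Y0 e e0) => i; rewrite sub0r hnormN.
Qed.

Lemma multiplied_exists f (a : nat -> R) (B : R) : (forall n, `|a n| <= B) ->
  exists w, forall n, dot w (v n) = dot f (v n) * of_real (a n).
Proof.
move=> aB; apply: (fourier_exists dot_norm v_complete).
apply: (@square_summable_le _ _ _ _ B 0%N) (fourier_summable dot_norm v_complete f) _ => n _.
by rewrite nrmM nrm_of_real mulrC ler_wpM2r ?nrm_ge0.
Qed.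

Lemma dominated_cvg f (I : Type) (F : set_system I) (FF : Filter F) w (y : I -> H) (b : nat -> R)
    (a : nat -> I -> R) (C : R) :
    (forall n, dot w (v n) = dot f (v n) * of_real (b n)) ->
    (forall i n, dot (y i) (v n) = dot f (v n) * of_real (a n i)) ->
    (\forall i \near F, forall n, `|b n - a n i| <= C) ->
    (forall n, a n i @[i --> F] --> b n) ->
  y @ F --> w.
Proof.
move=> wE yE aC ab; apply: hnorm_sub_cvg.
apply: (@hnorm_dominated _ _ _ _ dot_norm _ v_complete _ _ _ _ (fun n => dot f (v n))
   (fun n i => b n - a n i) C); first exact: (fourier_summable dot_norm v_complete).
- by move=> i n; rewrite dotBl wE yE of_realB mulrBr.
- exact: aC.
- by move=> n; rewrite -(subrr (b n)); apply: cvgB => //; exact: cvg_cst.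
Qed.

(** * Existence: the series of modes is a solution *)

Section Existence.
Variable f : H.

Let mode_cl n t : R := mode n (clamp T t).

Lemma mode_clamp_continuous n : continuous (mode_cl n).
Proof.
apply: (clamp_continuous (f := mode n) T_gt0); apply: continuous_subspaceT => t.
exact: mode_continuous.
Qed.

Lemma solution_exists : exists u, [/\
  forall t n, dot (u t) (v n) = dot f (v n) * of_real (mode_cl n t),
  forall t, D (u t) &
  forall t n, dot (A (u t)) (v n) = dot f (v n) * of_real (lam n * mode_cl n t)].
Proof.
have [B B0 hB] := mode_bound rho_gt0 rho_le1 g T_gt0 dg_continuous dg_bounded lam_gt0 lam_nondecreasing.
have [C C0 hC] := lam_mode_bound rho_gt0 rho_le1 g T_gt0 dg_continuous dg_bounded lam_gt0 lam_nondecreasing.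
have /choice[u hu] : forall t, exists w, forall n, dot w (v n) = dot f (v n) * of_real (mode_cl n t).
  by move=> t; apply: (@multiplied_exists _ _ B) => n; apply: hB; exact: clamp_itv.
have hA t : D (u t) /\ forall n, dot (A (u t)) (v n) = dot f (v n) * of_real (lam n * mode_cl n t).
  have [|w hw] := @multiplied_exists f (fun n => lam n * mode_cl n t) C.
    by move=> n; apply: hC; exact: clamp_itv.
  have [|Du ->] := diagonal_domain dot_norm v_complete A_self_adjoint v_eigen (x := u t) (y := w).
    by move=> n; rewrite hw hu of_realM; ring.
  by [].
by exists u; split => // [t|t]; case: (hA t).
Qed.

Variable u : R -> H.
Hypothesis uE : forall t n, dot (u t) (v n) = dot f (v n) * of_real (mode_cl n t).
Hypothesis AuE : forall t n, dot (A (u t)) (v n) = dot f (v n) * of_real (lam n * mode_cl n t).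

Lemma mode_solution_continuous : continuous u.
Proof.
have [B B0 hB] := mode_bound rho_gt0 rho_le1 g T_gt0 dg_continuous dg_bounded lam_gt0 lam_nondecreasing.
move=> t; apply: (@dominated_cvg f _ _ _ _ _ (fun n => mode_cl n t) (fun n => mode_cl n) (2 * B)).
- by move=> n; exact: uE.
- by move=> i n; exact: uE.
- apply: nearW => x n; rewrite mulr_natl mulr2n (le_trans (ler_normB _ _))//.
  by apply: lerD; apply: hB; exact: clamp_itv.
- by move=> n; exact: mode_clamp_continuous.
Qed.

Lemma operator_solution_continuous : continuous (A \o u).
Proof.
have [C C0 hC] := lam_mode_bound rho_gt0 rho_le1 g T_gt0 dg_continuous dg_bounded lam_gt0 lam_nondecreasing.
move=> t; apply: (@dominated_cvg f _ _ _ _ _ (fun n => lam n * mode_cl n t)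
  (fun n x => lam n * mode_cl n x) (2 * C)).
- by move=> n; exact: AuE.
- by move=> i n; exact: AuE.
- apply: nearW => x n; rewrite mulr_natl mulr2n (le_trans (ler_normB _ _))//.
  by apply: lerD; apply: hC; exact: clamp_itv.
- by move=> n; apply: cvgM; [exact: cvg_cst|exact: mode_clamp_continuous].
Qed.

(** Read off from the equation, so that its continuity follows from that of [A u]; that it is the
    Caputo derivative is [mode_solution_caputo]. *)
Definition caputo_solution t : H := of_real (g (clamp T t)) *: f - A (u t).

Lemma caputo_solutionE t n :
  dot (caputo_solution t) (v n) = dot f (v n) * of_real (g (clamp T t) - lam n * mode_cl n t).
Proof. by rewrite dotBl dotZl AuE of_realB; ring. Qed.

Lemma caputo_solution_continuous : continuous caputo_solution.
Proof.
have [C C0 hC] := lam_mode_bound rho_gt0 rho_le1 g T_gt0 dg_continuous dg_bounded lam_gt0 lam_nondecreasing.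
have [B hB] := clamp_bounded T_gt0 g_continuous.
have hBC x n : `|g (clamp T x) - lam n * mode_cl n x| <= B + C.
  by rewrite (le_trans (ler_normB _ _))// lerD// hC// clamp_itv.
move=> t; apply: (@dominated_cvg f _ _ _ _ _ (fun n => g (clamp T t) - lam n * mode_cl n t)
  (fun n x => g (clamp T x) - lam n * mode_cl n x) (2 * (B + C))).
- by move=> n; exact: caputo_solutionE.
- by move=> i n; exact: caputo_solutionE.
- apply: nearW => x n; rewrite mulr_natl mulr2n (le_trans (ler_normB _ _))//.
  by apply: lerD; exact: hBC.
- move=> n; apply: cvgB; first exact: (clamp_continuous T_gt0 g_continuous).
  by apply: cvgM; [exact: cvg_cst|exact: mode_clamp_continuous].
Qed.

Lemma mode_solution_derivative t w : t \in `]0, T] ->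
  (forall n, dot w (v n) = dot f (v n) * of_real (dmode n t)) ->
  derivative_within of_real `[0, T] u t w.
Proof.
rewrite in_itv/= => /andP[t0 tT] wE.
(* Difference quotients at [t] only involve points above [t / 2], where the modes are uniformly
   Lipschitz. *)
have [L L0 hL] := mode_lipschitz rho_gt0 rho_le1 g T_gt0 dg_continuous dg_bounded lam_gt0 lam_nondecreasing
  (divr_gt0 t0 (ltr0n _ 2)).
have [B B0 hB] := dmode_bound rho_gt0 rho_le1 g T_gt0 dg_continuous dg_bounded lam_gt0 lam_nondecreasing.
apply: (@dominated_cvg f _ _ _ w _ (fun n => dmode n t)
  (fun n x => (x - t)^-1 * (mode_cl n x - mode_cl n t)) (B * pow_kernel rho t + L)).
- exact: wE.
- by move=> x n; rewrite dotZl dotBl !uE of_realM of_realB; ring.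
- exists (t / 2) => /=; first by rewrite divr_gt0.
  move=> x; rewrite /ball_/= ltr_distlC => /andP[tx xt'] xt xT n.
  rewrite (le_trans (ler_normB _ _))// lerD ?hB// /mode_cl !clamp_id//; last first.
    by rewrite in_itv/= tT ltW.
  rewrite normrM normfV mulrC ler_pdivrMr ?normr_gt0 ?subr_eq0//.
  by move: xT => /=; rewrite in_itv/= => /andP[x0 xT]; apply: hL => //; lra.
- move=> n; have dm : is_derive t 1 (mode n) (dmode n t) by exact: mode_is_derive.
  have := is_derive_derivative_within `[0, T]%classic dm.
  apply: cvg_trans; apply: near_eq_cvg.
  exists 1 => //= x _ _ xT; rewrite /mode_cl !clamp_id//.
  by rewrite in_itv/= tT ltW.
Qed.

Lemma mode_solution_caputo t : t \in `]0, T] -> caputo T rho u t (caputo_solution t).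
Proof.
move=> tT; have /andP[t0 t'T] : 0 < t <= T by move: tT; rewrite in_itv.
have tT' : t \in `[0, T] by rewrite in_itv/= t'T ltW.
rewrite /caputo; case: eqP => [rho1|rho1].
  apply: mode_solution_derivative => // n; rewrite caputo_solutionE /mode_cl clamp_id// gE//.
  by rewrite /dmode (drelax_solE rho_gt0 (g 0) dg_continuous dg_bounded).
have rho_lt1 : rho < 1 by rewrite lt_neqAle rho_le1 andbT; apply/eqP.
have rho'0 : 0 < 1 - rho by rewrite subr_gt0.
have [B B0 hB] := dmode_bound rho_gt0 rho_le1 g T_gt0 dg_continuous dg_bounded lam_gt0 lam_nondecreasing.
have /choice[dh hdh] : forall x, exists w, x <= T -> forall n, dot w (v n) = dot f (v n) * of_real (dmode n x).
  move=> x; have [xT|Tx] := leP x T; last by exists 0.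
  have [|w hw] := @multiplied_exists f (fun n => dmode n x) (B * pow_kernel rho x).
    by move=> n; exact: hB.
  by exists w.
have td n : tame (dmode n) := tame_drelax_sol rho_gt0 (g 0) dg_continuous dg_bounded (lam n) _.
have G0 : 0 < Gamma (1 - rho) by exact: Gamma_gt0.
have kapE x : x \in `]0, t[ ->
    ((t - x) `^ rho)^-1 = Gamma (1 - rho) * pow_kernel (1 - rho) (t - x).
  rewrite in_itv/= => /andP[_ xt]; rewrite pow_kernelE ?subr_gt0// mulrC divfK ?gt_eqF//.
  by rewrite -powRN; congr (_ `^ _); ring.
pose phi n x := ((t - x) `^ rho)^-1 * dmode n x.
(* A majorant common to all modes, with integrable singularities at the two ends of []0, t[]. *)
pose G x := ((t - x) `^ rho)^-1 * (B * pow_kernel rho x).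
have phi_int n : \int[mu]_(x in `]0, t[) phi n x =
    Gamma (1 - rho) * (g t - lam n * mode n t).
  have <- : conv (pow_kernel (1 - rho)) (dmode n) t = g t - lam n * mode n t.
    rewrite gE//; apply: caputo_relax_sol => //; apply: lam_pos => //.
  rewrite conv_itv; [|by move=> x; exact: pow_kernel_le0|by move=> x; exact: tame_le0].
  have I : mu.-integrable `]0, t[ (EFin \o (fun x => pow_kernel (1 - rho) (t - x) * dmode n x)).
    apply: integrableS (tame_conv_int t (tame_pow_kernel rho'0) (td n)) => //.
  rewrite -RintegralZl//; apply: eq_Rintegral => x; rewrite inE/= => xt.
  by rewrite /phi kapE// mulrA.
have [|||||||w [hw wE]] := @bochner_expansion _ _ _ _ dot_norm _ v_complete `]0, t[%classic
  (fun x => of_real ((t - x) `^ rho)^-1 *: dh x) (fun n => dot f (v n)) phi G.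
- exact: measurable_itv.
- apply: (@le_lt_trans _ _ (lebesgue_measure (`]0, t[%classic : set R))) => //.
  by rewrite lebesgue_measure_itv/= lte_fin t0 -EFinB ltry.
- exact: (fourier_summable dot_norm v_complete).
- move=> x /=; rewrite in_itv/= => /andP[x0 xt] n; rewrite dotZl hdh; last first.
    by rewrite ltW// (lt_le_trans xt).
  by rewrite /phi of_realM; ring.
- move=> n; have mG := measurable_conv_integrand1 t (measurable_pow_kernel (1 - rho)) (tame_measurable (td n)).
  have mG' := measurable_funM (measurable_cst (Gamma (1 - rho))) mG.
  apply: eq_measurable_fun (measurable_funTS mG') => x; rewrite inE/= => xt.
  by rewrite /phi kapE// mulrA.
- move=> n x /=; rewrite in_itv/= => /andP[x0 xt].
  rewrite /phi /G normrM ger0_norm ?invr_ge0 ?powR_ge0// ler_wpM2l ?invr_ge0 ?powR_ge0// hB//.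
  by rewrite ltW// (lt_le_trans xt).
- have I : mu.-integrable `]0, t[ (EFin \o (fun x => pow_kernel (1 - rho) (t - x) * pow_kernel rho x)).
    exact: integrableS (pow_kernel_conv_int t rho'0 rho_gt0).
  have I2 : mu.-integrable `]0, t[ (fun x => (Gamma (1 - rho) * B)%:E *
      (pow_kernel (1 - rho) (t - x) * pow_kernel rho x)%:E)%E by exact: integrableZl.
  apply: eq_integrable I2 => // x; rewrite inE/= => xt.
  by rewrite /G kapE// -EFinM; congr EFin; ring.
exists dh, w; split => //.
- move=> x; rewrite in_itv/= => /andP[x0 xt].
  have xT : x <= T by rewrite ltW// (lt_le_trans xt).
  by apply: mode_solution_derivative; [rewrite in_itv/= x0|exact: hdh].
- apply: (fourier_inj v_complete) => n; rewrite dotZl wE phi_int caputo_solutionE.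
  rewrite /mode_cl clamp_id// of_realM of_realV [in RHS](mulrCA (dot f (v n))) mulKf//.
  by rewrite -of_real0 (inj_eq (@of_real_inj R k)) gt_eqF.
Qed.

End Existence.

(** * Uniqueness: the coefficients of a given solution *)

Section Uniqueness.
Variables (t0 : R) (psi : H) (u : R -> H) (f : H).
Hypothesis u_solution : inverse_solution D A T t0 rho g psi u f.

Lemma redot_continuous (y : H) : hnorm y <= 1 -> {within `[0, T], continuous (fun t => redot (u t) y)}.
Proof.
case: u_solution => /subspace_continuousP cu _ _ _ _ y1.
apply/subspace_continuousP => t tT; apply/cvgrPdist_lt => e e0.
apply: filterS ((hnorm_cvgP _ _ _).1 (cu t tT) e e0) => s; apply: le_lt_trans.
by rewrite -redotB; exact: redot_le.
Qed.

Lemma redot_is_derive (y : H) t w : hnorm y <= 1 -> t \in `]0, T[ ->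
  derivative_within of_real `[0, T] u t w -> is_derive t 1 (fun x => redot (u x) y) (redot w y).
Proof.
move=> y1 tT hw; apply: (derivative_within_is_derive (S := `[0, T]%classic)).
  by apply: filterS (near_in_itvoo tT) => z /=; exact: subset_itvW.
apply/cvgrPdist_lt => e e0; apply: filterS ((hnorm_cvgP _ _ _).1 hw e e0) => s; apply: le_lt_trans.
rewrite /GRing.scale/= -redotB -redotZ -redotB; exact: redot_le.
Qed.

(** The real part of the pairing with [b v_n] solves the real scalar equation with [lam n]; letting
    [b] vary over the unit ball recovers the full coefficient through [redot_coef]. *)
Lemma redot_solution n (b : K) : nrm b <= 1 -> forall t, t \in `]0, T] ->
  redot (u t) (b *: v n) = redot (u 0) (b *: v n) * ml_kernel rho (lam n) 1 t +
    redot f (b *: v n) * response rho (g 0) dg (lam n) t.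
Proof.
move=> b1; set y := b *: v n; have y1 : hnorm y <= 1 by exact: hnorm_unit.
have cy := redot_continuous y1.
case: u_solution => _ hD _ [Du [hDu _ hE]] _.
have Dut t : t \in `]0, T] ->
    redot (Du t) y = redot f y * forcing (g 0) dg t - lam n * redot (u t) y.
  move=> tT; rewrite -gE// [redot f y * _]mulrC -(redotZ dot (g t) f y) -hE// redotD.
  rewrite [redot (A _) _]redot_basis (dot_eigen A_self_adjoint v_eigen)//; last exact: hD.
  by rewrite mulrCA re_of_realM -redot_basis addrK.
have [rho1|rho1] := eqVneq rho 1.
  apply: (derivative_uniqueness (y := fun t => redot (u t) y) (dy := fun t => redot (Du t) y)
    rho_gt0 dg_continuous dg_bounded T_gt0 cy) => //.
    move=> x xT; have xT' : x \in `]0, T] by apply: subset_itvW xT.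
    apply: redot_is_derive => //; have := hDu x xT'.
    by rewrite /caputo rho1 eqxx.
  by move=> x xT; apply: Dut; apply: subset_itvW xT.
have rho_lt1 : rho < 1 by rewrite lt_neqAle rho1.
have hC t : t \in `]0, T] -> exists (dh : R -> H) (J : H),
    [/\ forall x, x \in `]0, t[ -> derivative_within of_real `[0, T] u x (dh x),
        bochner_integral `]0, t[ (fun x => of_real (((t - x) `^ rho)^-1) *: dh x) J
      & Du t = of_real ((Gamma (1 - rho))^-1) *: J].
  by move=> tT; have := hDu t tT; rewrite /caputo (negbTE rho1).
(* In [caputo] the function [dh] depends on [t]; the derivative of the pairing is one function that
   agrees with all of them. *)
pose dy x := 'D_1 (fun x => redot (u x) y) x.
have sub t x : t \in `]0, T] -> x \in `]0, t[ -> x \in `]0, T[.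
  by rewrite !in_itv/= => /andP[_ tT] /andP[-> xt]; exact: lt_le_trans tT.
have dyE x : x \in `]0, T[ -> is_derive x 1 (fun x => redot (u x) y) (dy x).
  move=> xT; have [|dh [J [hdh _ _]]] := hC T; first by rewrite in_itv/= T_gt0 lexx.
  by have hd := redot_is_derive y1 xT (hdh x xT); apply: derivableP; exact: ex_derive.
have mdy := measurable_derivative T_gt0 cy dyE.
apply: (caputo_uniqueness (y := fun t => redot (u t) y) (dy := dy)
    rho_gt0 dg_continuous dg_bounded T_gt0 cy) => // t tT.
have [dh [J [hdh hJ DuE]]] := hC t tT.
have FE x : x \in `]0, t[ -> redot (of_real (((t - x) `^ rho)^-1) *: dh x) y = ((t - x) `^ rho)^-1 * dy x.
  move=> xt; rewrite redotZ; congr (_ * _).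
  by have hd := redot_is_derive y1 (sub t x tT xt) (hdh x xt); rewrite /dy derive_val.
have mF : measurable_fun `]0, t[%classic
    (fun x : R => redot (of_real (((t - x) `^ rho)^-1) *: dh x) y).
  have mw : measurable_fun setT (fun x : R => (t - x) `^ (- rho)).
    by apply: (measurableT_comp (measurable_powR _)); exact: measurable_funB.
  have mdy' : measurable_fun `]0, t[%classic dy.
    by apply: measurable_funS mdy => // x /= xt; exact: sub tT xt.
  apply: eq_measurable_fun (measurable_funM (measurable_funTS mw) mdy') => x.
  by rewrite inE/= => xt; rewrite FE// powRN.
have [I IE] := bochner_pairing dot_norm (measurable_itv `]0, t[) hJ y1 mF.
split.
  by apply: eq_integrable I => // x; rewrite inE/= => xt; rewrite FE.
rewrite -Dut// DuE redotZ; congr (_ * _); rewrite -IE.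
by apply: eq_Rintegral => x; rewrite inE/= => xt; rewrite FE.
Qed.

Lemma solution_coef n t : t \in `]0, T] ->
  dot (u t) (v n) = dot (u 0) (v n) * of_real (ml_kernel rho (lam n) 1 t) +
    dot f (v n) * of_real (response rho (g 0) dg (lam n) t).
Proof.
move=> tT; apply: redot_coef => b b1; rewrite redot_solution//.
rewrite !redot_basis mulrDr reD; congr (_ + _).
  by rewrite [_ * of_real _]mulrC mulrCA re_of_realM mulrC.
by rewrite [_ * of_real _]mulrC mulrCA re_of_realM mulrC.
Qed.

Lemma solution_mode n t : t \in `[0, T] -> dot (u t) (v n) = dot f (v n) * of_real (mode n t).
Proof.
have TI : T \in `]0, T] by rewrite in_itv/= T_gt0 lexx.
have d0 := one_sub_ml_neq0 rho_gt0 rho_le1 T_gt0 lam_gt0 lam_nondecreasing n.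
have d0' : of_real (1 - ml_kernel rho (lam n) 1 T) != 0.
  by rewrite -of_real0 (inj_eq (@of_real_inj R k)).
(* Periodicity is a linear equation for the coefficient of [u 0], solvable because [1 - s T] is
   nonzero. *)
have u0E : dot (u 0) (v n) = dot f (v n) * of_real (mode_init rho T g dg lam n).
  have := solution_coef n TI; case: u_solution => _ _ _ _ [-> _] h.
  apply: (mulIf d0'); rewrite -mulrA -of_realM /mode_init divfK// of_realB of_real1 mulrBr mulr1.
  by apply/eqP; rewrite subr_eq addrC; apply/eqP.
rewrite in_itv/= => /andP[]; rewrite le_eqVlt => /predU1P[<-|t0'] tT.
  by rewrite u0E (mode0 rho_gt0 T g dg_continuous dg_bounded).
rewrite solution_coef ?in_itv/= ?t0'// u0E (mode_gt0 rho_gt0)//.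
by rewrite of_realD of_realM mulrDr -mulrA addrC.
Qed.

Lemma solution_det n : 0 < t0 < T ->
  dot f (v n) * of_real (mode_det rho T g dg lam t0 n) =
  dot psi (v n) * of_real (1 - ml_kernel rho (lam n) 1 T).
Proof.
move=> /andP[t00 t0T]; case: (u_solution) => _ _ _ _ [_ <-].
rewrite solution_mode ?in_itv/= ?ltW// -mulrA -of_realM; congr (_ * of_real _); apply/esym.
exact: mode_t0.
Qed.

End Uniqueness.
Lemma derivative_within_eq (h h' : R -> H) t w : {in `[0, T], h =1 h'} -> t \in `[0, T] ->
  derivative_within of_real `[0, T] h t w -> derivative_within of_real `[0, T] h' t w.
Proof.
move=> hh' tT; apply: cvg_trans; apply: near_eq_cvg.
by exists 1 => //= s _ _ sT; rewrite !hh'.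
Qed.

Lemma inverse_solution_eq (t0 : R) (psi : H) u u' f : 0 < t0 < T -> {in `[0, T], u =1 u'} ->
  inverse_solution D A T t0 rho g psi u f -> inverse_solution D A T t0 rho g psi u' f.
Proof.
move=> /andP[t00 t0T] uu' [cu hD cA [Du [hDu cDu hE]] [uT ut0]].
have sub t : t \in `]0, T] -> t \in `[0, T] by rewrite !in_itv/= => /andP[/ltW -> ->].
have I0 : 0 \in `[0, T] by rewrite in_itv/= lexx ltW.
have IT : T \in `[0, T] by rewrite in_itv/= lexx ltW.
have It : t0 \in `[0, T] by rewrite in_itv/= !ltW.
split.
- by apply: subspace_eq_continuous cu => t; rewrite inE/= => tT; exact: uu'.
- by move=> t tT; rewrite -uu'; [exact: hD|exact: sub].
- by apply: subspace_eq_continuous cA => t; rewrite inE/= => tT; exact: (congr1 A (uu' t (sub t tT))).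
- exists Du; split => // t tT; last by rewrite -uu'; [exact: hE|exact: sub].
  have := hDu t tT; rewrite /caputo; case: ifP => _.
    by apply: derivative_within_eq => //; exact: sub.
  move=> [dh [J [hdh hJ DuE]]]; exists dh, J; split => // x xt.
  apply: derivative_within_eq (hdh x xt) => //.
  move: xt tT; rewrite !in_itv/= => /andP[x0 xt] /andP[_ tT].
  by rewrite (ltW x0) ltW// (lt_le_trans xt).
- by rewrite -!uu'.
Qed.

(** Decouples the problem into one scalar equation per mode for [f] and a formula for [u]. For the
    converse, the solution built from [f] agrees with [u] on [[0, T]], which is all that the
    definition sees. *)
Lemma inverse_solutionP (t0 : R) (psi : H) u f : 0 < t0 < T ->
  inverse_solution D A T t0 rho g psi u f <->
  (forall n, dot f (v n) * of_real (mode_det rho T g dg lam t0 n) =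
    dot psi (v n) * of_real (1 - ml_kernel rho (lam n) 1 T)) /\
  forall t n, t \in `[0, T] -> dot (u t) (v n) = dot f (v n) * of_real (mode n t).
Proof.
move=> t0T; split=> [sol|[hdet hu]].
  by split=> [n|t n]; [exact: (solution_det sol)|exact: (solution_mode sol)].
have [u' [uE uD AuE]] := solution_exists f.
apply: (@inverse_solution_eq t0 psi u' u) => //.
  move=> t tT; apply: (fourier_inj v_complete) => n.
  by rewrite uE hu// clamp_id.
have clT t : t \in `]0, T] -> clamp T t = t
  by rewrite in_itv/= => /andP[x0 xT]; rewrite clamp_id// in_itv/= ltW.
have /andP[t00 t0T'] := t0T.
split.
- by apply: continuous_subspaceT; exact: mode_solution_continuous.
- by move=> t _; exact: uD.
- by apply: continuous_subspaceT; exact: operator_solution_continuous.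
- exists (caputo_solution f u'); split.
  + by move=> t; exact: mode_solution_caputo.
  + by apply: continuous_subspaceT; exact: caputo_solution_continuous.
  + by move=> t tT; rewrite /caputo_solution subrK clT.
- split; apply: (fourier_inj v_complete) => n; rewrite !uE.
    rewrite !clamp_id ?in_itv/= ?lexx ?ltW//; congr (_ * of_real _).
    exact: mode_periodic.
  have d0 := one_sub_ml_neq0 rho_gt0 rho_le1 T_gt0 lam_gt0 lam_nondecreasing n.
  have d0' : of_real (1 - ml_kernel rho (lam n) 1 T) != 0.
    by rewrite -of_real0 (inj_eq (@of_real_inj R k)).
  apply: (mulIf d0'); rewrite -hdet clamp_id ?in_itv/= ?ltW// -mulrA -of_realM; congr (_ * of_real _).
  exact: mode_t0.
Qed.

(** * The two assertions, coefficient by coefficient *)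

Section Assertions.
Variables (t0 : R) (psi : H).
Hypothesis t0_itv : 0 < t0 < T.
Hypothesis g_t0 : g t0 != 0.
Hypothesis D_psi : D psi.
Local Notation solution := (inverse_solution D A T t0 rho g psi).
Local Notation K0 := (K0 lam T t0 rho g).
Local Notation f_coef := (f_coef dot v lam T t0 rho g psi).
Local Notation u_coef := (u_coef lam T rho g).

Lemma Delta_det n : Delta rho g (lam n) t0 T = mode_det rho T g dg lam t0 n.
Proof.
apply: (Delta_mode_det rho_gt0 T_gt0 dg_continuous dg_bounded gE) => //.
by case/andP: t0_itv => -> /ltW ->.
Qed.

Lemma f_coefE n : f_coef n = dot psi (v n) * of_real (1 - ml_kernel rho (lam n) 1 T) /
  of_real (mode_det rho T g dg lam t0 n).
Proof. by rewrite /f_coef Delta_det mittag_leffler_T. Qed.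

Lemma u_coefE n t : t \in `[0, T] -> u_coef n t = mode n t.
Proof. by move=> tT; exact: u_coef_mode. Qed.

Lemma mem_K0 n : (n \in K0) = (mode_det rho T g dg lam t0 n == 0).
Proof.
by apply/idP/eqP; rewrite inE /K0/= Delta_det.
Qed.

(** From some index on, [n] lies outside [K0] and [f_coef n] is at most a constant times the
    coefficient [lam_n psi_n] of [A psi]; so [c] contributes finitely many terms only. *)
Lemma coef_summable (c : nat -> K) : summable (fun n => if n \in K0 then c n else f_coef n).
Proof.
have [N [d [d0 hd]]] := mode_det_eventually rho_gt0 rho_le1 dg_continuous dg_bounded gE lam_gt0 lam_nondecreasing lam_cvg t0_itv g_t0.
apply: (@square_summable_le _ _ (fun n => dot (A psi) (v n)) _ d^-1 N).
  exact: (fourier_summable dot_norm v_complete).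
move=> n /hd dn; rewrite mem_K0; case: eqP => [m0|/eqP m0].
  by move: dn; rewrite m0 mulr0 normr0 leNgt d0.
rewrite f_coefE (dot_eigen A_self_adjoint v_eigen)// !nrmM.
have -> : nrm (of_real (mode_det rho T g dg lam t0 n))^-1 = `|mode_det rho T g dg lam t0 n|^-1.
  by rewrite -of_realV nrm_of_real normfV.
rewrite !nrm_of_real (gtr0_norm (lam_pos lam_gt0 lam_nondecreasing n)).
have hdet : `|mode_det rho T g dg lam t0 n|^-1 <= d^-1 * lam n.
  rewrite mulrC ler_pdivlMr// mulrC ler_pdivrMr ?normr_gt0//.
  by move: dn; rewrite normrM (gtr0_norm (lam_pos lam_gt0 lam_nondecreasing n)).
rewrite [d^-1 * _]mulrA -mulrA mulrC; apply: ler_wpM2r; first exact: nrm_ge0.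
apply: le_trans hdet; rewrite ler_piMl ?invr_ge0//.
exact: (one_sub_ml_le1 rho_gt0 rho_le1 T lam_gt0 lam_nondecreasing).
Qed.

Lemma solution_formulaP (c : nat -> K) u f :
  solution_formula dot v lam T t0 rho g psi c u f <->
  (forall n, dot f (v n) = if n \in K0 then c n else f_coef n) /\
  forall t n, t \in `[0, T] -> dot (u t) (v n) = dot f (v n) * of_real (mode n t).
Proof.
have EP := expansion_onP dot_norm v_complete.
split=> [[[f1 [f2 [/EP hf1 /EP hf2 fE]]] hu]|[hf hu]].
  have hf n : dot f (v n) = if n \in K0 then c n else f_coef n.
    by rewrite fE dotDl hf1 hf2 in_setC; case: (n \in K0); rewrite /= ?add0r ?addr0.
  split=> // t n tT; have /EP := hu t tT => ->.
  by rewrite in_setT hf u_coefE//; case: (n \in K0).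
split; last first.
  by move=> t tT; apply/EP => n; rewrite in_setT hu// hf u_coefE//; case: (n \in K0).
have [f1 hf1] : exists f1, forall n, dot f1 (v n) = if n \in ~` K0 then f_coef n else 0.
  have [f1 h1] := fourier_exists dot_norm v_complete (coef_summable (fun=> 0)).
  by exists f1 => n; rewrite h1 in_setC; case: (n \in K0).
exists f1, (f - f1); split; [exact/EP| |by rewrite addrC subrK].
by apply/EP => n; rewrite dotBl hf hf1 in_setC; case: (n \in K0); rewrite /= ?subr0 ?subrr.
Qed.

Lemma det_neq0_coef n (z : K) : n \notin K0 ->
  z * of_real (mode_det rho T g dg lam t0 n) = dot psi (v n) * of_real (1 - ml_kernel rho (lam n) 1 T) <->
  z = f_coef n.
Proof.
rewrite mem_K0 => d0; have d0' : of_real (mode_det rho T g dg lam t0 n) != 0.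
  by rewrite -of_real0 (inj_eq (@of_real_inj R k)).
rewrite f_coefE; split=> [<-|->]; first by rewrite mulfK.
by rewrite divfK.
Qed.

(** The equation reads [0 = psi_n (1 - s T)] with [1 - s T] nonzero: it constrains [psi_n] and
    leaves [z] free. *)
Lemma det_eq0_coef n (z : K) : n \in K0 ->
  z * of_real (mode_det rho T g dg lam t0 n) = dot psi (v n) * of_real (1 - ml_kernel rho (lam n) 1 T) <->
  dot psi (v n) = 0.
Proof.
rewrite mem_K0 => /eqP ->; rewrite of_real0 mulr0; split=> [/esym/eqP|->]; last by rewrite mul0r.
rewrite mulf_eq0 => /orP[/eqP //|].
rewrite -of_real0 (inj_eq (@of_real_inj R k)) (negbTE (one_sub_ml_neq0 _ _ _ _ _ _))//.
Qed.

Lemma assertions_hold : assertion1 dot D A v lam T t0 rho g psi /\ assertion2 dot D A v lam T t0 rho g psi.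
Proof.
have SP u f := inverse_solutionP psi u f t0_itv.
have FE (c : nat -> K) : exists u f, solution_formula dot v lam T t0 rho g psi c u f.
  have [f hf] := fourier_exists dot_norm v_complete (coef_summable c).
  have [u [uE _ _]] := solution_exists f.
  by exists u, f; apply/solution_formulaP; split => // t n tT; rewrite uE clamp_id.
have FS (c : nat -> K) u f : (forall n, K0 n -> dot psi (v n) = 0) ->
    solution_formula dot v lam T t0 rho g psi c u f -> solution u f.
  move=> h0 /solution_formulaP[hf hu]; apply/SP; split => // n.
  have [nK|nK] := boolP (n \in K0).
    by apply/(det_eq0_coef _ nK); apply: h0; rewrite inE in nK.
  by apply/(det_neq0_coef _ nK); rewrite hf (negbTE nK).
have SF u f : solution u f -> solution_formula dot v lam T t0 rho g psi (fun n => dot f (v n)) u f.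
  move=> /SP[hdet hu]; apply/solution_formulaP; split => // n.
  by case: ifPn => // nK; apply/(det_neq0_coef _ nK).
have S0 u f : solution u f -> forall n, K0 n -> dot psi (v n) = 0.
  move=> /SP[hdet _] n nK; have nK' : n \in K0 by rewrite inE.
  exact: (det_eq0_coef _ nK').1 (hdet n).
split=> [K00|[n0 K0n0]].
  have nK n : (n \in K0) = false by rewrite K00 in_set0.
  have [u [f huf]] := FE (fun=> 0).
  have sol : solution u f by apply: FS huf => n; rewrite K00.
  have /solution_formulaP[hf hu] := huf.
  exists u, f; split => //.
  - move=> u' f' /SF/solution_formulaP[hf' hu'].
    have ff : f' = f by apply: (fourier_inj v_complete) => n; rewrite hf hf' nK.
    by split=> // t tT; apply: (fourier_inj v_complete) => n; rewrite hu' ?hu ?ff.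
  - by apply/(expansion_onP dot_norm v_complete) => n; rewrite in_setT hf nK.
  - move=> t tT; apply/(expansion_onP dot_norm v_complete) => n.
    by rewrite in_setT hu// hf nK u_coefE.
split; first split=> [[u [f /S0]]//|h0].
  by have [u [f huf]] := FE (fun=> 0); exists u, f; exact: FS huf.
move=> h0; split.
(* The choices 0 and 1 on [K0] give different [f], as the index [n0] shows. *)
- have [u1 [f1 h1]] := FE (fun=> 0); have [u2 [f2 h2]] := FE (fun=> 1).
  exists u1, f1, u2, f2; split; [exact: FS h1|exact: FS h2|move=> [_ f12]].
  have /solution_formulaP[/(_ n0) + _] := h1; have /solution_formulaP[/(_ n0) + _] := h2.
  rewrite f12 mem_set// => -> /eqP; rewrite oner_eq0//.
- exact: FE.
- by move=> u f; split=> [/SF ?|[c /(FS _ _ _ h0)]//]; exists (fun n => dot f (v n)).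
Qed.
End Assertions.

End InverseProblem.

Section SmallTime.
Context {R : realType}.
Implicit Types (T : R) (g : R -> R).

Lemma C1_on_continuous T g : C1_on T g -> {within `[0, T], continuous g}.
Proof.
move=> [dg [gd _]]; apply: derivative_within_continuous => t tT.
by exists (dg t); exact: gd.
Qed.

Lemma C1_onW T' T g : T <= T' -> C1_on T' g -> C1_on T g.
Proof.
move=> TT' [dg [gd cdg]].
have sub : `[0, T]%classic `<=` `[0, T']%classic.
  by move=> t /=; rewrite !in_itv/= => /andP[-> /le_trans]; apply.
exists dg; split; last exact: continuous_subspaceW cdg.
move=> t tT; have hg := gd t (sub t tT).
apply/cvgrPdist_lt => e e0; have [d d0 hd] := derivative_within_dist hg e0.
by exists d => //= s ts st sT; apply: hd => //; exact: sub.
Qed.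

Lemma C1_on_neq0 T g : 0 < T -> C1_on T g -> g 0 != 0 ->
  exists T0 : R, 0 < T0 <= T /\ forall t, 0 <= t <= T0 -> g t != 0.
Proof.
move=> T_gt0 /C1_on_continuous cg g00.
have n0 : 0 < `|g 0| by rewrite normr_gt0.
have [|d d0 hd] := within_continuous_dist cg _ n0 (x := 0).
  by rewrite /= in_itv/= lexx ltW.
exists (Num.min T (d / 2)); rewrite lt_min T_gt0 divr_gt0//=; split; first by rewrite ge_min lexx.
move=> t /andP[t0]; rewrite le_min => /andP[tT td].
have := hd t; rewrite sub0r normrN ger0_norm// => /(_ _ _)/wrap[].
- by rewrite /= in_itv/= t0.
- by lra.
by apply: contraTneq => ->; rewrite subr0 ltxx.
Qed.
End SmallTime.

Theorem theorem3p9 (R : realType) (k : scalar_kind)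
  (H : completeNormedModType (scalar_field R k)) (dot : {dot H for conj_scalar k})
  (dot_norm : forall x : H, `|x| ^+ 2 = dot x x)
  (H_separable : separable_space H)
  (D : set H) (A : H -> H)
  (A_self_adjoint : self_adjoint dot D A)
  (A_positive : positive_operator dot D A)
  (A_compact_inverse : compact_inverse D A)
  (v : nat -> H) (lam : nat -> R)
  (v_complete : complete_orthonormal dot v)
  (v_eigen : forall n, D (v n) /\ A (v n) = of_real k (lam n) *: v n)
  (lam_gt0 : 0 < lam 0%N)
  (lam_nondecreasing : forall n, lam n <= lam n.+1)
  (lam_cvg : lam n @[n --> \oo] --> +oo) :
  (forall (T : R) (g : R -> R) (t0 : R) (psi : H),
     0 < T -> C1_on T g -> g T != 0 -> 0 < t0 < T -> 0 < g t0 * g T -> D psi ->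
     assertion1 dot D A v lam T t0 1 g psi /\
     assertion2 dot D A v lam T t0 1 g psi) /\
  (forall (rho Tbar : R) (g : R -> R),
     0 < rho < 1 -> 0 < Tbar -> C1_on Tbar g -> g 0 != 0 ->
     exists T0 : R, 0 < T0 <= Tbar /\
       forall (T t0 : R) (psi : H),
         0 < T <= T0 -> 0 < t0 < T -> D psi ->
         assertion1 dot D A v lam T t0 rho g psi /\
         assertion2 dot D A v lam T t0 rho g psi).
Proof.
(* Common to both cases, which differ in how [g t0 != 0] is obtained: from the sign condition, or
   from the choice of [T0]. *)
have core (rho T t0 : R) (g : R -> R) (psi : H) : 0 < rho -> rho <= 1 -> 0 < T -> C1_on T g ->
    0 < t0 < T -> g t0 != 0 -> D psi ->
    assertion1 dot D A v lam T t0 rho g psi /\ assertion2 dot D A v lam T t0 rho g psi.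
  move=> rho0 rho1 T0 gC1 t0T gt0 Dpsi.
  have [M [dg [cdg hM gE]]] := C1_on_forcing T0 gC1.
  exact: (assertions_hold dot_norm A_self_adjoint v_complete v_eigen lam_gt0 lam_nondecreasing
    lam_cvg rho0 rho1 T0 (C1_on_continuous gC1) cdg hM gE).
split=> [T g t0 psi T0 gC1 gT t0T gt0T Dpsi|rho Tbar g /andP[rho0 rho1] Tbar0 gC1 g0].
  apply: core => //; apply: contraTneq gt0T => ->; by rewrite mul0r ltxx.
have [T0 [T0_itv hg]] := C1_on_neq0 Tbar0 gC1 g0.
exists T0; split => // T t0 psi /andP[T_gt0 TT0] t0T Dpsi.
have /andP[t00 t0T'] := t0T; have /andP[_ T0T] := T0_itv.
apply: core => //; first exact: ltW.
  by apply: C1_onW gC1; exact: le_trans TT0 T0T.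
by apply: hg; rewrite (ltW t00)/= (le_trans (ltW t0T')).
Qed.
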